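(* Let $0\le k<\infty$, $z_0\in\mathbb{D}\setminus\{0\}$, and let $\lambda\in\mathbb{C}$ be such that $|\lambda|\le\alpha_{k1}/2$. Let $\gamma_1=2\lambda/\alpha_{k1}$ and $$V_{k\text{-}\mathcal{UCV}}(z_0,\lambda)=\{\log f'(z_0): f\in k\text{-}\mathcal{UCV}\text{ with }a_2(f)=\lambda\}.$$ (i) If $|\gamma_1|=1$ then $V_{k\text{-}\mathcal{UCV}}(z_0,\lambda)=\{w_0\}$, where $w_0=\int_0^{z_0}\zeta^{-1}\{P_k(\gamma_1\zeta)-1\}\, d\zeta$. (ii) If $|\gamma_1|<1$ then $V_{k\text{-}\mathcal{UCV}}(z_0,\lambda)=Q_{\gamma_1}(z_0,\overline{\mathbb{D}}):=\{Q_{\gamma_1}(z_0,\varepsilon):\varepsilon\in\overline{\mathbb{D}}\}$, where for $z\in\mathbb{D}$ and $\varepsilon\in\overline{\mathbb{D}}$ $$Q_{\gamma_1}(z,\varepsilon)=\int_0^{z}\zeta^{-1}\left\{P_k\left(\zeta\,\frac{\varepsilon\zeta+\gamma_1}{1+\overline{\gamma_1}\varepsilon\zeta}\right)-1\right\} d\zeta ,$$ and $Q_{\gamma_1}(z_0,\varepsilon)$ is a convex, univalent and analytic function of $\varepsilon\in\overline{\mathbb{D}}$. Furthermore, for $\varepsilon\in\partial\mathbb{D}$ and $f\in k\text{-}\mathcal{UCV}$ with $a_2(f)=\lambda$, the equality $\log f'(z_0)=Q_{\gamma_1}(z_0,\varepsilon)$ holds if, and only if, $$f(z)=\int_0^z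 e^{Q_{\gamma_1}(\zeta,\varepsilon)}\, d\zeta,\quad z\in\mathbb{D}.$$
   Context: $\mathbb{D}=\{z\in\mathbb{C}:|z|<1\}$, with closure $\overline{\mathbb{D}}$. For $0\le k<\infty$ let $\Omega_k=\{w\in\mathbb{C}:\operatorname{Re}w>k|w-1|\}$, a convex domain containing $1$. The class $k\text{-}\mathcal{UCV}$ of $k$-uniformly convex functions consists of all analytic $f$ in $\mathbb{D}$ with $f(0)=f'(0)-1=0$ such that $1+zf''(z)/f'(z)$ is analytic in $\mathbb{D}$ (so $f'$ has no zeros) and takes values in $\Omega_k$. $P_k$ is the conformal map (analytic bijection) of $\mathbb{D}$ onto $\Omega_k$ with $P_k(0)=1$ and $P_k'(0)>0$, with expansion $P_k(z)=1+\alpha_{k1}z+\alpha_{k2}z^2+\cdots$, so $\alpha_{k1}=P_k'(0)>0$. (Explicitly, $P_k(z)=\frac{1}{1-k^2}\cosh\left(A\log\frac{1+\sqrt z}{1-\sqrt z}\right)-\frac{k^2}{1-k^2}$ with $A=\frac{2}{\pi}\arccos k$ and $\alpha_{k1}=\frac{2A^2}{1-k^2}$ for $0\le k<1$; $P_1(z)=1+\frac{2}{\pi^2}\left(\log\frac{1+\sqrt z}{1-\sqrt z}\right)^2$ and $\alpha_{11}=8/\pi^2$ for $k=1$; for $k>1$ it is given by an expression involving an elliptic integral.) $\log f'$ is the single-valued analytic branch of the logarithm of $f'$ in $\mathbb{D}$ with $\log f'(0)=0$. $a_2(f)=f''(0)/2$. ''Convex, univalent and analytic function of $\varepsilon\in\overline{\mathbb{D}}$''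 means: analytic in a neighbourhood of $\overline{\mathbb{D}}$, injective on $\overline{\mathbb{D}}$, and mapping $\mathbb{D}$ onto a convex domain. Integrands $\zeta^{-1}\{\cdot\}$ have removable singularities at $0$. *)

(* Defs.v *)
From Stdlib Require Export Reals ClassicalEpsilon.
From Coquelicot Require Export Coquelicot.

Open Scope R_scope.

Definition unit_disc (z : C) : Prop := Cmod z < 1.
Definition closed_unit_disc (z : C) : Prop := Cmod z <= 1.

(* Complex differentiability at every point; only used for open [U].
   Functions are total, but only their values on [U] matter. *)
Definition holomorphic_on (U : C -> Prop) (f : C -> C) : Prop :=
  forall z : C, U z -> ex_derive (K := C_AbsRing) (V := C_NormedModule) f z.

Definition injective_on (U : C -> Prop) (f : C -> C) : Prop :=
  forall z1 z2 : C, U z1 -> U z2 -> f z1 = f z2 -> z1 = z2.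

Definition image (f : C -> C) (U : C -> Prop) (w : C) : Prop :=
  exists z : C, U z /\ w = f z.

Definition convex_set (S : C -> Prop) : Prop :=
  forall (w1 w2 : C) (t : R), S w1 -> S w2 -> 0 <= t <= 1 ->
    S (RtoC (1 - t) * w1 + RtoC t * w2)%C.

(* Connectedness, part of being a domain, follows from convexity. *)
Definition convex_domain (S : C -> Prop) : Prop :=
  open (T := C_UniformSpace) S /\ (exists w : C, S w) /\ convex_set S.

Definition convex_univalent_analytic_on_closed_disc (F : C -> C) : Prop :=
  (exists U : C -> Prop,
      open (T := C_UniformSpace) U /\
      (forall z : C, closed_unit_disc z -> U z) /\
      holomorphic_on U F) /\
  injective_on closed_unit_disc F /\
  convex_domain (image F unit_disc).

Definition Cexp (z : C) : C :=
  (exp (Re z) * cos (Im z), exp (Re z) * sin (Im z)).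

(* The integral of [F] from 0 to [z], taken along the segment [0, z]. The
   value of [F] at 0 is irrelevant, so integrands with a removable singularity
   at 0 need no special treatment; for a holomorphic integrand on the disc the
   choice of path is immaterial. *)
Definition Cint0 (F : C -> C) (z : C) : C :=
  (z * RInt (V := C_R_CompleteNormedModule)
         (fun t : R => F (RtoC t * z)%C) 0 1)%C.

Definition is_log_branch (h g : C -> C) : Prop :=
  holomorphic_on unit_disc g /\ g (RtoC 0) = RtoC 0 /\
  forall z : C, unit_disc z -> Cexp (g z) = h z.

(* On the unit disc this is the unique branch when [h] is holomorphic and
   zero-free there with [h 0 = 1]; it is arbitrary elsewhere. *)
Definition log_branch (h : C -> C) : C -> C :=
  epsilon (inhabits (fun _ : C => RtoC 0)) (is_log_branch h).

Definition Omega (k : R) (w : C) : Prop :=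
  Re w > k * Cmod (w - RtoC 1)%C.

Definition is_conformal_map_onto_Omega (k : R) (P : C -> C) : Prop :=
  holomorphic_on unit_disc P /\
  injective_on unit_disc P /\
  (forall w : C, image P unit_disc w <-> Omega k w) /\
  P (RtoC 0) = RtoC 1 /\
  Im (C_derive P (RtoC 0)) = 0 /\
  0 < Re (C_derive P (RtoC 0)).

(* [P'(0)], as a real number. *)
Definition alpha1 (P : C -> C) : R := Re (C_derive P (RtoC 0)).

Definition convexity_quotient (f : C -> C) (z : C) : C :=
  (RtoC 1 + z * C_derive (C_derive f) z / C_derive f z)%C.

(* Since division is total, "1 + z f''/f' is analytic" is read with the
   non-vanishing of f' made explicit. *)
Definition kUCV (k : R) (f : C -> C) : Prop :=
  holomorphic_on unit_disc f /\
  f (RtoC 0) = RtoC 0 /\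
  C_derive f (RtoC 0) = RtoC 1 /\
  (forall z : C, unit_disc z -> C_derive f z <> RtoC 0) /\
  holomorphic_on unit_disc (convexity_quotient f) /\
  (forall z : C, unit_disc z -> Omega k (convexity_quotient f z)).

Definition a2 (f : C -> C) : C :=
  (C_derive (C_derive f) (RtoC 0) / RtoC 2)%C.

Definition log_deriv (f : C -> C) : C -> C := log_branch (C_derive f).

Definition V_kUCV (k : R) (z0 lambda : C) (w : C) : Prop :=
  exists f : C -> C, kUCV k f /\ a2 f = lambda /\ w = log_deriv f z0.

Definition Q (P : C -> C) (gamma z eps : C) : C :=
  Cint0
    (fun zeta : C =>
       (/ zeta *
        (P (zeta * ((eps * zeta + gamma)
                    / (RtoC 1 + Cconj gamma * eps * zeta))) - RtoC 1))%C)
    z.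

(* Main.v *)
(* Writing 1 + z f''/f' = P(w) with w(z) = z phi(z) and phi(0) = gamma1, Schur's
   algorithm gives phi(z) = T(z psi(z)), where T is the disc automorphism taking
   0 to gamma1 and |psi| <= 1; hence at each z the quotient takes its values in
   the set of all h_z(e) = P(z T(z e)), |e| <= 1. Since Omega_k is convex so is
   the class of these functions, and therefore h_z maps the closed disc onto a
   convex set: for |e| = 1 the point h_z(e) is a boundary point with outer normal
   e h_z'(e).

   Fix |e| = 1 and put D = log f' - Q(., e) and H = d/de Q(., e). The support
   inequality says Re (D' / (e H')) <= 0. Moreover 1 + z H''/H' is the sum of
   1 + w P''/P'(w) and 1 + e h_z''/h_z'(e), both of positive (nonnegative) real
   part by convexity; so H is convex, hence starlike, and the inequality passes
   from D'/(e H') to D/(e H). Thus Q(z0, e) is a boundary point of the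
   variability region with outer normal e dQ/de, and the strong maximum principle
   for D/H gives uniqueness there. Maximum-principle arguments in the variable e
   then show that Q(z0, .) is injective and onto the region. *)

(* [Omega k] enters through its convexity, so the argument is carried out for an arbitrary convex
   image [Om] of the disc under an injective holomorphic [P]. Nothing is assumed about [P] at the
   boundary: for fixed [z] with [0 < |z| < 1] the parameter [e] may run over the larger disc
   [|e| < 1 / |z|], so derivatives in [e] exist on the whole unit circle, and the maximum principles
   in [e] take place on discs that contain the closed unit disc.

   The quotients that occur, such as [(q - 1) / z] or [D / H], have removable singularities at 0.
   They are expressed through integrals of [t^k F (t z)] over [[0, 1]], which are holomorphic at 0
   and satisfy a first-order differential equation; that equation yields the one for [H / (z H')].

   Where a winding number would be usual, a function with nonpositive real part and a known value at
   0 is used instead: [e Q' / (w - Q)] for surjectivity, [(Q (c x) - Q x) / (x Q' x)] for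
   injectivity. *)
Require Import Defs.
From Stdlib Require Import ssreflect Lra Lia Classical FunctionalExtensionality.

(** * Continuity and complex differentiability *)

Notation ccont := (continuous (U := C_UniformSpace)) (only parsing).
Notation ccont_C := (continuous (T := C_UniformSpace) (U := C_UniformSpace)) (only parsing).
Notation CR_space := (prod_UniformSpace C_UniformSpace R_UniformSpace) (only parsing).
Notation ccont_CR := (continuous (T := CR_space) (U := C_UniformSpace)) (only parsing).

(** The balls of [C_UniformSpace] are squares, since it is a product space; [sqrt 2] is the cost of
    passing to round discs. *)
Lemma locally_Cmod (z : C) (A : C -> Prop) :
  locally (T := C_UniformSpace) z A <->
  exists d : R, 0 < d /\ forall y : C, Cmod (y - z) < d -> A y.
Proof.
split.
- move=> [d Hd]; exists d; split; first exact: cond_pos.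
  move=> y Hy; apply: Hd; exact: C_NormedModule_mixin_compat1.
- move=> [d [Hd HA]].
  have Hs : 0 < sqrt 2 by apply: sqrt_lt_R0; lra.
  have He : 0 < d / sqrt 2 by apply: Rdiv_lt_0_compat.
  exists (mkposreal _ He) => y Hy; apply: HA.
  have := C_NormedModule_mixin_compat2 z y (mkposreal _ He) Hy.
  rewrite /= /minus /plus /opp /=.
  have -> : sqrt 2 * (d / sqrt 2) = d by field; lra.
  by [].
Qed.

Lemma Cminus_0_r (z : C) : (z - RtoC 0 = z)%C.
Proof. ring. Qed.

Lemma Cminus_diag (z : C) : (z - z = RtoC 0)%C.
Proof. ring. Qed.

Lemma Cmod_minus_sym (x y : C) : Cmod (x - y) = Cmod (y - x).
Proof. by rewrite -(Cmod_opp (x - y)); congr Cmod; ring. Qed.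

Lemma Cmod_triangle_minus (x y z : C) : Cmod (x - z) <= Cmod (x - y) + Cmod (y - z).
Proof.
have -> : (x - z = (x - y) + (y - z))%C by ring.
exact: Cmod_triangle.
Qed.

Lemma Cmod_reverse_triangle (x y : C) : Cmod x - Cmod y <= Cmod (x - y).
Proof.
have := Cmod_triangle (x - y) y.
have -> : (x - y + y = x)%C by ring.
lra.
Qed.

Lemma im_le_Cmod (c : C) : Rabs (Im c) <= Cmod c.
Proof. exact: Rle_trans (Rmax_r _ _) (Rmax_Cmod c). Qed.

Lemma Cmod_RtoC_nonneg (x : R) : 0 <= x -> Cmod (RtoC x) = x.
Proof. by move=> Hx; rewrite Cmod_R Rabs_pos_eq. Qed.

Lemma C_ext (x y : C) : Re x = Re y -> Im x = Im y -> x = y.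
Proof. by case: x => a b; case: y => c d /= -> ->. Qed.

Lemma locally_imp {T : UniformSpace} (x : T) (A B : T -> Prop) :
  (forall y : T, A y -> B y) -> locally x A -> locally x B.
Proof. by move=> H [d Hd]; exists d => y /Hd /H. Qed.

Lemma locally_and {T : UniformSpace} (x : T) (A B : T -> Prop) :
  locally x A -> locally x B -> locally x (fun y => A y /\ B y).
Proof. exact: filter_and. Qed.

Lemma locally_all {T : UniformSpace} (x : T) (A : T -> Prop) :
  (forall y : T, A y) -> locally x A.
Proof. by move=> H; exists (mkposreal 1 Rlt_0_1). Qed.

Lemma continuous_ball_iff {T U : UniformSpace} (f : T -> U) (x : T) :
  continuous f x <-> forall eps : posreal, locally x (fun y => ball (f x) eps (f y)).
Proof. exact: filterlim_locally. Qed.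

Section Continuity.

Context {T : UniformSpace}.
Implicit Types (f g : T -> C) (x : T).

Lemma continuous_C_iff f x :
  ccont f x <->
  forall eps : R, 0 < eps -> locally x (fun y => Cmod (f y - f x) < eps).
Proof.
split.
- move=> Hf eps He; apply: (Hf (fun w => Cmod (w - f x) < eps)).
  by apply/locally_Cmod; exists eps.
- move=> Hf A /locally_Cmod [d [Hd HA]].
  by apply: locally_imp (Hf d Hd) => y; apply: HA.
Qed.

Lemma continuous_Re f x :
  ccont f x -> continuous (fun y => Re (f y)) x.
Proof.
move=> Hf; apply: (continuous_comp f (fun c : C => fst c) x Hf).
exact: (continuous_fst (U := R_UniformSpace) (V := R_UniformSpace) (fst (f x)) (snd (f x))).
Qed.

Lemma continuous_Im f x :
  ccont f x -> continuous (fun y => Im (f y)) x.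
Proof.
move=> Hf; apply: (continuous_comp f (fun c : C => snd c) x Hf).
exact: (continuous_snd (U := R_UniformSpace) (V := R_UniformSpace) (fst (f x)) (snd (f x))).
Qed.

Lemma continuous_C_components f x :
  continuous (fun y => Re (f y)) x -> continuous (fun y => Im (f y)) x ->
  ccont f x.
Proof.
move=> H1 H2; apply/continuous_ball_iff => eps.
have {}H1 := proj1 (continuous_ball_iff _ _) H1 eps.
have {}H2 := proj1 (continuous_ball_iff _ _) H2 eps.
by apply: locally_imp (locally_and _ _ _ H1 H2) => y [? ?]; split.
Qed.

Lemma continuous_Cplus f g x :
  ccont f x -> ccont g x ->
  ccont (fun y => f y + g y)%C x.
Proof. exact: (continuous_plus (V := C_R_NormedModule) f g x). Qed.

Lemma continuous_Copp f x :
  ccont f x ->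
  ccont (fun y => - f y)%C x.
Proof. exact: (continuous_opp (V := C_R_NormedModule) f x). Qed.

Lemma continuous_Cminus f g x :
  ccont f x -> ccont g x ->
  ccont (fun y => f y - g y)%C x.
Proof. by move=> Hf Hg; apply: continuous_Cplus => //; apply: continuous_Copp. Qed.

Lemma continuous_Cmult f g x :
  ccont f x -> ccont g x ->
  ccont (fun y => f y * g y)%C x.
Proof.
move=> Hf Hg; have ? := continuous_Re _ _ Hf; have ? := continuous_Re _ _ Hg.
have ? := continuous_Im _ _ Hf; have ? := continuous_Im _ _ Hg.
apply: continuous_C_components => /=.
- apply: (continuous_minus (V := R_NormedModule)
    (fun y => Re (f y) * Re (g y)) (fun y => Im (f y) * Im (g y)));
  exact: (continuous_mult (K := R_AbsRing)).
- apply: (continuous_plus (V := R_NormedModule)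
    (fun y => Re (f y) * Im (g y)) (fun y => Im (f y) * Re (g y)));
  exact: (continuous_mult (K := R_AbsRing)).
Qed.

Lemma continuous_Cinv f x :
  f x <> RtoC 0 -> ccont f x ->
  ccont (fun y => / f y)%C x.
Proof.
move=> Hx Hf; have HR := continuous_Re _ _ Hf; have HI := continuous_Im _ _ Hf.
have Hd : continuous (fun y => / (Re (f y) ^ 2 + Im (f y) ^ 2)) x.
  apply: (continuous_comp (fun y => Re (f y) ^ 2 + Im (f y) ^ 2) Rinv).
  - apply: (continuous_plus (V := R_NormedModule)
      (fun y => Re (f y) ^ 2) (fun y => Im (f y) ^ 2)) => /=.
    + apply: (continuous_mult (K := R_AbsRing) (fun y => Re (f y)) (fun y => Re (f y) * 1)) => //.
      by apply: (continuous_mult (K := R_AbsRing) (fun y => Re (f y))) => //; apply: continuous_const.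
    + apply: (continuous_mult (K := R_AbsRing) (fun y => Im (f y)) (fun y => Im (f y) * 1)) => //.
      by apply: (continuous_mult (K := R_AbsRing) (fun y => Im (f y))) => //; apply: continuous_const.
  - apply: continuous_Rinv => H0; apply: Hx; apply: Cmod_eq_0.
    have : Cmod (f x) ^ 2 = 0 by rewrite Cmod2_alt.
    by move=> /= ?; nra.
apply: continuous_C_components.
- exact: (continuous_mult (K := R_AbsRing) (fun y => Re (f y))).
- apply: (continuous_mult (K := R_AbsRing) (fun y => - Im (f y))) => //.
  exact: (continuous_opp (V := R_NormedModule) (fun y => Im (f y))).
Qed.

Lemma continuous_Cdiv f g x :
  g x <> RtoC 0 ->
  ccont f x -> ccont g x ->
  ccont (fun y => f y / g y)%C x.
Proof. by move=> Hx Hf Hg; apply: continuous_Cmult => //; apply: continuous_Cinv. Qed.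

Lemma continuous_RtoC (u : T -> R) x :
  continuous u x -> ccont (fun y => RtoC (u y)) x.
Proof. by move=> Hu; apply: continuous_C_components => //=; apply: continuous_const. Qed.

Lemma continuous_Cexp f x :
  ccont f x ->
  ccont (fun y => Cexp (f y)) x.
Proof.
move=> Hf; have HR := continuous_Re _ _ Hf; have HI := continuous_Im _ _ Hf.
have He : continuous (fun y => exp (Re (f y))) x.
  by apply: (continuous_comp _ exp) => //; apply: continuous_exp.
apply: continuous_C_components => /=.
- apply: (continuous_mult (K := R_AbsRing) _ (fun y => cos (Im (f y)))) => //.
  by apply: (continuous_comp _ cos) => //; apply: continuous_cos.
- apply: (continuous_mult (K := R_AbsRing) _ (fun y => sin (Im (f y)))) => //.
  by apply: (continuous_comp _ sin) => //; apply: continuous_sin.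
Qed.

Lemma continuous_Cmod f x :
  ccont f x -> continuous (fun y => Cmod (f y)) x.
Proof.
move=> /continuous_C_iff Hf; apply/continuous_ball_iff => eps.
apply: locally_imp (Hf eps (cond_pos eps)) => y Hy.
apply: Rle_lt_trans Hy.
have H1 := Cmod_reverse_triangle (f y) (f x).
have H2 := Cmod_reverse_triangle (f x) (f y).
rewrite (Cmod_minus_sym (f x)) in H2.
by apply: Rabs_le; rewrite /minus /plus /opp /=; lra.
Qed.

End Continuity.

(* Caratheodory's form of differentiability: the difference quotient extends
   continuously. The calculus rules, and differentiation under the integral
   sign, become statements about continuity only. *)
Definition cdiff (f : C -> C) (z l : C) : Prop :=
  exists phi : C -> C,
    ccont_C phi z /\ phi z = l /\
    forall y : C, f y = (f z + (y - z) * phi y)%C.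

Lemma cdiff_eps (f : C -> C) (z l : C) :
  cdiff f z l <->
  forall eps : R, 0 < eps -> exists d : R, 0 < d /\ forall y : C,
    Cmod (y - z) < d -> Cmod (f y - f z - (y - z) * l) <= eps * Cmod (y - z).
Proof.
split.
- move=> [phi [Hc [Hl Hf]]] eps He.
  have /locally_Cmod [d [Hd HH]] := proj1 (continuous_C_iff _ _) Hc eps He.
  exists d; split => // y /HH Hy; rewrite (Hf y) -Hl.
  have -> : (f z + (y - z) * phi y - f z - (y - z) * phi z
             = (phi y - phi z) * (y - z))%C by ring.
  rewrite Cmod_mult; apply: Rmult_le_compat_r; first exact: Cmod_ge_0.
  lra.
- move=> H.
  exists (fun y => match Ceq_dec y z with left _ => l | right _ => ((f y - f z) / (y - z))%C end).
  split; last split.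
  + apply/continuous_C_iff => eps He; apply/locally_Cmod.
    have [d [Hd HH]] := H (eps / 2) ltac:(lra).
    exists d; split => // y Hy.
    case: (Ceq_dec z z) => // _; case: (Ceq_dec y z) => Hyz.
      by rewrite Cminus_diag Cmod_0.
    have Hn : (y - z <> 0)%C by move=> E; apply: Hyz; rewrite -(Cplus_0_r z) -E; ring.
    have -> : ((f y - f z) / (y - z) - l = (f y - f z - (y - z) * l) / (y - z))%C.
      by field.
    rewrite Cmod_div //.
    have Hp : 0 < Cmod (y - z) by apply/Cmod_gt_0.
    apply: (Rle_lt_trans _ (eps / 2)); last lra.
    apply/Rle_div_l => //; exact: HH.
  + by case: (Ceq_dec z z).
  + move=> y; case: (Ceq_dec y z) => [-> | Hyz]; first by ring.
    by field => E; apply: Hyz; rewrite -(Cplus_0_r z) -E; ring.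
Qed.

Lemma cdiff_is_derive (f : C -> C) (z l : C) :
  cdiff f z l <-> is_derive (K := C_AbsRing) (V := C_NormedModule) f z l.
Proof.
split.
- move=> /cdiff_eps H; split; first exact: is_linear_scal_l.
  move=> x Hx.
  have -> : x = z.
    by symmetry; apply: (is_filter_lim_locally_unique (K := C_AbsRing)
       (V := AbsRing_NormedModule C_AbsRing) _ _ Hx).
  move=> eps; have [d [Hd HH]] := H eps (cond_pos eps).
  by exists (mkposreal d Hd) => y Hy; apply: HH.
- move=> [_ H]; apply/cdiff_eps => eps He.
  have [d Hd] := H z (fun P HP => HP) (mkposreal eps He).
  exists d; split; first exact: cond_pos.
  by move=> y Hy; apply: Hd.
Qed.

Lemma cdiff_continuous (f : C -> C) (z l : C) :
  cdiff f z l -> ccont_C f z.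
Proof.
move=> [phi [Hc [Hl Hf]]].
apply: (continuous_ext (T := C_UniformSpace) (fun y => f z + (y - z) * phi y)%C).
  by move=> y; rewrite (Hf y).
apply: continuous_Cplus; first exact: continuous_const.
apply: continuous_Cmult => //; apply: continuous_Cminus; last exact: continuous_const.
exact: continuous_id.
Qed.

Lemma cdiff_ext_loc (f g : C -> C) (z l : C) :
  locally (T := C_UniformSpace) z (fun y => f y = g y) -> cdiff f z l -> cdiff g z l.
Proof.
move=> /locally_Cmod [d [Hd H]] /cdiff_eps Hf; apply/cdiff_eps => eps He.
have [d' [Hd' H']] := Hf eps He.
exists (Rmin d d'); split; first exact: Rmin_pos.
move=> y Hy; rewrite -H -?H.
- by apply: H'; apply: Rlt_le_trans Hy (Rmin_r _ _).
- by rewrite Cminus_diag Cmod_0.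
- by apply: Rlt_le_trans Hy (Rmin_l _ _).
Qed.

Lemma cdiff_ext (f g : C -> C) (z l : C) :
  (forall y : C, f y = g y) -> cdiff f z l -> cdiff g z l.
Proof. by move=> H; apply: cdiff_ext_loc; apply: locally_all. Qed.

Lemma cdiff_unique (f : C -> C) (z l1 l2 : C) : cdiff f z l1 -> cdiff f z l2 -> l1 = l2.
Proof.
move=> /cdiff_is_derive/is_C_derive_unique <- /cdiff_is_derive/is_C_derive_unique <-.
by [].
Qed.

Lemma cdiff_C_derive (f : C -> C) (z l : C) : cdiff f z l -> C_derive f z = l.
Proof. by move=> /cdiff_is_derive/is_C_derive_unique. Qed.

Lemma cdiff_const (c z : C) : cdiff (fun _ => c) z (RtoC 0).
Proof.
exists (fun _ => RtoC 0); split; first exact: continuous_const.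
by split => // y; ring.
Qed.

Lemma cdiff_id (z : C) : cdiff (fun y => y) z (RtoC 1).
Proof.
exists (fun _ => RtoC 1); split; first exact: continuous_const.
by split => // y; ring.
Qed.

Section Calculus.

Variables (f g : C -> C) (z a b : C).
Hypotheses (Hf : cdiff f z a) (Hg : cdiff g z b).

Lemma cdiff_plus : cdiff (fun y => f y + g y)%C z (a + b)%C.
Proof.
move: Hf Hg => [p [Cp [<- Ep]]] [q [Cq [<- Eq]]].
exists (fun y => p y + q y)%C; split; first exact: continuous_Cplus.
by split => // y; rewrite (Ep y) (Eq y); ring.
Qed.

Lemma cdiff_minus : cdiff (fun y => f y - g y)%C z (a - b)%C.
Proof.
move: Hf Hg => [p [Cp [<- Ep]]] [q [Cq [<- Eq]]].
exists (fun y => p y - q y)%C; split; first exact: continuous_Cminus.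
by split => // y; rewrite (Ep y) (Eq y); ring.
Qed.

Lemma cdiff_mult : cdiff (fun y => f y * g y)%C z (a * g z + f z * b)%C.
Proof.
have Cg := cdiff_continuous _ _ _ Hg.
move: Hf Hg => [p [Cp [<- Ep]]] [q [Cq [<- Eq]]].
exists (fun y => p y * g y + f z * q y)%C; split.
  apply: continuous_Cplus; first exact: continuous_Cmult.
  by apply: continuous_Cmult => //; apply: continuous_const.
by split => // y; rewrite (Ep y) (Eq y); ring.
Qed.

Lemma cdiff_scal (c : C) : cdiff (fun y => c * f y)%C z (c * a)%C.
Proof.
move: Hf => [p [Cp [<- Ep]]].
exists (fun y => c * p y)%C; split.
  by apply: continuous_Cmult => //; apply: continuous_const.
by split => // y; rewrite (Ep y); ring.
Qed.

Lemma cdiff_inv : f z <> RtoC 0 -> cdiff (fun y => / f y)%C z (- a / (f z * f z))%C.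
Proof.
move=> Hz.
have Cf := cdiff_continuous _ _ _ Hf.
move: Hf => [p [Cp [<- Ep]]].
have Hloc : locally (T := C_UniformSpace) z (fun y => f y <> RtoC 0).
  have H0 : 0 < Cmod (f z) by apply/Cmod_gt_0.
  have H := proj1 (continuous_C_iff _ _) Cf (Cmod (f z)) H0.
  apply: locally_imp H => y Hy E; rewrite E in Hy.
  have EE : (RtoC 0 - f z = - f z)%C by ring.
  by rewrite EE Cmod_opp in Hy; lra.
(* A slope must satisfy its identity at every [y], which [/ f y] cannot guarantee where [f]
   vanishes. There the function is redefined so that the identity holds trivially; near [z] nothing
   changes. *)
apply: (cdiff_ext_loc (fun y => match Ceq_dec (f y) (RtoC 0) with
          | left _ => (/ f z + (y - z) * (- p y / (f y * f z)))%C
          | right _ => (/ f y)%C end)).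
  by apply: locally_imp Hloc => y Hy; case: (Ceq_dec (f y) _).
exists (fun y => - p y / (f y * f z))%C; split; last split => //.
  apply: continuous_Cdiv; first exact: Cmult_neq_0.
  - exact: continuous_Copp.
  - by apply: continuous_Cmult => //; apply: continuous_const.
move=> y; case: (Ceq_dec (f z) _) => // _; case: (Ceq_dec (f y) _) => // Hy.
have -> : (/ f y = / f z + (f z - f y) / (f y * f z))%C by field.
have -> : (f z - f y = - ((y - z) * p y))%C by rewrite (Ep y); ring.
by field.
Qed.

End Calculus.

Lemma cdiff_div (f g : C -> C) (z a b : C) :
  cdiff f z a -> cdiff g z b -> g z <> RtoC 0 ->
  cdiff (fun y => f y / g y)%C z ((a * g z - f z * b) / (g z * g z))%C.
Proof.
move=> Hf Hg Hz; have H := cdiff_mult _ _ _ _ _ Hf (cdiff_inv _ _ _ Hg Hz).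
by have -> : ((a * g z - f z * b) / (g z * g z) = a * / g z + f z * (- b / (g z * g z)))%C by field.
Qed.

Lemma cdiff_comp (f g : C -> C) (z a b : C) :
  cdiff f z a -> cdiff g (f z) b -> cdiff (fun y => g (f y)) z (a * b)%C.
Proof.
move=> Hf; have Cf := cdiff_continuous _ _ _ Hf.
move: Hf => [p [Cp [<- Ep]]] [q [Cq [<- Eq]]].
exists (fun y => p y * q (f y))%C; split.
  apply: continuous_Cmult => //.
  exact: (continuous_comp (U := C_UniformSpace) (V := C_UniformSpace) f q).
split => // y; rewrite (Eq (f y)).
have -> : (f y - f z = (y - z) * p y)%C by rewrite (Ep y); ring.
ring.
Qed.

Lemma cdiff_eq (f : C -> C) (z a b : C) : cdiff f z a -> a = b -> cdiff f z b.
Proof. by move=> H <-. Qed.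

Lemma Cexp_plus (x y : C) : Cexp (x + y) = (Cexp x * Cexp y)%C.
Proof.
case: x => a b; case: y => c d; apply: C_ext => /=; rewrite exp_plus ?cos_plus ?sin_plus; ring.
Qed.

Lemma Cexp_0 : Cexp (RtoC 0) = RtoC 1.
Proof. by apply: C_ext; rewrite /= exp_0 ?cos_0 ?sin_0; ring. Qed.

Lemma Cexp_neq_0 (z : C) : Cexp z <> RtoC 0.
Proof.
move=> E; have : (Cexp z * Cexp (- z) = 1)%C.
  rewrite -Cexp_plus; have -> : (z + - z = 0)%C by ring.
  exact: Cexp_0.
by rewrite E Cmult_0_l => H; apply: C1_nz; rewrite H.
Qed.

Lemma Cmod_Cexp (z : C) : Cmod (Cexp z) = exp (Re z).
Proof.
have H : Cmod (Cexp z) ^ 2 = exp (Re z) ^ 2.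
  rewrite Cmod2_alt /=; have := sin2_cos2 (Im z); rewrite /Rsqr => ?; nra.
have H1 := Cmod_ge_0 (Cexp z); have H2 := exp_pos (Re z).
by move: H => /=; nra.
Qed.

Lemma derivative_little_o (f : R -> R) (x l : R) :
  is_derive f x l -> forall eps : R, 0 < eps -> exists d : R, 0 < d /\ forall h : R,
    Rabs h < d -> Rabs (f (x + h) - f x - h * l) <= eps * Rabs h.
Proof.
move=> [_ H] eps He.
have [d Hd] := H x (fun P HP => HP) (mkposreal eps He).
exists d; split; first exact: cond_pos.
move=> h Hh; have := Hd (x + h).
rewrite /ball /= /AbsRing_ball /abs /minus /plus /opp /scal /= /mult /norm /= /abs /=.
have -> : x + h + - x = h by ring.
move=> /(_ Hh); congr (Rabs _ <= _); ring.
Qed.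

(** The functional equation moves the point to 0, where the real derivatives of [exp], [sin] and
    [cos] suffice. *)
Lemma cdiff_Cexp (z : C) : cdiff Cexp z (Cexp z).
Proof.
suff H0 : cdiff Cexp (RtoC 0) (RtoC 1).
  have H1 : cdiff (fun y => y - z)%C z (1 - 0)%C by apply: cdiff_minus (cdiff_id _) (cdiff_const _ _).
  have H2 : cdiff (fun y => Cexp (y - z)) z (RtoC 1).
    apply: cdiff_eq (cdiff_comp _ Cexp _ _ (RtoC 1) H1 _) _; last by ring.
    by have -> : (z - z = 0)%C by ring.
  apply: (cdiff_ext (fun y => Cexp z * Cexp (y - z))%C).
    by move=> y; rewrite -Cexp_plus; congr Cexp; ring.
  by apply: cdiff_eq (cdiff_scal _ _ _ H2 _) _; ring.
apply/cdiff_eps => eps He.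
(* Each component of the remainder will be at most [6 * e * m], and passing from components to
   [Cmod] costs [sqrt 2 <= 2]; hence the 12. The bound [m < e] absorbs the quadratic terms. *)
set e := Rmin 1 (eps / 12).
have He0 : 0 < e by apply: Rmin_pos; lra.
have He1 : e <= 1 by apply: Rmin_l.
have He2 : e <= eps / 12 by apply: Rmin_r.
clearbody e.
have [d1 [Hd1 H1]] := derivative_little_o _ _ _ (proj2 (is_derive_Reals exp 0 1) derivable_pt_lim_exp_0) e He0.
have [d2 [Hd2 H2]] := derivative_little_o _ _ _ (proj2 (is_derive_Reals sin 0 _) (derivable_pt_lim_sin 0)) e He0.
have [d3 [Hd3 H3]] := derivative_little_o _ _ _ (proj2 (is_derive_Reals cos 0 _) (derivable_pt_lim_cos 0)) e He0.
exists (Rmin e (Rmin d1 (Rmin d2 d3))); split.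
  by repeat apply: Rmin_pos.
move=> h; have -> : (h - 0 = h)%C by ring.
have := re_le_Cmod h; have := im_le_Cmod h; set m := Cmod h.
case: h @m => x y m /=; have Hm : 0 <= m by apply: Cmod_ge_0.
move=> Hy Hx Hlt.
have Hme : m < e by apply: Rlt_le_trans Hlt (Rmin_l _ _).
have {}Hlt : m < Rmin d1 (Rmin d2 d3) by apply: Rlt_le_trans Hlt (Rmin_r _ _).
have Hm1 : m < d1 by apply: Rlt_le_trans Hlt (Rmin_l _ _).
have {}Hlt : m < Rmin d2 d3 by apply: Rlt_le_trans Hlt (Rmin_r _ _).
have Hm2 : m < d2 by apply: Rlt_le_trans Hlt (Rmin_l _ _).
have Hm3 : m < d3 by apply: Rlt_le_trans Hlt (Rmin_r _ _).
have {}H1 := H1 x ltac:(lra); have {}H2 := H2 y ltac:(lra); have {}H3 := H3 y ltac:(lra).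
rewrite !Rplus_0_l ?exp_0 ?sin_0 ?cos_0 in H1 H2 H3.
rewrite Cexp_0.
apply: Rle_trans (Cmod_2Rmax _) _.
have Hs : sqrt 2 <= 2.
  by rewrite -{2}(sqrt_square 2); [apply: sqrt_le_1; lra | lra].
have Hsp : 0 <= sqrt 2 by apply: sqrt_pos.
suff HR : Rmax (Rabs (fst (Cexp (x, y) - 1 - (x, y) * 1)%C))
               (Rabs (snd (Cexp (x, y) - 1 - (x, y) * 1)%C)) <= 6 * e * m.
  apply: (Rle_trans _ (2 * (6 * e * m))); last nra.
  apply: Rmult_le_compat => //.
  by apply: Rle_trans (Rabs_pos _) (Rmax_l _ _).
have Hb1 : Rabs (exp x - 1) <= 2 * m.
  have -> : exp x - 1 = (exp x - 1 - x * 1) + x by ring.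
  by apply: Rle_trans (Rabs_triang _ _) _; nra.
have Hc : Rabs (cos y - 1) <= e * m.
  have -> : cos y - 1 = cos y - 1 - y * - 0 by ring.
  by apply: Rle_trans H3 _; nra.
have Hs1 : Rabs (sin y) <= 2 * m.
  have -> : sin y = (sin y - 0 - y * 1) + y by ring.
  by apply: Rle_trans (Rabs_triang _ _) _; nra.
have Hp1 : Rabs (exp x * (cos y - 1)) <= 3 * (e * m).
  rewrite Rabs_mult; apply: Rmult_le_compat => //; try exact: Rabs_pos.
  have -> : exp x = (exp x - 1) + 1 by ring.
  by apply: Rle_trans (Rabs_triang _ _) _; rewrite Rabs_R1; lra.
have Hp2 : Rabs ((exp x - 1) * sin y) <= 2 * m * (2 * m).
  by rewrite Rabs_mult; apply: Rmult_le_compat => //; exact: Rabs_pos.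
have Hq1 : Rabs (exp x - 1 - x * 1) <= e * m by apply: Rle_trans H1 _; nra.
have Hq2 : Rabs (sin y - 0 - y * 1) <= e * m by apply: Rle_trans H2 _; nra.
have Hme2 : m * m <= e * m by nra.
have Hem : 0 <= e * m by nra.
apply: Rmax_lub => /=.
- have -> : exp x * cos y + - (1) + - (x * 1 - y * 0)
            = (exp x - 1 - x * 1) + exp x * (cos y - 1) by ring.
  by apply: Rle_trans (Rabs_triang _ _) _; nra.
- have -> : exp x * sin y + - 0 + - (x * 0 + y * 1)
            = (sin y - 0 - y * 1) + (exp x - 1) * sin y by ring.
  by apply: Rle_trans (Rabs_triang _ _) _; nra.
Qed.

(** * Complex-valued Riemann integrals *)

Notation CInt := (RInt (V := C_R_CompleteNormedModule)) (only parsing).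
Notation ex_CInt := (ex_RInt (V := C_R_CompleteNormedModule)) (only parsing).
Notation is_CInt := (is_RInt (V := C_R_CompleteNormedModule)) (only parsing).

Lemma norm_C_R (x : C) : norm (V := C_R_CompleteNormedModule) x = Cmod x.
Proof.
by rewrite /Cmod -(pow2_abs (fst x)) -(pow2_abs (snd x)).
Qed.

(** The scalar is complex while the module structure is real, so linearity is checked on
    components. *)
Lemma is_CInt_scal (f : R -> C) (a b : R) (c l : C) :
  is_CInt f a b l -> is_CInt (fun t => c * f t)%C a b (c * l)%C.
Proof.
move=> H.
have H1 := is_RInt_fct_extend_fst (U := R_NormedModule) (V := R_NormedModule) f a b l H.
have H2 := is_RInt_fct_extend_snd (U := R_NormedModule) (V := R_NormedModule) f a b l H.
apply: (is_RInt_fct_extend_pair (U := R_NormedModule) (V := R_NormedModule)) => /=.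
- apply: (is_RInt_minus (V := R_NormedModule)); exact: (is_RInt_scal (V := R_NormedModule)).
- apply: (is_RInt_plus (V := R_NormedModule)); exact: (is_RInt_scal (V := R_NormedModule)).
Qed.

Lemma CInt_scal (f : R -> C) (a b : R) (c : C) :
  ex_CInt f a b -> CInt (fun t => c * f t)%C a b = (c * CInt f a b)%C.
Proof. by move=> H; apply: is_RInt_unique; apply: is_CInt_scal; exact: RInt_correct. Qed.

Lemma CInt_plus (f g : R -> C) (a b : R) :
  ex_CInt f a b -> ex_CInt g a b ->
  CInt (fun t => f t + g t)%C a b = (CInt f a b + CInt g a b)%C.
Proof. exact: (RInt_plus (V := C_R_CompleteNormedModule)). Qed.

Lemma CInt_minus (f g : R -> C) (a b : R) :
  ex_CInt f a b -> ex_CInt g a b ->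
  CInt (fun t => f t - g t)%C a b = (CInt f a b - CInt g a b)%C.
Proof. exact: (RInt_minus (V := C_R_CompleteNormedModule)). Qed.

Lemma CInt_const (a b : R) (c : C) : CInt (fun _ => c) a b = (RtoC (b - a) * c)%C.
Proof. by rewrite RInt_const scal_R_Cmult. Qed.

Lemma Re_CInt (f : R -> C) (a b : R) :
  ex_CInt f a b -> is_RInt (fun t => Re (f t)) a b (Re (CInt f a b)).
Proof.
move=> H; apply: (is_RInt_fct_extend_fst (U := R_NormedModule) (V := R_NormedModule) f).
exact: (RInt_correct (V := C_R_CompleteNormedModule)).
Qed.

Lemma Cmod_CInt_le (f : R -> C) (a b M : R) :
  a <= b -> ex_CInt f a b -> (forall t, a <= t <= b -> Cmod (f t) <= M) ->
  Cmod (CInt f a b) <= (b - a) * M.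
Proof.
move=> Hab Hf HM; rewrite -norm_C_R.
apply: (norm_RInt_le_const (V := C_R_NormedModule) f) => //.
  by move=> t Ht; rewrite (norm_C_R (f t)); apply: HM.
exact: (RInt_correct (V := C_R_CompleteNormedModule)).
Qed.

Lemma ex_CInt_continuous (f : R -> C) (a b : R) :
  a <= b -> (forall t, a <= t <= b -> ccont f t) -> ex_CInt f a b.
Proof.
move=> Hab H; apply: (ex_RInt_continuous (V := C_R_CompleteNormedModule)).
by move=> t; rewrite Rmin_left // Rmax_right //; apply: H.
Qed.

Lemma CInt_ext (f g : R -> C) (a b : R) :
  a <= b -> (forall t, a < t < b -> f t = g t) -> CInt f a b = CInt g a b.
Proof. by move=> Hab H; apply: RInt_ext => t; rewrite Rmin_left // Rmax_right //; apply: H. Qed.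

Lemma cdiff_RtoC (G : C -> C) (t : R) (l : C) :
  cdiff G (RtoC t) l ->
  is_derive (K := R_AbsRing) (V := C_R_NormedModule) (fun s : R => G (RtoC s)) t l.
Proof.
move=> /cdiff_eps H; split; first exact: is_linear_scal_l.
move=> x Hx.
have -> : x = t by symmetry; apply: is_filter_lim_locally_unique.
move=> eps; have [d [Hd HH]] := H eps (cond_pos eps).
exists (mkposreal d Hd) => y Hy.
have Hy' : Cmod (RtoC y - RtoC t) < d by rewrite -RtoC_minus Cmod_R; exact: Hy.
have {}HH := HH _ Hy'.
rewrite -RtoC_minus Cmod_R in HH.
rewrite (norm_C_R (minus _ _)).
apply: Rle_trans HH; apply: Req_le; congr Cmod.
have -> : minus y t = y - t by [].
by rewrite scal_R_Cmult.
Qed.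

Lemma CInt_FTC (G G' : C -> C) (a b : R) :
  a <= b ->
  (forall t : R, a <= t <= b -> cdiff G (RtoC t) (G' (RtoC t))) ->
  (forall t : R, a <= t <= b -> ccont (fun s : R => G' (RtoC s)) t) ->
  CInt (fun t : R => G' (RtoC t)) a b = (G (RtoC b) - G (RtoC a))%C.
Proof.
move=> Hab H1 H2; apply: is_RInt_unique.
apply: (is_RInt_derive (V := C_R_CompleteNormedModule) (fun t : R => G (RtoC t))).
- by move=> t; rewrite Rmin_left // Rmax_right // => Ht; apply: cdiff_RtoC; exact: H1.
- by move=> t; rewrite Rmin_left // Rmax_right //; exact: H2.
Qed.

(** Compactness of [[a, b]] gives one radius [d] about [x] that works for every [t]; the integrands
    then differ by at most [2 * e], because both are compared with the value at a nearby node
    [s]. *)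
Lemma continuous_CInt_param {T : UniformSpace} (K : T -> R -> C) (a b : R) (x : T) :
  a <= b ->
  locally x (fun y => ex_CInt (K y) a b) ->
  (forall t, a <= t <= b ->
     continuous (T := prod_UniformSpace T R_UniformSpace) (U := C_UniformSpace)
       (fun p => K (fst p) (snd p)) (x, t)) ->
  ccont (fun y => CInt (K y) a b) x.
Proof.
move=> Hab Hex HK; apply/continuous_C_iff => eps Heps.
(* The summand 1 keeps the denominator positive when [a = b] and makes the final bound strict. *)
set e := eps / (2 * (b - a) + 1).
have He : 0 < e by apply: Rdiv_lt_0_compat; lra.
have Hd : forall t : R, exists d : posreal, a <= t <= b -> forall y s,
    ball x d y -> ball t d s -> Cmod (K y s - K x t) < e.
  move=> t; case: (classic (a <= t <= b)) => Ht; last by exists (mkposreal 1 Rlt_0_1).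
  have [d Hd] := proj1 (continuous_C_iff _ _) (HK t Ht) e He.
  by exists d => _ y s Hy Hs; apply: (Hd (y, s)); split.
pose dl t := proj1_sig (constructive_indefinite_description _ (Hd t)).
have Hdl : forall t, a <= t <= b -> forall y s,
    ball x (dl t) y -> ball t (dl t) s -> Cmod (K y s - K x t) < e.
  by move=> t; rewrite /dl; case: (constructive_indefinite_description _ _).
have [d Hcomp] := Compactness.compactness_value 1 (a, tt) (b, tt) (fun t => dl (fst t)).
have Hunif : forall y t, ball x d y -> a <= t <= b -> Cmod (K y t - K x t) <= 2 * e.
  move=> y t Hy Ht; apply: NNPP => Hn; apply: (Hcomp (t, tt)) => // -[[s []] /= [[Hs _] [[Hst _] Hds]]].
  apply: Hn.
  have Hts : ball s (dl s) t by exact: Hst.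
  have H1 := Hdl s Hs y t (ball_le _ _ _ Hds _ Hy) Hts.
  have H2 := Hdl s Hs x t (ball_center x _) Hts.
  rewrite Cmod_minus_sym in H2.
  have := Cmod_triangle_minus (K y t) (K x s) (K x t); lra.
have Hx := locally_singleton _ _ Hex.
have Hball : locally x (fun y => ball x d y) by exists d.
apply: locally_imp (locally_and _ _ _ Hball Hex) => y [Hy Hey].
rewrite -CInt_minus //.
apply: (Rle_lt_trans _ ((b - a) * (2 * e))).
  apply: Cmod_CInt_le => //.
    exact: (ex_RInt_minus (V := C_R_CompleteNormedModule)).
  by move=> t Ht; apply: Hunif.
have -> : eps = (2 * (b - a) + 1) * e by rewrite /e; field; lra.
nra.
Qed.

Lemma continuous_slice {T1 T2 : UniformSpace} (K : T1 -> T2 -> C) (w : T1) (t : T2) :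
  continuous (T := prod_UniformSpace T1 T2) (U := C_UniformSpace)
    (fun p => K (fst p) (snd p)) (w, t) ->
  ccont (K w) t.
Proof.
apply: (continuous_comp_2 (V := T1) (W := T2) (X := C_UniformSpace) (fun _ => w) (fun t => t) K).
  exact: continuous_const.
exact: continuous_id.
Qed.

(** The projection of the line onto [[a, b]]. A neighbourhood of an endpoint leaves the interval;
    clipping makes the hypotheses on [[a, b]] applicable on all of it. *)
Definition clip (a b t : R) : R := Rmax a (Rmin b t).

Lemma clip_bounds (a b t : R) : a <= b -> a <= clip a b t <= b.
Proof.
move=> H; rewrite /clip; split; first exact: Rmax_l.
apply: Rmax_lub => //; exact: Rmin_l.
Qed.

Lemma clip_id (a b t : R) : a <= t <= b -> clip a b t = t.
Proof. by move=> [H1 H2]; rewrite /clip Rmin_right // Rmax_right. Qed.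

Lemma clip_continuous (a b t : R) : continuous (clip a b) t.
Proof.
apply/continuous_ball_iff => eps; exists eps => s Hs.
apply: Rle_lt_trans Hs.
rewrite /minus /plus /opp /= /abs /= /clip /Rmax /Rmin.
rewrite /Rabs; repeat destruct Rle_dec; repeat destruct Rcase_abs; lra.
Qed.

Section ParametricDerivative.

Variables (K K' : C -> R -> C) (a b : R) (w0 : C) (r : R).
Hypothesis Hab : a <= b.
Hypothesis Hr : 0 < r.
Hypothesis HK : forall w t, Cmod (w - w0) < r -> a <= t <= b ->
  cdiff (fun v => K v t) w (K' w t).
Hypothesis HK' : forall w t, Cmod (w - w0) < r -> a <= t <= b ->
  ccont_CR
    (fun p => K' (fst p) (snd p)) (w, t).
Hypothesis HKint : forall w, Cmod (w - w0) < r -> ex_CInt (K w) a b.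

Let seg (w : C) (s : R) : C := (w0 + RtoC s * (w - w0))%C.
Let Phi (w : C) (t : R) : C := CInt (fun s => K' (seg w s) (clip a b t)) 0 1.

Lemma segment_in_disc (w : C) (s : R) :
  Cmod (w - w0) < r -> 0 <= s <= 1 -> Cmod (seg w s - w0) < r.
Proof.
move=> Hw Hs; have -> : (seg w s - w0 = RtoC s * (w - w0))%C by rewrite /seg; ring.
rewrite Cmod_mult Cmod_RtoC_nonneg; last lra.
have := Cmod_ge_0 (w - w0); nra.
Qed.

Lemma integrand_continuous (w : C) (t s : R) :
  Cmod (w - w0) < r -> 0 <= s <= 1 ->
  continuous (T := prod_UniformSpace (CR_space) R_UniformSpace)
    (U := C_UniformSpace)
    (fun p => K' (seg (fst (fst p)) (snd p)) (clip a b (snd (fst p)))) (w, t, s).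
Proof.
move=> Hw Hs.
apply: (continuous_comp_2
  (U := prod_UniformSpace (CR_space) R_UniformSpace)
  (V := C_UniformSpace) (W := R_UniformSpace) (X := C_UniformSpace)
  (fun p => seg (fst (fst p)) (snd p)) (fun p => clip a b (snd (fst p))) K').
- apply: continuous_Cplus; first exact: continuous_const.
  apply: continuous_Cmult.
    by apply: continuous_RtoC; apply: continuous_snd.
  apply: continuous_Cminus; last exact: continuous_const.
  apply: (continuous_comp (V := CR_space) fst fst).
    exact: continuous_fst.
  exact: continuous_fst.
- apply: (continuous_comp (W := R_UniformSpace) (fun p => snd (fst p)) (clip a b)).
    apply: (continuous_comp (V := CR_space) fst snd).
      exact: continuous_fst.
    exact: continuous_snd.
  exact: clip_continuous.
- apply: HK'; first exact: segment_in_disc.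
  exact: clip_bounds.
Qed.

Lemma slope_continuous (w : C) (t : R) :
  Cmod (w - w0) < r ->
  ccont_CR
    (fun p => Phi (fst p) (snd p)) (w, t).
Proof.
move=> Hw; apply: (continuous_CInt_param
  (T := CR_space)
  (fun p s => K' (seg (fst p) s) (clip a b (snd p)))).
- lra.
- have Hloc : locally (T := C_UniformSpace) w (fun y => Cmod (y - w0) < r).
    apply/locally_Cmod; exists (r - Cmod (w - w0)); split; first lra.
    by move=> y Hy; have := Cmod_triangle_minus y w w0; lra.
  case: Hloc => d Hd; exists d => -[y u] [Hy _]; have {}Hy := Hd _ Hy.
  apply: ex_CInt_continuous; first lra.
  move=> s Hs /=.
  apply: (continuous_comp
    (V := prod_UniformSpace (CR_space) R_UniformSpace)
    (fun s => ((y, u), s))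
    (fun p => K' (seg (fst (fst p)) (snd p)) (clip a b (snd (fst p))))).
    apply/continuous_ball_iff => eps; exists eps => s' Hs'; split => //=.
    exact: ball_center.
  exact: integrand_continuous.
- by move=> s Hs; apply: integrand_continuous.
Qed.

Lemma slope_eq (w : C) (t : R) :
  Cmod (w - w0) < r -> a <= t <= b -> K w t = (K w0 t + (w - w0) * Phi w t)%C.
Proof.
move=> Hw Ht.
have Hc : forall s, 0 <= s <= 1 -> ccont (fun s : R => K' (seg w s) t) s.
  move=> s Hs.
  apply: (continuous_comp_2 (V := C_UniformSpace) (W := R_UniformSpace) (X := C_UniformSpace)
    (fun s => seg w s) (fun _ => t) K').
  - apply: continuous_Cplus; first exact: continuous_const.
    apply: continuous_Cmult; last exact: continuous_const.
    by apply: continuous_RtoC; apply: continuous_id.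
  - exact: continuous_const.
  - by apply: HK' => //; exact: segment_in_disc.
rewrite /Phi clip_id // -CInt_scal; last by apply: ex_CInt_continuous => //; lra.
have := CInt_FTC (fun u => K (w0 + u * (w - w0)) t)%C
   (fun u => (w - w0) * K' (w0 + u * (w - w0)) t)%C 0 1.
move=> ->; last first.
- move=> s Hs; apply: continuous_Cmult; first exact: continuous_const.
  exact: Hc.
- move=> s Hs.
  apply: (cdiff_comp (fun u => w0 + u * (w - w0))%C (fun v => K v t)).
    have := cdiff_plus _ _ _ _ _ (cdiff_const w0 (RtoC s))
      (cdiff_mult _ _ _ _ _ (cdiff_id (RtoC s)) (cdiff_const (w - w0)%C (RtoC s))).
    by move/cdiff_eq; apply; ring.
  by apply: HK => //; exact: segment_in_disc.
- lra.
have -> : (w0 + RtoC 1 * (w - w0) = w)%C by ring.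
have -> : (w0 + RtoC 0 * (w - w0) = w0)%C by ring.
ring.
Qed.

(** The mean [Phi w t] of [K'] over the segment from [w0] to [w] is the Caratheodory slope of [K] at
    [w0]. It is jointly continuous, so its integral over [t] is continuous in [w] and is the slope
    of the integral. *)
Lemma cdiff_CInt_param : cdiff (fun w => CInt (K w) a b) w0 (CInt (K' w0) a b).
Proof.
have H00 : Cmod (w0 - w0) < r.
  by rewrite Cminus_diag Cmod_0.
have Hex : forall w, Cmod (w - w0) < r -> ex_CInt (Phi w) a b.
  move=> w Hw; apply: ex_CInt_continuous => // t Ht.
  exact: (continuous_slice Phi w t (slope_continuous w t Hw)).
have Hloc : locally (T := C_UniformSpace) w0 (fun y => Cmod (y - w0) < r).
  by apply/locally_Cmod; exists r.
apply: (cdiff_ext_loc (fun w => CInt (K w0) a b + (w - w0) * CInt (Phi w) a b)%C).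
  apply: locally_imp Hloc => w Hw.
  rewrite -CInt_scal; last exact: Hex.
  rewrite -CInt_plus; [|exact: HKint|].
    by apply: CInt_ext => // t Ht; rewrite (slope_eq w t) //; lra.
  have [l Hl] := Hex w Hw; exists ((w - w0) * l)%C; exact: is_CInt_scal.
exists (fun w => CInt (Phi w) a b); split; last split.
- apply: continuous_CInt_param => //.
    by apply: locally_imp Hloc => w; exact: Hex.
  by move=> t Ht; exact: slope_continuous.
- apply: CInt_ext => // t Ht; rewrite /Phi clip_id; last lra.
  rewrite (CInt_ext _ (fun _ => K' w0 t)); last first.
  + by move=> s _; congr K'; rewrite /seg; ring.
  + lra.
  rewrite CInt_const; have -> : 1 - 0 = 1 by ring.
  by ring.
- move=> y; have -> : (w0 - w0 = 0)%C by ring.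
  by ring.
Qed.

End ParametricDerivative.

(** * Goursat's theorem for rectangles *)

Definition pt (x y : R) : C := (RtoC x + Ci * RtoC y)%C.

(** The counterclockwise boundary integral: bottom minus top, plus [Ci] times right minus left. *)
Definition rect_int (F : C -> C) (a b c d : R) : C :=
  (CInt (fun x => F (pt x c)) a b - CInt (fun x => F (pt x d)) a b
   + Ci * (CInt (fun y => F (pt b y)) c d - CInt (fun y => F (pt a y)) c d))%C.

Definition in_rect (a b c d : R) (z : C) : Prop := a <= Re z <= b /\ c <= Im z <= d.

Lemma Re_pt (x y : R) : Re (pt x y) = x.
Proof. by rewrite /pt /=; ring. Qed.

Lemma Im_pt (x y : R) : Im (pt x y) = y.
Proof. by rewrite /pt /=; ring. Qed.

Lemma pt_Re_Im (z : C) : pt (Re z) (Im z) = z.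
Proof. by apply: C_ext; rewrite ?Re_pt ?Im_pt. Qed.

Lemma in_rect_pt (a b c d x y : R) : a <= x <= b -> c <= y <= d -> in_rect a b c d (pt x y).
Proof. by rewrite /in_rect Re_pt Im_pt. Qed.

Lemma pt_continuous_l (x y : R) : ccont (fun s : R => pt s y) x.
Proof.
apply: continuous_Cplus; last exact: continuous_const.
by apply: continuous_RtoC; apply: continuous_id.
Qed.

Lemma pt_continuous_r (x y : R) : ccont (fun s : R => pt x s) y.
Proof.
apply: continuous_Cplus; first exact: continuous_const.
apply: continuous_Cmult; first exact: continuous_const.
by apply: continuous_RtoC; apply: continuous_id.
Qed.

Section RectInt.

Variables (F : C -> C) (a b c d : R).
Hypotheses (Hab : a <= b) (Hcd : c <= d).
Hypothesis HF : forall z, in_rect a b c d z -> ccont_C F z.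

Lemma ex_CInt_horizontal (x1 x2 y : R) :
  a <= x1 -> x1 <= x2 -> x2 <= b -> c <= y <= d -> ex_CInt (fun x => F (pt x y)) x1 x2.
Proof.
move=> H1 H2 H3 Hy; apply: ex_CInt_continuous => // x Hx.
apply: (continuous_comp (V := C_UniformSpace) (fun s => pt s y) F); first exact: pt_continuous_l.
by apply: HF; apply: in_rect_pt => //; lra.
Qed.

Lemma ex_CInt_vertical (x y1 y2 : R) :
  a <= x <= b -> c <= y1 -> y1 <= y2 -> y2 <= d -> ex_CInt (fun y => F (pt x y)) y1 y2.
Proof.
move=> Hx H1 H2 H3; apply: ex_CInt_continuous => // y Hy.
apply: (continuous_comp (V := C_UniformSpace) (fun s => pt x s) F); first exact: pt_continuous_r.
by apply: HF; apply: in_rect_pt => //; lra.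
Qed.

Lemma rect_int_split (m n : R) :
  a <= m <= b -> c <= n <= d ->
  rect_int F a b c d =
  (rect_int F a m c n + rect_int F m b c n + rect_int F a m n d + rect_int F m b n d)%C.
Proof.
move=> Hm Hn.
have EX : forall y, c <= y <= d -> CInt (fun x => F (pt x y)) a b =
    (CInt (fun x => F (pt x y)) a m + CInt (fun x => F (pt x y)) m b)%C.
  move=> y Hy; symmetry; apply: (RInt_Chasles (V := C_R_CompleteNormedModule));
  by apply: ex_CInt_horizontal; lra.
have EY : forall x, a <= x <= b -> CInt (fun y => F (pt x y)) c d =
    (CInt (fun y => F (pt x y)) c n + CInt (fun y => F (pt x y)) n d)%C.
  move=> x Hx; symmetry; apply: (RInt_Chasles (V := C_R_CompleteNormedModule));
  by apply: ex_CInt_vertical; lra.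
rewrite /rect_int (EX c) ?(EX d) ?(EY a) ?(EY b); try lra.
ring.
Qed.

Lemma rect_int_bound (M : R) :
  (forall z, in_rect a b c d z -> Cmod (F z) <= M) ->
  Cmod (rect_int F a b c d) <= 2 * ((b - a) + (d - c)) * M.
Proof.
move=> HM.
have H1 : forall y, c <= y <= d -> Cmod (CInt (fun x => F (pt x y)) a b) <= (b - a) * M.
  move=> y Hy; apply: Cmod_CInt_le => //; first by apply: ex_CInt_horizontal; lra.
  by move=> x Hx; apply: HM; apply: in_rect_pt.
have H2 : forall x, a <= x <= b -> Cmod (CInt (fun y => F (pt x y)) c d) <= (d - c) * M.
  move=> x Hx; apply: Cmod_CInt_le => //; first by apply: ex_CInt_vertical; lra.
  by move=> y Hy; apply: HM; apply: in_rect_pt.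
rewrite /rect_int; apply: Rle_trans (Cmod_triangle _ _) _.
rewrite Cmod_mult Cmod_Ci.
have T : forall u v : C, Cmod (u - v) <= Cmod u + Cmod v.
  by move=> u v; rewrite -(Cmod_opp v); exact: Cmod_triangle.
have := T (CInt (fun x => F (pt x c)) a b) (CInt (fun x => F (pt x d)) a b).
have := T (CInt (fun y => F (pt b y)) c d) (CInt (fun y => F (pt a y)) c d).
have := H1 c ltac:(lra); have := H1 d ltac:(lra).
have := H2 a ltac:(lra); have := H2 b ltac:(lra).
lra.
Qed.

End RectInt.

Lemma cdiff_affine (u w : C) (z : C) : cdiff (fun v => u + w * v)%C z w.
Proof.
exists (fun _ => w); split; first exact: continuous_const.
by split => // y; ring.
Qed.

Lemma rect_int_primitive (F G : C -> C) (a b c d : R) :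
  a <= b -> c <= d ->
  (forall z, in_rect a b c d z -> cdiff G z (F z)) ->
  (forall z, in_rect a b c d z -> ccont_C F z) ->
  rect_int F a b c d = RtoC 0.
Proof.
move=> Hab Hcd HG HF.
have EX : forall y, c <= y <= d ->
    CInt (fun x => F (pt x y)) a b = (G (pt b y) - G (pt a y))%C.
  move=> y Hy; have -> // := CInt_FTC (fun u => G (u + Ci * RtoC y)%C)
    (fun u => F (u + Ci * RtoC y)%C) a b Hab.
  - move=> x Hx; have H1 : cdiff (fun u => u + Ci * RtoC y)%C (RtoC x) (RtoC 1).
      by move: (cdiff_affine (Ci * RtoC y)%C (RtoC 1) (RtoC x)); apply: cdiff_ext => v; ring.
    apply: cdiff_eq (cdiff_comp _ G _ _ (F (pt x y)) H1 _) _; last by rewrite /pt; ring.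
    by apply: HG; apply: in_rect_pt.
  - move=> x Hx; apply: (continuous_comp (V := C_UniformSpace) (fun s => pt s y) F).
      exact: pt_continuous_l.
    by apply: HF; apply: in_rect_pt.
have EY : forall x, a <= x <= b ->
    (Ci * CInt (fun y => F (pt x y)) c d = G (pt x d) - G (pt x c))%C.
  move=> x Hx.
  have Hc : forall y, c <= y <= d -> ccont (fun s : R => F (pt x s)) y.
    move=> y Hy; apply: (continuous_comp (V := C_UniformSpace) (fun s => pt x s) F).
      exact: pt_continuous_r.
    by apply: HF; apply: in_rect_pt.
  rewrite -CInt_scal; last exact: ex_CInt_continuous.
  have -> // := CInt_FTC (fun u => G (RtoC x + Ci * u)%C)
    (fun u => Ci * F (RtoC x + Ci * u))%C c d Hcd.
  - move=> y Hy.
    apply: (cdiff_comp _ G _ _ (F (pt x y)) (cdiff_affine (RtoC x) Ci (RtoC y))).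
    by apply: HG; apply: in_rect_pt.
  - move=> y Hy; apply: continuous_Cmult; first exact: continuous_const.
    exact: Hc.
rewrite /rect_int EX ?EX; try lra.
have -> : forall u v w : C, (u + Ci * (v - w) = u + (Ci * v - Ci * w))%C by move=> u v w; ring.
rewrite EY ?EY; try lra.
ring.
Qed.

Lemma rect_int_minus (F G : C -> C) (a b c d : R) :
  a <= b -> c <= d ->
  (forall z, in_rect a b c d z -> ccont_C F z) ->
  (forall z, in_rect a b c d z -> ccont_C G z) ->
  rect_int (fun z => F z - G z)%C a b c d = (rect_int F a b c d - rect_int G a b c d)%C.
Proof.
move=> Hab Hcd HF HG; rewrite /rect_int.
have EX : forall y, c <= y <= d -> CInt (fun x => F (pt x y) - G (pt x y))%C a b =
    (CInt (fun x => F (pt x y)) a b - CInt (fun x => G (pt x y)) a b)%C.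
  move=> y Hy; apply: CInt_minus.
    by apply: (ex_CInt_horizontal F a b c d HF); lra.
  by apply: (ex_CInt_horizontal G a b c d HG); lra.
have EY : forall x, a <= x <= b -> CInt (fun y => F (pt x y) - G (pt x y))%C c d =
    (CInt (fun y => F (pt x y)) c d - CInt (fun y => G (pt x y)) c d)%C.
  move=> x Hx; apply: CInt_minus.
    by apply: (ex_CInt_vertical F a b c d HF); lra.
  by apply: (ex_CInt_vertical G a b c d HG); lra.
rewrite !EX ?EY; try lra.
ring.
Qed.

(** The right endpoints decrease, so the supremum of the left endpoints lies in every interval. *)
Lemma nested_intervals (u : nat -> R) (w : R) :
  0 <= w ->
  (forall n, u n <= u (S n) <= u n + w / 2 ^ n / 2) ->
  exists x, forall n, u n <= x <= u n + w / 2 ^ n.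
Proof.
move=> Hw H.
have Hp : forall n, 0 < 2 ^ n by move=> n; apply: pow_lt; lra.
have Hstep : forall n, w / 2 ^ S n = w / 2 ^ n / 2.
  by move=> n /=; field; have := Hp n; lra.
have Hup : forall n k, u n <= u (n + k)%nat.
  move=> n; elim=> [|k IH]; first by rewrite Nat.add_0_r; lra.
  by rewrite Nat.add_succ_r; have := H (n + k)%nat; lra.
have Hdown : forall n k, u (n + k)%nat + w / 2 ^ (n + k) <= u n + w / 2 ^ n.
  move=> n; elim=> [|k IH]; first by rewrite Nat.add_0_r; lra.
  rewrite Nat.add_succ_r Hstep; have := H (n + k)%nat; lra.
have Hpos : forall n, 0 <= w / 2 ^ n.
  by move=> n; apply: Rmult_le_pos => //; apply: Rlt_le; apply: Rinv_0_lt_compat.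
have Hub : forall n m, u n <= u m + w / 2 ^ m.
  move=> n m; case: (Nat.le_ge_cases n m) => Hnm.
    have := Hup n (m - n)%nat; have -> : (n + (m - n) = m)%nat by lia.
    by have := Hpos m; lra.
  have := Hdown m (n - m)%nat; have -> : (m + (n - m) = n)%nat by lia.
  by have := Hpos n; lra.
have [x [Hx1 Hx2]] : {x | is_lub (fun y => exists n, y = u n) x}.
  apply: completeness; last by exists (u 0%nat), 0%nat.
  by exists (u 0%nat + w / 2 ^ 0) => _ [n ->].
exists x => n; split; first by apply: Hx1; exists n.
by apply: Hx2 => _ [m ->].
Qed.

Section Goursat.

Variables (F : C -> C) (a b c d : R).
Hypotheses (Hab : a <= b) (Hcd : c <= d).
Hypothesis HF : forall z, in_rect a b c d z -> exists l, cdiff F z l.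

Let w := b - a.
Let h := d - c.

Let sub_rect (n : nat) (p : R * R) : Prop :=
  a <= fst p /\ fst p + w / 2 ^ n <= b /\ c <= snd p /\ snd p + h / 2 ^ n <= d.

Let quarter (n : nat) (p : R * R) : C :=
  rect_int F (fst p) (fst p + w / 2 ^ n) (snd p) (snd p + h / 2 ^ n).

Let F_continuous (z : C) :
  in_rect a b c d z -> ccont_C F z.
Proof. by move=> /HF [l Hl]; exact: cdiff_continuous Hl. Qed.

Let pow2_pos (n : nat) : 0 < 2 ^ n.
Proof. by apply: pow_lt; lra. Qed.

Let half_side (s : R) (n : nat) : s / 2 ^ S n = s / 2 ^ n / 2.
Proof. by move=> /=; field; have := pow2_pos n; lra. Qed.

Let side_nonneg (s : R) (n : nat) : 0 <= s -> 0 <= s / 2 ^ n.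
Proof. by move=> H; apply: Rmult_le_pos => //; apply: Rlt_le; apply: Rinv_0_lt_compat. Qed.

(** One of the four quarters carries at least a quarter of the modulus. The premise stands under the
    existential quantifier so that choice produces a total successor function. *)
Lemma bisection_step (n : nat) (p : R * R) :
  exists q : R * R, sub_rect n p ->
    sub_rect (S n) q /\
    fst p <= fst q <= fst p + w / 2 ^ n / 2 /\
    snd p <= snd q <= snd p + h / 2 ^ n / 2 /\
    Cmod (quarter n p) <= 4 * Cmod (quarter (S n) q).
Proof.
case: p => x y; case: (classic (sub_rect n (x, y))) => [[/= H1 [H2 [H3 H4]]] | H];
  last by exists (0, 0).
have Hw : 0 <= w / 2 ^ n by apply: side_nonneg; rewrite /w; lra.
have Hh : 0 <= h / 2 ^ n by apply: side_nonneg; rewrite /h; lra.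
have Hs := rect_int_split F x (x + w / 2 ^ n) y (y + h / 2 ^ n) ltac:(lra) ltac:(lra) _
  (x + w / 2 ^ n / 2) (y + h / 2 ^ n / 2) ltac:(lra) ltac:(lra).
have {}Hs := Hs ltac:(move=> z [Hz1 Hz2]; apply: F_continuous; split; lra).
set q1 := rect_int F x (x + w / 2 ^ n / 2) y (y + h / 2 ^ n / 2) in Hs.
set q2 := rect_int F (x + w / 2 ^ n / 2) (x + w / 2 ^ n) y (y + h / 2 ^ n / 2) in Hs.
set q3 := rect_int F x (x + w / 2 ^ n / 2) (y + h / 2 ^ n / 2) (y + h / 2 ^ n) in Hs.
set q4 := rect_int F (x + w / 2 ^ n / 2) (x + w / 2 ^ n) (y + h / 2 ^ n / 2) (y + h / 2 ^ n) in Hs.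
have Hsum : Cmod (quarter n (x, y)) <= Cmod q1 + Cmod q2 + Cmod q3 + Cmod q4.
  rewrite /quarter /= Hs.
  have := Cmod_triangle (q1 + q2 + q3) q4; have := Cmod_triangle (q1 + q2) q3.
  have := Cmod_triangle q1 q2; lra.
have Ew : forall s, s + w / 2 ^ n / 2 + w / 2 ^ n / 2 = s + w / 2 ^ n by move=> s; field; have := pow2_pos n; lra.
have Eh : forall s, s + h / 2 ^ n / 2 + h / 2 ^ n / 2 = s + h / 2 ^ n by move=> s; field; have := pow2_pos n; lra.
have [Hq | [Hq | [Hq | Hq]]] : Cmod (quarter n (x, y)) <= 4 * Cmod q1 \/
  Cmod (quarter n (x, y)) <= 4 * Cmod q2 \/ Cmod (quarter n (x, y)) <= 4 * Cmod q3 \/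
  Cmod (quarter n (x, y)) <= 4 * Cmod q4 by lra.
- exists (x, y) => _; rewrite /sub_rect /quarter !half_side /=.
  by repeat split => //; lra.
- exists (x + w / 2 ^ n / 2, y) => _; rewrite /sub_rect /quarter !half_side /= Ew.
  by repeat split => //; lra.
- exists (x, y + h / 2 ^ n / 2) => _; rewrite /sub_rect /quarter !half_side /= Eh.
  by repeat split => //; lra.
- exists (x + w / 2 ^ n / 2, y + h / 2 ^ n / 2) => _.
  rewrite /sub_rect /quarter !half_side /= Ew Eh.
  by repeat split => //; lra.
Qed.

Theorem goursat : rect_int F a b c d = RtoC 0.
Proof.
pose next n p := proj1_sig (constructive_indefinite_description _ (bisection_step n p)).
pose p := nat_rect (fun _ => (R * R)%type) (a, c) next.
have Hnext : forall n q, sub_rect n q ->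
    sub_rect (S n) (next n q) /\
    fst q <= fst (next n q) <= fst q + w / 2 ^ n / 2 /\
    snd q <= snd (next n q) <= snd q + h / 2 ^ n / 2 /\
    Cmod (quarter n q) <= 4 * Cmod (quarter (S n) (next n q)).
  by move=> n q; rewrite /next; case: (constructive_indefinite_description _ _).
have Hsub : forall n, sub_rect n (p n).
  elim=> [|n IH]; last exact: (proj1 (Hnext n (p n) IH)).
  by rewrite /sub_rect /= /w /h; repeat split; lra.
have Hw : 0 <= w by rewrite /w; lra.
have Hh : 0 <= h by rewrite /h; lra.
have [x Hx] := nested_intervals (fun n => fst (p n)) w Hw
  (fun n => proj1 (proj2 (Hnext n (p n) (Hsub n)))).
have [y Hy] := nested_intervals (fun n => snd (p n)) h Hh
  (fun n => proj1 (proj2 (proj2 (Hnext n (p n) (Hsub n))))).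
have Hgrow : forall n, Cmod (rect_int F a b c d) <= 4 ^ n * Cmod (quarter n (p n)).
  elim=> [|n IH].
    rewrite /quarter /= /w /h.
    have -> : a + (b - a) / 1 = b by field.
    have -> : c + (d - c) / 1 = d by field.
    lra.
  have [_ [_ [_ Hq]]] := Hnext n (p n) (Hsub n).
  apply: Rle_trans IH _; rewrite /=.
  have H4 : 0 < 4 ^ n by apply: pow_lt; lra.
  rewrite /= in Hq; nra.
have Hin : in_rect a b c d (pt x y).
  have := Hx 0%nat; have := Hy 0%nat; rewrite /= /w /h => ? ?.
  by apply: in_rect_pt; lra.
have [l /cdiff_eps Hl] := HF _ Hin.
(* The affine part [A] of [F] at the limit point has a primitive and contributes nothing. The rest
   is at most [eps] times the sum of the sides, as is the diameter without [eps]; the factor [4 ^ n]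
   from the bisection cancels the square of the scale. *)
have Hsmall : forall eps, 0 < eps -> Cmod (rect_int F a b c d) <= 2 * eps * (w + h) ^ 2.
  move=> eps Heps; have [dl [Hdl Hd]] := Hl eps Heps.
  have [n Hn] : exists n, (w + h) / 2 ^ n < dl.
    have [n Hn] := Pow_x_infinity 2 ltac:(rewrite Rabs_pos_eq; lra) ((w + h) / dl + 1).
    exists n; have {}Hn := Hn n (Nat.le_refl n).
    rewrite Rabs_pos_eq in Hn; last by apply: Rlt_le.
    apply/Rlt_div_l; first exact: pow2_pos.
    have : (w + h) / dl < 2 ^ n by lra.
    by move/Rlt_div_l; lra.
  have {}Hn : w / 2 ^ n + h / 2 ^ n < dl by move: Hn; rewrite /Rdiv; lra.
  set wn := w / 2 ^ n in Hn; set hn := h / 2 ^ n in Hn.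
  have Hwn : 0 <= wn by exact: side_nonneg.
  have Hhn : 0 <= hn by exact: side_nonneg.
  have [/= S1 [S2 [S3 S4]]] := Hsub n.
  have Hxn := Hx n; have Hyn := Hy n.
  set A := fun z : C => (F (pt x y) - pt x y * l + l * z)%C.
  have HA : forall z, cdiff A z l by move=> z; exact: cdiff_affine.
  have HAc : forall z, ccont_C A z.
    by move=> z; exact: cdiff_continuous (HA z).
  have HFn : forall z, in_rect (fst (p n)) (fst (p n) + wn) (snd (p n)) (snd (p n) + hn) z ->
      ccont_C F z.
    by move=> z [? ?]; apply: F_continuous; rewrite -/wn in S2; rewrite -/hn in S4; split; lra.
  have HA0 : rect_int A (fst (p n)) (fst (p n) + wn) (snd (p n)) (snd (p n) + hn) = RtoC 0.
    apply: (rect_int_primitive A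
      (fun z => (F (pt x y) - pt x y * l) * z + l * (z * z) / RtoC 2)%C); try lra.
    - move=> z _.
      have H1 := cdiff_scal _ _ _ (cdiff_id z) (F (pt x y) - pt x y * l)%C.
      have H2 := cdiff_scal _ _ _ (cdiff_mult _ _ _ _ _ (cdiff_id z) (cdiff_id z)) (l / RtoC 2)%C.
      move: (cdiff_plus _ _ _ _ _ H1 H2) => /cdiff_eq H.
      have {}H : cdiff (fun y0 => (F (pt x y) - pt x y * l) * y0 + l / 2 * (y0 * y0))%C z (A z).
        by apply: H; rewrite /A; field; move/RtoC_inj; lra.
      by move: H; apply: cdiff_ext => v; field; move/RtoC_inj; lra.
    - by move=> z _; exact: HAc.
  have Hq : quarter n (p n) = rect_int (fun z => F z - A z)%C
      (fst (p n)) (fst (p n) + wn) (snd (p n)) (snd (p n) + hn).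
    rewrite rect_int_minus //; try lra.
    by rewrite HA0 /quarter -/wn -/hn; ring.
  have Hb : Cmod (quarter n (p n)) <= 2 * (wn + hn) * (eps * (wn + hn)).
    rewrite Hq.
    have -> : wn + hn = (fst (p n) + wn - fst (p n)) + (snd (p n) + hn - snd (p n)) by ring.
    apply: rect_int_bound; try lra.
      by move=> z Hz; apply: continuous_Cminus; [exact: HFn | exact: HAc].
    have -> : fst (p n) + wn - fst (p n) + (snd (p n) + hn - snd (p n)) = wn + hn by ring.
    move=> z [Hz1 Hz2].
    have Hdist : Cmod (z - pt x y) <= wn + hn.
      have E : (z - pt x y = RtoC (Re z - x) + Ci * RtoC (Im z - y))%C.
        by rewrite -{1}(pt_Re_Im z) /pt !RtoC_minus; ring.
      rewrite E; apply: Rle_trans (Cmod_triangle _ _) _.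
      rewrite Cmod_mult Cmod_Ci !Cmod_R Rmult_1_l.
      rewrite -/wn in Hxn; rewrite -/hn in Hyn.
      by apply: Rplus_le_compat; apply: Rabs_le; lra.
    have -> : (F z - A z = F z - F (pt x y) - (z - pt x y) * l)%C by rewrite /A; ring.
    apply: Rle_trans (Hd z _) _; first lra.
    by apply: Rmult_le_compat_l; lra.
  apply: Rle_trans (Hgrow n) _.
  have E4 : 4 ^ n = 2 ^ n * 2 ^ n by rewrite -Rpow_mult_distr; congr (_ ^ _); ring.
  have H2n := pow2_pos n.
  have Ew : w = wn * 2 ^ n by rewrite /wn; field; lra.
  have Eh : h = hn * 2 ^ n by rewrite /hn; field; lra.
  have -> : 2 * eps * (w + h) ^ 2 = 4 ^ n * (2 * (wn + hn) * (eps * (wn + hn))).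
    by rewrite E4 Ew Eh; ring.
  by apply: Rmult_le_compat_l => //; apply: pow_le; lra.
apply: Cmod_eq_0; apply: Rle_antisym; last exact: Cmod_ge_0.
apply: le_epsilon => e He.
have Hs : 0 <= (w + h) ^ 2 by apply: pow2_ge_0.
have He' : 0 < e / (2 * (w + h) ^ 2 + 1) by apply: Rdiv_lt_0_compat; lra.
apply: Rle_trans (Hsmall _ He') _.
have -> : 2 * (e / (2 * (w + h) ^ 2 + 1)) * (w + h) ^ 2 = e * ((2 * (w + h) ^ 2) / (2 * (w + h) ^ 2 + 1)).
  by field; lra.
have : (2 * (w + h) ^ 2) / (2 * (w + h) ^ 2 + 1) <= 1 by apply/Rle_div_l; lra.
nra.
Qed.

End Goursat.

(** * Mean values over circles and Cauchy's formula *)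

Definition disc (c : C) (r : R) (z : C) : Prop := Cmod (z - c) < r.

Definition circle_point (c : C) (r : R) (t : R) : C := (c + RtoC r * Cexp (Ci * RtoC t))%C.

(** Integration is against the angle, so this is [2 * PI] times a mean value rather than a contour
    integral. *)
Definition circle_int (f : C -> C) (c : C) (r : R) : C :=
  CInt (fun t => f (circle_point c r t)) 0 (2 * PI).

Lemma disc_locally (c : C) (r : R) (z : C) :
  disc c r z -> locally (T := C_UniformSpace) z (disc c r).
Proof.
move=> Hz; apply/locally_Cmod; exists (r - Cmod (z - c)); split; first by rewrite /disc in Hz; lra.
by move=> y Hy; rewrite /disc; have := Cmod_triangle_minus y z c; lra.
Qed.

Lemma disc_center (c : C) (r : R) : 0 < r -> disc c r c.
Proof.
by rewrite /disc Cminus_diag Cmod_0.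
Qed.

Lemma holomorphic_cdiff (U : C -> Prop) (f : C -> C) (z : C) :
  holomorphic_on U f -> U z -> cdiff f z (C_derive f z).
Proof.
move=> Hf Hz; have [l Hl] := Hf z Hz.
by rewrite (is_C_derive_unique _ _ _ Hl); apply/cdiff_is_derive.
Qed.

Lemma holomorphic_intro (U : C -> Prop) (f f' : C -> C) :
  (forall z, U z -> cdiff f z (f' z)) -> holomorphic_on U f.
Proof. by move=> H z Hz; exists (f' z); apply/cdiff_is_derive; exact: H. Qed.

Lemma holomorphic_continuous (U : C -> Prop) (f : C -> C) (z : C) :
  holomorphic_on U f -> U z -> ccont_C f z.
Proof. by move=> Hf Hz; exact: cdiff_continuous (holomorphic_cdiff _ _ _ Hf Hz). Qed.

Lemma holomorphic_subset (U V : C -> Prop) (f : C -> C) :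
  (forall z, V z -> U z) -> holomorphic_on U f -> holomorphic_on V f.
Proof. by move=> H Hf z /H; exact: Hf. Qed.

Lemma Cmod_Cexp_Ci (t : R) : Cmod (Cexp (Ci * RtoC t)) = 1.
Proof.
rewrite Cmod_Cexp; have -> : Re (Ci * RtoC t)%C = 0 by rewrite /=; ring.
exact: exp_0.
Qed.

Lemma Cmod_circle_point (c : C) (r t : R) : 0 <= r -> Cmod (circle_point c r t - c) = r.
Proof.
move=> Hr; have -> : (circle_point c r t - c = RtoC r * Cexp (Ci * RtoC t))%C.
  by rewrite /circle_point; ring.
by rewrite Cmod_mult Cmod_Cexp_Ci Cmod_RtoC_nonneg // Rmult_1_r.
Qed.

Lemma circle_point_continuous2 (c : C) (r t : R) :
  continuous (T := prod_UniformSpace R_UniformSpace R_UniformSpace) (U := C_UniformSpace)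
    (fun p => circle_point c (fst p) (snd p)) (r, t).
Proof.
apply: continuous_Cplus; first exact: continuous_const.
apply: continuous_Cmult; first by apply: continuous_RtoC; exact: continuous_fst.
apply: continuous_Cexp; apply: continuous_Cmult; first exact: continuous_const.
by apply: continuous_RtoC; exact: continuous_snd.
Qed.

Lemma circle_point_continuous (c : C) (r t : R) : ccont (circle_point c r) t.
Proof.
exact: (continuous_slice (circle_point c) r t (circle_point_continuous2 c r t)).
Qed.

Lemma two_PI_pos : 0 < 2 * PI.
Proof. have := PI_RGT_0; lra. Qed.

Section CircleIntegral.

Variables (f : C -> C) (c : C) (r0 : R).
Hypothesis Hr0 : 0 <= r0.

Lemma ex_circle_int :
  (forall z, Cmod (z - c) = r0 -> ccont_C f z) ->
  ex_CInt (fun t => f (circle_point c r0 t)) 0 (2 * PI).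
Proof.
move=> Hf; apply: ex_CInt_continuous; first exact: Rlt_le two_PI_pos.
move=> t _; apply: (continuous_comp (V := C_UniformSpace) (circle_point c r0) f).
  exact: circle_point_continuous.
by apply: Hf; rewrite Cmod_circle_point.
Qed.

Lemma circle_int_continuous (rho : R) :
  r0 < rho ->
  (forall z, disc c rho z -> ccont_C f z) ->
  ccont (circle_int f c) r0.
Proof.
move=> Hrho Hf.
have Hin : forall s t, Rabs s < rho -> disc c rho (circle_point c s t).
  move=> s t Hs; rewrite /disc.
  have -> : (circle_point c s t - c = RtoC s * Cexp (Ci * RtoC t))%C by rewrite /circle_point; ring.
  by rewrite Cmod_mult Cmod_Cexp_Ci Cmod_R; lra.
have Hp := two_PI_pos.
apply: continuous_CInt_param; first lra.
- have Hd : 0 < rho - r0 by lra.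
  exists (mkposreal _ Hd) => s Hs.
  have {}Hs : Rabs (s - r0) < rho - r0 by exact: Hs.
  apply: ex_CInt_continuous; first lra.
  move=> t _; apply: (continuous_comp (V := C_UniformSpace) (circle_point c s) f).
    exact: circle_point_continuous.
  apply: Hf; apply: Hin.
  have E : forall u : R, u = (u - r0) + r0 by move=> u; ring.
  rewrite (E s); apply: Rle_lt_trans (Rabs_triang _ _) _; rewrite (Rabs_pos_eq r0) //; lra.
- move=> t _.
  apply: (continuous_comp (V := C_UniformSpace) (fun p => circle_point c (fst p) (snd p)) f).
    exact: circle_point_continuous2.
  by apply: Hf; apply: Hin; rewrite Rabs_pos_eq.
Qed.

End CircleIntegral.

Lemma circle_int_0 (f : C -> C) (c : C) : circle_int f c 0 = (RtoC (2 * PI) * f c)%C.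
Proof.
rewrite /circle_int (CInt_ext _ (fun _ => f c)).
- by rewrite CInt_const Rminus_0_r.
- exact: Rlt_le two_PI_pos.
- by move=> t _; congr f; rewrite /circle_point; ring.
Qed.

(* Goursat's theorem for [u |-> f (c + exp u)] on [[ln r1, ln r2] x [0, 2 pi]];
   the horizontal sides cancel by periodicity. *)
Lemma circle_int_annulus (f : C -> C) (c : C) (r1 r2 : R) :
  0 < r1 -> r1 <= r2 ->
  (forall z, r1 <= Cmod (z - c) <= r2 -> exists l, cdiff f z l) ->
  circle_int f c r1 = circle_int f c r2.
Proof.
move=> H1 H12 Hf.
pose F u := f (c + Cexp u)%C.
have Hmod : forall x, ln r1 <= x <= ln r2 -> r1 <= exp x <= r2.
  move=> x [Hx1 Hx2]; rewrite -(exp_ln r1) // -(exp_ln r2); last lra.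
  have He : forall u v, u <= v -> exp u <= exp v.
    by move=> u v [/exp_increasing /Rlt_le // | ->]; apply: Rle_refl.
  by split; apply: He.
have Hln : ln r1 <= ln r2 by apply: ln_le.
have HF : forall u, in_rect (ln r1) (ln r2) 0 (2 * PI) u -> exists l, cdiff F u l.
  move=> u [Hu _].
  have [l Hl] : exists l, cdiff f (c + Cexp u)%C l.
    apply: Hf; have -> : (c + Cexp u - c = Cexp u)%C by ring.
    by rewrite Cmod_Cexp; exact: Hmod.
  have H0 := cdiff_plus _ _ _ _ _ (cdiff_const c u) (cdiff_Cexp u).
  exists ((RtoC 0 + Cexp u) * l)%C; exact: (cdiff_comp _ f _ _ _ H0 Hl).
have := goursat F (ln r1) (ln r2) 0 (2 * PI) Hln (Rlt_le _ _ two_PI_pos) HF.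
rewrite /rect_int.
have -> : (fun x => F (pt x (2 * PI))) = (fun x => F (pt x 0)).
  apply: functional_extensionality => x; rewrite /F; congr (f (c + _)%C).
  apply: C_ext; rewrite /Cexp Re_pt Im_pt Re_pt Im_pt /=.
    by rewrite cos_2PI cos_0.
  by rewrite sin_2PI sin_0.
have Hcirc : forall r, 0 < r -> CInt (fun y => F (pt (ln r) y)) 0 (2 * PI) = circle_int f c r.
  move=> r Hr; congr (RInt _ 0 (2 * PI)); apply: functional_extensionality => y.
  rewrite /F /circle_point; congr (f (c + _)%C).
  rewrite /pt Cexp_plus; congr (_ * _)%C.
  by apply: C_ext; rewrite /= exp_ln // ?cos_0 ?sin_0; ring.
rewrite !Hcirc //; last lra.
set X := CInt _ _ _; move=> E.
have {}E : (circle_int f c r2 - circle_int f c r1 = 0)%C.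
  have E2 : (Ci * (circle_int f c r2 - circle_int f c r1) = 0)%C by rewrite -E; ring.
  have -> : (circle_int f c r2 - circle_int f c r1
    = - Ci * (Ci * (circle_int f c r2 - circle_int f c r1)))%C.
    by apply: C_ext => /=; ring.
  by rewrite E2; ring.
have -> : (circle_int f c r2 = (circle_int f c r2 - circle_int f c r1) + circle_int f c r1)%C by ring.
by rewrite E; ring.
Qed.

Lemma continuous_accumulation (N : R -> C) (x : R) (k : C) :
  ccont N x -> (forall d, 0 < d -> exists y, Rabs (y - x) < d /\ N y = k) -> N x = k.
Proof.
move=> /continuous_C_iff HN Hk.
apply/Ceq_minus; apply: Cmod_eq_0; apply: Rle_antisym; last exact: Cmod_ge_0.
apply: le_epsilon => e He; have [d Hd] := HN e He.
have [y [Hy1 Hy2]] := Hk d (cond_pos d).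
have := Hd y Hy1; rewrite Hy2 Cmod_minus_sym; lra.
Qed.

(* The possible singularity on the circle of radius [rho] is bridged by the
   continuity of the mean in the radius. *)
Lemma circle_int_exceptional (f : C -> C) (c : C) (rho R0 r : R) :
  0 <= rho -> 
  (forall z, disc c R0 z -> ccont_C f z) ->
  (forall z, disc c R0 z -> Cmod (z - c) <> rho -> exists l, cdiff f z l) ->
  0 <= r < R0 ->
  circle_int f c r = (RtoC (2 * PI) * f c)%C.
Proof.
move=> Hrho Hcont Hdiff Hr.
have HN : forall s, 0 <= s < R0 -> ccont (circle_int f c) s.
  by move=> s Hs; apply: (circle_int_continuous f c s _ R0) => //; lra.
have Hann : forall r1 r2, 0 < r1 <= r2 -> r2 < R0 -> (r2 < rho \/ rho < r1) ->
    circle_int f c r1 = circle_int f c r2.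
  move=> r1 r2 H12 H2 Hor; apply: circle_int_annulus; try lra.
  move=> z Hz; apply: Hdiff; first by rewrite /disc; lra.
  by case: Hor => ?; lra.
have Hlow : forall s, 0 <= s < R0 -> s < rho -> circle_int f c s = (RtoC (2 * PI) * f c)%C.
  move=> s Hs Hsr; rewrite -circle_int_0; symmetry.
  apply: continuous_accumulation; first by apply: HN; lra.
  move=> d Hd; case: (Req_dec s 0) => [-> | Hs0].
    by exists 0; split => //; rewrite Rminus_0_r Rabs_R0.
  exists (Rmin s (d / 2)); split.
    rewrite Rminus_0_r Rabs_pos_eq; first by have := Rmin_r s (d / 2); lra.
    by apply: Rmin_glb; lra.
  apply: Hann; [split; [apply: Rmin_pos; lra | exact: Rmin_l] | lra | lra].
have Hrho0 : rho < R0 -> circle_int f c rho = (RtoC (2 * PI) * f c)%C.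
  move=> HR; case: (Req_dec rho 0) => [-> | Hn]; first exact: circle_int_0.
  apply: continuous_accumulation; first by apply: HN; lra.
  move=> d Hd; exists (Rmax (rho / 2) (rho - d / 2)).
  have H1 := Rmax_l (rho / 2) (rho - d / 2); have H2 := Rmax_r (rho / 2) (rho - d / 2).
  have H3 : Rmax (rho / 2) (rho - d / 2) < rho by apply: Rmax_lub_lt; lra.
  split; first by apply: Rabs_def1; lra.
  by apply: Hlow; lra.
case: (Rtotal_order r rho) => [H | [E | H]]; first by apply: Hlow; lra.
  by rewrite E; apply: Hrho0; lra.
rewrite -Hrho0; last lra.
symmetry; apply: continuous_accumulation; first by apply: HN; lra.
move=> d Hd; exists (Rmin r (rho + d / 2)).
have H1 := Rmin_l r (rho + d / 2); have H2 := Rmin_r r (rho + d / 2).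
have H3 : rho < Rmin r (rho + d / 2) by apply: Rmin_glb_lt; lra.
split; first by apply: Rabs_def1; lra.
by apply: Hann; lra.
Qed.

Lemma mean_value (f : C -> C) (c : C) (R0 r : R) :
  holomorphic_on (disc c R0) f -> 0 <= r < R0 ->
  circle_int f c r = (RtoC (2 * PI) * f c)%C.
Proof.
move=> Hf Hr; apply: (circle_int_exceptional f c 0 R0) => //; first lra.
  by move=> z; exact: holomorphic_continuous.
by move=> z Hz _; exists (C_derive f z); exact: holomorphic_cdiff Hf Hz.
Qed.

Lemma Cminus_neq_0 (x y : C) : x <> y -> (x - y <> 0)%C.
Proof. by move=> H E; apply: H; apply/Ceq_minus. Qed.

Lemma Cmod_lt_minus_neq_0 (z w : C) : Cmod w < Cmod z -> (z - w <> 0)%C.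
Proof. by move=> H; apply: Cminus_neq_0 => E; rewrite E in H; lra. Qed.

Lemma circle_point_0_mod (r t : R) : 0 <= r -> Cmod (circle_point (RtoC 0) r t) = r.
Proof.
move=> Hr; have := Cmod_circle_point (RtoC 0) r t Hr.
by rewrite Cminus_0_r.
Qed.

(** The integral does not change when the radius grows beyond [r], and [z / (z - w)] tends to 1 at
    infinity. *)
Lemma circle_int_cauchy_kernel (w : C) (r : R) :
  Cmod w < r -> circle_int (fun z => z / (z - w))%C (RtoC 0) r = RtoC (2 * PI).
Proof.
move=> Hw; have Hw0 := Cmod_ge_0 w; have Hp := two_PI_pos.
have Hd : forall z, Cmod w < Cmod z ->
    cdiff (fun z => z / (z - w))%C z ((1 * (z - w) - z * (1 - 0)) / ((z - w) * (z - w)))%C.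
  move=> z Hz; apply: cdiff_div; first exact: cdiff_id.
    exact: cdiff_minus (cdiff_id _) (cdiff_const _ _).
  exact: Cmod_lt_minus_neq_0.
apply/Ceq_minus; apply: Cmod_eq_0; apply: Rle_antisym; last exact: Cmod_ge_0.
apply: le_epsilon => e He.
(* On this circle [|z - w| >= 2 * PI * |w| / e], so the deviation [|w / (z - w)|] of the kernel from
   1 is at most [e / (2 * PI)]. *)
set rho := Rmax r (Cmod w + 2 * PI * Cmod w / e).
have Hrho1 : r <= rho by exact: Rmax_l.
have Hrho2 : Cmod w + 2 * PI * Cmod w / e <= rho by exact: Rmax_r.
rewrite (circle_int_annulus _ _ r rho); try lra; last first.
  move=> z; rewrite Cminus_0_r => Hz; eexists; apply: Hd; lra.
have Hex : ex_CInt (fun t => circle_point 0 rho t / (circle_point 0 rho t - w))%C 0 (2 * PI).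
  apply: (ex_circle_int (fun z => z / (z - w))%C (RtoC 0) rho); first lra.
  by move=> z; rewrite Cminus_0_r => Hz; apply: cdiff_continuous (Hd z _); lra.
have E1 : RtoC (2 * PI) = CInt (fun _ => RtoC 1) 0 (2 * PI).
  by rewrite CInt_const Rminus_0_r; ring.
rewrite E1 /circle_int -CInt_minus //; last exact: (ex_RInt_const (V := C_R_NormedModule)).
have -> : 0 + e = (2 * PI - 0) * (e / (2 * PI)) by field; exact: PI_neq0.
apply: Cmod_CInt_le; first lra.
  apply: (ex_RInt_minus (V := C_R_CompleteNormedModule)) => //.
  exact: (ex_RInt_const (V := C_R_NormedModule)).
move=> t _; set z := circle_point _ _ _.
have Hz : Cmod z = rho by apply: circle_point_0_mod; lra.
have Hne : (z - w <> 0)%C by apply: Cmod_lt_minus_neq_0; lra.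
have -> : (z / (z - w) - 1 = w / (z - w))%C by field.
rewrite Cmod_div //.
have Hge : rho - Cmod w <= Cmod (z - w) by rewrite -Hz; exact: Cmod_reverse_triangle.
have Hpos : 0 < Cmod (z - w) by lra.
apply/Rle_div_l => //.
apply: (Rle_trans _ (e / (2 * PI) * (2 * PI * Cmod w / e))).
  by apply: Req_le; field; split; [lra | exact: PI_neq0].
apply: Rmult_le_compat_l; last lra.
by apply: Rlt_le; apply: Rdiv_lt_0_compat.
Qed.

(** The slope [phi] of [f] at [w] is continuous on the disc and differentiable off [w]. Hence
    [z * phi z] has a mean value property with the single exceptional radius [|w|], and its central
    value is 0. *)
Lemma cauchy_formula (f : C -> C) (R0 r : R) (w : C) :
  holomorphic_on (disc (RtoC 0) R0) f -> Cmod w < r -> r < R0 ->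
  circle_int (fun z => f z * (z / (z - w)))%C (RtoC 0) r = (RtoC (2 * PI) * f w)%C.
Proof.
move=> Hf Hw Hr; have Hw0 := Cmod_ge_0 w.
have Hdw : disc (RtoC 0) R0 w by rewrite /disc Cminus_0_r; lra.
have [phi [Hphi [_ Ephi]]] := holomorphic_cdiff _ _ _ Hf Hdw.
have Hquot : forall z, z <> w -> phi z = ((f z - f w) / (z - w))%C.
  by move=> z Hz; rewrite (Ephi z); field; exact: Cminus_neq_0.
have Hphid : forall z, disc (RtoC 0) R0 z -> z <> w -> exists l, cdiff phi z l.
  move=> z Hz Hzw; eexists.
  apply: (cdiff_ext_loc (fun z => (f z - f w) / (z - w))%C); last first.
    apply: (cdiff_div _ _ _ (C_derive f z - 0)%C (1 - 0)%C).
    - exact: cdiff_minus (holomorphic_cdiff _ _ _ Hf Hz) (cdiff_const _ _).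
    - exact: cdiff_minus (cdiff_id _) (cdiff_const _ _).
    - exact: Cminus_neq_0.
  apply/locally_Cmod; exists (Cmod (z - w)); split.
    by apply/Cmod_gt_0; exact: Cminus_neq_0.
  move=> y Hy; rewrite Hquot // => E; rewrite E Cmod_minus_sym in Hy; lra.
have Hphic : forall z, disc (RtoC 0) R0 z -> ccont_C phi z.
  move=> z Hz; case: (classic (z = w)) => [-> // | Hzw].
  by have [l Hl] := Hphid z Hz Hzw; exact: cdiff_continuous Hl.
have H0 : circle_int (fun z => z * phi z)%C (RtoC 0) r = RtoC 0.
  rewrite (circle_int_exceptional _ (RtoC 0) (Cmod w) R0); try lra.
  - ring.
  - by move=> z Hz; apply: continuous_Cmult; [exact: continuous_id | exact: Hphic].
  - move=> z Hz; rewrite Cminus_0_r => Hm.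
    have [l Hl] := Hphid z Hz ltac:(by move=> E; apply: Hm; rewrite E).
    eexists; exact: (cdiff_mult _ _ _ _ _ (cdiff_id z) Hl).
have Hin : forall z, Cmod (z - 0) = r -> disc (RtoC 0) R0 z by move=> z Hz; rewrite /disc Hz.
have Hker : ex_CInt (fun t => circle_point 0 r t / (circle_point 0 r t - w))%C 0 (2 * PI).
  apply: (ex_circle_int (fun z => z / (z - w))%C (RtoC 0) r); first lra.
  move=> z; rewrite Cminus_0_r => Hz; apply: continuous_Cdiv.
  - by apply: Cmod_lt_minus_neq_0; lra.
  - exact: continuous_id.
  - by apply: continuous_Cminus; [exact: continuous_id | exact: continuous_const].
rewrite -(circle_int_cauchy_kernel w r Hw) Cmult_comm.
rewrite /circle_int -CInt_scal //.
have E : forall u : C, u = (u + circle_int (fun z => z * phi z)%C (RtoC 0) r)%C.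
  by move=> u; rewrite H0; ring.
rewrite (E (CInt (fun t => f w * _)%C _ _)) /circle_int -CInt_plus; first last.
- apply: (ex_circle_int (fun z => z * phi z)%C); first lra.
  move=> z /Hin Hz; apply: continuous_Cmult; [exact: continuous_id | exact: Hphic].
- by have [l Hl] := Hker; exists (f w * l)%C; exact: is_CInt_scal.
apply: CInt_ext; first exact: Rlt_le two_PI_pos.
move=> t _; set z := circle_point _ _ _.
have Hz : Cmod z = r by apply: circle_point_0_mod; lra.
have Hne : (z - w <> 0)%C by apply: Cmod_lt_minus_neq_0; lra.
by rewrite (Ephi z); field.
Qed.

(* Differentiating Cauchy's formula twice under the integral sign. *)
Lemma cauchy_derivative_disc (f : C -> C) (R0 : R) :
  holomorphic_on (disc (RtoC 0) R0) f -> holomorphic_on (disc (RtoC 0) R0) (C_derive f).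
Proof.
move=> Hf w0 Hw0.
have Hw0' : Cmod w0 < R0 by move: Hw0; rewrite /disc Cminus_0_r.
have Hm0 := Cmod_ge_0 w0.
pose r := (Cmod w0 + R0) / 2.
have Hr : 0 < r < R0 /\ Cmod w0 < r by rewrite /r; lra.
pose z t := circle_point (RtoC 0) r t.
have Hz : forall t, Cmod (z t) = r by move=> t; apply: circle_point_0_mod; lra.
have Hfz : forall t, ccont (fun t => f (z t)) t.
  move=> t; apply: (continuous_comp (V := C_UniformSpace) z f); first exact: circle_point_continuous.
  by apply: (holomorphic_continuous _ _ _ Hf); rewrite /disc Cminus_0_r Hz; lra.
pose K0 w t := (f (z t) * (z t / (z t - w)))%C.
pose K1 w t := (f (z t) * (z t / ((z t - w) * (z t - w))))%C.
pose K2 w t := (f (z t) * (RtoC 2 * z t / ((z t - w) * (z t - w) * (z t - w))))%C.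
have Hne : forall w t, Cmod w < r -> (z t - w <> 0)%C.
  by move=> w t Hw; apply: Cmod_lt_minus_neq_0; rewrite Hz.
have D1 : forall w t, Cmod w < r -> cdiff (fun v => K0 v t) w (K1 w t).
  move=> w t Hw; have Hn := Hne w t Hw; rewrite /K0 /K1.
  have H1 := cdiff_minus _ _ _ _ _ (cdiff_const (z t) w) (cdiff_id w).
  have H2 := cdiff_scal _ _ _ (cdiff_inv _ _ _ H1 Hn) (f (z t) * z t)%C.
  apply: cdiff_eq; first by apply: cdiff_ext H2 => v; rewrite /Cdiv; ring.
  by field.
have D2 : forall w t, Cmod w < r -> cdiff (fun v => K1 v t) w (K2 w t).
  move=> w t Hw; have Hn := Hne w t Hw; rewrite /K1 /K2.
  have H1 := cdiff_minus _ _ _ _ _ (cdiff_const (z t) w) (cdiff_id w).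
  have H2 := cdiff_mult _ _ _ _ _ H1 H1.
  have H3 := cdiff_scal _ _ _ (cdiff_inv _ _ _ H2 (Cmult_neq_0 _ _ Hn Hn)) (f (z t) * z t)%C.
  apply: cdiff_eq; first by apply: cdiff_ext H3 => v; rewrite /Cdiv; ring.
  by field.
have Cz : forall (w : C) (t : R), ccont_CR (fun p => z (snd p)) (w, t).
  move=> w t; apply: (continuous_comp (V := R_UniformSpace) snd z); first exact: continuous_snd.
  exact: circle_point_continuous.
have Cf : forall (w : C) (t : R), ccont_CR (fun p => f (z (snd p))) (w, t).
  move=> w t; apply: (continuous_comp (V := R_UniformSpace) snd (fun t => f (z t))).
    exact: continuous_snd.
  exact: Hfz.
have Cm : forall (w : C) (t : R), ccont_CR (fun p => z (snd p) - fst p)%C (w, t).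
  by move=> w t; apply: continuous_Cminus; [exact: Cz | exact: continuous_fst].
have C1 : forall w t, Cmod w < r -> ccont_CR (fun p => K1 (fst p) (snd p)) (w, t).
  move=> w t Hw; have Hn := Hne w t Hw; apply: continuous_Cmult; first exact: Cf.
  apply: continuous_Cdiv; [exact: Cmult_neq_0 | exact: Cz |].
  by apply: continuous_Cmult; exact: Cm.
have C2 : forall w t, Cmod w < r -> ccont_CR (fun p => K2 (fst p) (snd p)) (w, t).
  move=> w t Hw; have Hn := Hne w t Hw; apply: continuous_Cmult; first exact: Cf.
  apply: continuous_Cdiv.
  - by apply: Cmult_neq_0 => //; exact: Cmult_neq_0.
  - by apply: continuous_Cmult; [exact: continuous_const | exact: Cz].
  - by apply: continuous_Cmult; [apply: continuous_Cmult|]; exact: Cm.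
have Hp := two_PI_pos.
have I0 : forall w, Cmod w < r -> ex_CInt (K0 w) 0 (2 * PI).
  move=> w Hw; apply: ex_CInt_continuous; first lra.
  move=> t _; apply: (continuous_slice K0); have Hn := Hne w t Hw.
  apply: continuous_Cmult; first exact: Cf.
  by apply: continuous_Cdiv; [exact: Hn | exact: Cz | exact: Cm].
have I1 : forall w, Cmod w < r -> ex_CInt (K1 w) 0 (2 * PI).
  move=> w Hw; apply: ex_CInt_continuous; first lra.
  by move=> t _; apply: (continuous_slice K1); exact: C1.
have near : forall w v, Cmod (v - w) < r - Cmod w -> Cmod v < r.
  by move=> w v H; have := Cmod_triangle_minus v w (RtoC 0); rewrite !Cminus_0_r; lra.
have E1 : forall w, Cmod w < r ->
    cdiff (fun v => CInt (K0 v) 0 (2 * PI)) w (CInt (K1 w) 0 (2 * PI)).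
  move=> w Hw; apply: (cdiff_CInt_param K0 K1 0 (2 * PI) w (r - Cmod w)); try lra.
  - by move=> v t /near Hv _; exact: D1.
  - by move=> v t /near Hv _; exact: C1.
  - by move=> v /near Hv; exact: I0.
have E2 : forall w, Cmod w < r ->
    cdiff (fun v => CInt (K1 v) 0 (2 * PI)) w (CInt (K2 w) 0 (2 * PI)).
  move=> w Hw; apply: (cdiff_CInt_param K1 K2 0 (2 * PI) w (r - Cmod w)); try lra.
  - by move=> v t /near Hv _; exact: D2.
  - by move=> v t /near Hv _; exact: C2.
  - by move=> v /near Hv; exact: I1.
have H2pi : RtoC (2 * PI) <> RtoC 0 by move/RtoC_inj; lra.
have Hloc : forall w, Cmod w < r -> locally (T := C_UniformSpace) w (fun v => Cmod v < r).
  move=> w Hw; apply/locally_Cmod; exists (r - Cmod w); split; first lra.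
  by move=> v /near.
have Ef : forall w, Cmod w < r -> C_derive f w = (/ RtoC (2 * PI) * CInt (K1 w) 0 (2 * PI))%C.
  move=> w Hw; apply: cdiff_C_derive.
  apply: (cdiff_ext_loc (fun v => / RtoC (2 * PI) * CInt (K0 v) 0 (2 * PI))%C).
    apply: locally_imp (Hloc w Hw) => v Hv.
    have := cauchy_formula f R0 r v Hf Hv ltac:(lra).
    by rewrite /circle_int -/z -/(K0 v) => ->; field.
  exact: cdiff_scal (E1 w Hw) _.
eexists; apply/cdiff_is_derive.
apply: (cdiff_ext_loc (fun v => / RtoC (2 * PI) * CInt (K1 v) 0 (2 * PI))%C).
  apply: locally_imp (Hloc w0 _) => [v Hv | ]; last lra.
  by rewrite Ef.
by apply: cdiff_scal; apply: E2; lra.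
Qed.

Lemma cdiff_shift (f : C -> C) (c z l : C) :
  cdiff f (c + z)%C l <-> cdiff (fun y => f (c + y)%C) z l.
Proof.
split => H.
  have H1 : cdiff (fun y => c + y)%C z (RtoC 1).
    by move: (cdiff_affine c (RtoC 1) z); apply: cdiff_ext => y; ring.
  by apply: cdiff_eq (cdiff_comp _ f _ _ _ H1 H) _; ring.
have H1 : cdiff (fun y => - c + y)%C (c + z)%C (RtoC 1).
  by move: (cdiff_affine (- c)%C (RtoC 1) (c + z)%C); apply: cdiff_ext => y; ring.
have E : (- c + (c + z) = z)%C by ring.
rewrite -E in H.
move: (cdiff_comp _ _ _ _ _ H1 H) => /cdiff_eq H2.
have {}H2 : cdiff (fun y => f (c + (- c + y))%C) (c + z)%C l by apply: H2; ring.
by move: H2; apply: cdiff_ext => y; congr f; ring.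
Qed.

Theorem holomorphic_derive (c : C) (r : R) (f : C -> C) :
  holomorphic_on (disc c r) f -> holomorphic_on (disc c r) (C_derive f).
Proof.
move=> Hf.
have E : forall z, (c + (z - c) = z)%C by move=> z; ring.
have H1 : holomorphic_on (disc (RtoC 0) r) (fun y => f (c + y)%C).
  move=> z Hz; have Hcz : disc c r (c + z)%C.
    by move: Hz; rewrite /disc; have -> : (c + z - c = z - 0)%C by ring.
  exists (C_derive f (c + z)%C); apply/cdiff_is_derive; apply/cdiff_shift.
  exact: holomorphic_cdiff Hf Hcz.
have H2 := cauchy_derivative_disc _ _ H1.
move=> z Hz.
have Hz' : disc (RtoC 0) r (z - c)%C.
  by move: Hz; rewrite /disc; have -> : (z - c - 0 = z - c)%C by ring.
have H3 := holomorphic_cdiff _ _ _ H2 Hz'.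
eexists; apply/cdiff_is_derive; rewrite -{1}(E z); apply/cdiff_shift.
apply: (cdiff_ext_loc _ _ _ _ _ H3).
apply: locally_imp (disc_locally _ _ _ Hz') => y Hy.
apply: cdiff_C_derive; apply/cdiff_shift.
apply: (holomorphic_cdiff (disc c r)) => //.
by move: Hy; rewrite /disc; have -> : (c + y - c = y - 0)%C by ring.
Qed.

(** * Maximum principle and Schwarz's lemma *)

(** Compactness of the enclosing square. Points outside the disc receive a radius whose ball misses
    it, and the factor 2 turns bounds on two coordinates into a bound on [Cmod]. *)
Lemma closed_disc_bounded (c : C) (r : R) (g : C -> R) :
  (forall z, Cmod (z - c) <= r -> exists d M, 0 < d /\
     forall y, Cmod (y - c) <= r -> Cmod (y - z) < d -> g y <= M) ->
  exists M, forall z, Cmod (z - c) <= r -> g z <= M.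
Proof.
move=> H.
have H1 : forall t : R * (R * unit), exists p : posreal * R, forall y, Cmod (y - c) <= r ->
    Cmod (y - (fst t, fst (snd t))) < 2 * fst p -> g y <= snd p.
  move=> t; set z : C := (fst t, fst (snd t)).
  case: (Rle_dec (Cmod (z - c)) r) => Hz.
    have [d [M [Hd HM]]] := H z Hz; have Hd2 : 0 < d / 2 by lra.
    exists (mkposreal _ Hd2, M) => y Hy /= Hyz; apply: HM => //; lra.
  have Hd : 0 < (Cmod (z - c) - r) / 2 by lra.
  exists (mkposreal _ Hd, 0) => y Hy /= Hyz.
  have := Cmod_triangle_minus z y c; rewrite (Cmod_minus_sym z y); lra.
pose p t := proj1_sig (constructive_indefinite_description _ (H1 t)).
have Hp : forall t y, Cmod (y - c) <= r ->
    Cmod (y - (fst t, fst (snd t))) < 2 * fst (p t) -> g y <= snd (p t).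
  by move=> t; rewrite /p; case: (constructive_indefinite_description _ _).
have Hl := Compactness.compactness_list 2
  (Re c - r, (Im c - r, tt)) (Re c + r, (Im c + r, tt)) (fun t => fst (p t)).
apply: NNPP => Hn; apply: Hl => -[l Hl]; apply: Hn.
have Hmax : forall l : list (R * (R * unit)), exists M, forall t, List.In t l -> snd (p t) <= M.
  elim=> [|t l' [M IH]]; first by exists 0.
  exists (Rmax M (snd (p t))) => s [<- | Hs]; first exact: Rmax_r.
  by apply: Rle_trans (IH s Hs) (Rmax_l _ _).
have [M HM] := Hmax l; exists M => z Hz.
have Hre := Rle_trans _ _ _ (re_le_Cmod (z - c)) Hz.
have Him := Rle_trans _ _ _ (im_le_Cmod (z - c)) Hz.
have Ere : Re (z - c) = Re z - Re c by [].
have Eim : Im (z - c) = Im z - Im c by [].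
rewrite Ere in Hre; rewrite Eim in Him.
have [|[t1 [t2 []]] [Hin [_ [Hc1 [Hc2 _]]]]] := Hl (Re z, (Im z, tt)).
  have := Rabs_le_between (Re z - Re c) r; have := Rabs_le_between (Im z - Im c) r.
  by move=> [/(_ Him) ? _] [/(_ Hre) ? _]; split; [lra | split; [lra | ]].
apply: Rle_trans (HM _ Hin); apply: Hp => //=.
have E : (z - (t1, t2) = RtoC (Re z - t1) + Ci * RtoC (Im z - t2))%C.
  by apply: C_ext => /=; rewrite /Re /Im; ring.
rewrite E; apply: Rle_lt_trans (Cmod_triangle _ _) _.
rewrite Cmod_mult Cmod_Ci !Cmod_R Rmult_1_l; lra.
Qed.

(** If the supremum [M] were not attained, [/ (M - g z)] would be locally bounded, hence bounded by
    some [B], and [M - / B] would be a smaller upper bound. *)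
Lemma closed_disc_max (c : C) (r : R) (g : C -> R) :
  0 <= r -> (forall z, Cmod (z - c) <= r -> continuous (T := C_UniformSpace) g z) ->
  exists z1, Cmod (z1 - c) <= r /\ forall z, Cmod (z - c) <= r -> g z <= g z1.
Proof.
move=> Hr Hg.
have Hcont : forall z, Cmod (z - c) <= r -> forall e, 0 < e -> exists d, 0 < d /\
    forall y, Cmod (y - z) < d -> Rabs (g y - g z) < e.
  move=> z Hz e He.
  have [d [Hd H]] := proj1 (locally_Cmod _ _)
    (proj1 (continuous_ball_iff _ _) (Hg z Hz) (mkposreal e He)).
  by exists d.
have [M0 HM0] : exists M, forall z, Cmod (z - c) <= r -> g z <= M.
  apply: closed_disc_bounded => z Hz; have [d [Hd H]] := Hcont z Hz 1 Rlt_0_1.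
  exists d, (g z + 1); split => // y _ /H Hy.
  by have := Rle_abs (g y - g z); lra.
have Hc : Cmod (c - c) <= r.
  by rewrite Cminus_diag Cmod_0.
have [M [HM1 HM2]] : {M | is_lub (fun y => exists z, Cmod (z - c) <= r /\ y = g z) M}.
  apply: completeness; last by exists (g c), c.
  by exists M0 => _ [z [Hz ->]]; exact: HM0.
apply: NNPP => Hn.
have Hlt : forall z, Cmod (z - c) <= r -> g z < M.
  move=> z Hz; case: (HM1 (g z)) => [|//|E]; first by exists z.
  exfalso; apply: Hn; exists z; split => // y Hy; rewrite E.
  by apply: HM1; exists y.
have [B HB] : exists B, forall z, Cmod (z - c) <= r -> / (M - g z) <= B.
  apply: closed_disc_bounded => z Hz; have Hz1 := Hlt z Hz.
  have [d [Hd H]] := Hcont z Hz ((M - g z) / 2) ltac:(lra).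
  exists d, (/ ((M - g z) / 2)); split => // y Hy /H Hyz.
  apply: Rinv_le_contravar; first lra.
  by have := Rle_abs (g y - g z); lra.
have HBpos : 0 < B.
  apply: Rlt_le_trans (HB c Hc); apply: Rinv_0_lt_compat; have := Hlt c Hc; lra.
have : M <= M - / B.
  apply: HM2 => _ [z [Hz ->]].
  have H1 := Hlt z Hz; have H2 := HB z Hz.
  have H3 : / B <= M - g z.
    rewrite -(Rinv_inv (M - g z)); apply: Rinv_le_contravar => //.
    by apply: Rinv_0_lt_compat; lra.
  lra.
have := Rinv_0_lt_compat _ HBpos; lra.
Qed.

(* A maximum of [Re f + eps |z - c|^2] cannot be interior: its mean over a
   small circle exceeds the central value. *)
Lemma Re_max_principle (f : C -> C) (c : C) (R0 r M : R) :
  holomorphic_on (disc c R0) f -> 0 < r < R0 ->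
  (forall z, Cmod (z - c) = r -> Re (f z) <= M) ->
  forall z, Cmod (z - c) <= r -> Re (f z) <= M.
Proof.
move=> Hf Hr HM z Hz; apply: le_epsilon => e0 He0.
have Hr2 : 0 < r ^ 2 by apply: pow_lt; lra.
pose e := e0 / r ^ 2; have He : 0 < e by apply: Rdiv_lt_0_compat.
have Hcy : forall y, continuous (T := C_UniformSpace) (fun y : C => Cmod (y - c)) y.
  move=> y; apply: continuous_Cmod; apply: continuous_Cminus; last exact: continuous_const.
  exact: continuous_id.
have Hg : forall y, Cmod (y - c) <= r ->
    continuous (T := C_UniformSpace) (fun z => Re (f z) + e * Cmod (z - c) ^ 2) y.
  move=> y Hy.
  apply: (continuous_plus (V := R_NormedModule) (U := C_UniformSpace)
    (fun z => Re (f z)) (fun z => e * Cmod (z - c) ^ 2)).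
    by apply: continuous_Re; apply: holomorphic_continuous Hf _; rewrite /disc; lra.
  apply: (continuous_mult (K := R_AbsRing) (U := C_UniformSpace)
    (fun _ => e) (fun z : C => Cmod (z - c) * (Cmod (z - c) * 1))).
    exact: continuous_const.
  apply: (continuous_mult (K := R_AbsRing) (U := C_UniformSpace)
    (fun z : C => Cmod (z - c)) (fun z : C => Cmod (z - c) * 1)); first exact: Hcy.
  apply: (continuous_mult (K := R_AbsRing) (U := C_UniformSpace)
    (fun z : C => Cmod (z - c)) (fun z : C => 1)); first exact: Hcy.
  exact: continuous_const.
have [z1 [Hz1 Hmax]] := closed_disc_max c r (fun z => Re (f z) + e * Cmod (z - c) ^ 2)
  ltac:(lra) Hg.
have Hsq : forall u : C, 0 <= Cmod u ^ 2 by move=> u; apply: pow2_ge_0.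
have He0' : e * r ^ 2 = e0 by rewrite /e; field; lra.
case: Hz1 => [Hz1 | Hz1]; last first.
  have := Hmax z Hz; have := HM z1 Hz1; have := Hsq (z - c)%C; rewrite Hz1 He0'; nra.
exfalso.
pose a := (z1 - c)%C; pose rho := (r - Cmod a) / 2.
have Hrho : 0 < rho by rewrite /rho /a; lra.
(* The linear term reproduces the cross term of [|y - c|^2 = |a|^2 + rho^2 + 2 Re (Cconj a * (y -
   z1))] and vanishes at [z1]. Maximality at [z1] thus gives [Re F <= Re (f z1) - e * rho^2] on the
   circle, against the mean value of [F]. *)
pose F y := (f y + RtoC (2 * e) * Cconj a * (y - z1))%C.
have HF : holomorphic_on (disc z1 (2 * rho)) F.
  apply: (holomorphic_intro _ _ (fun y => C_derive f y + RtoC (2 * e) * Cconj a * (1 - 0))%C).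
  move=> y Hy; apply: cdiff_plus.
    apply: (holomorphic_cdiff _ _ _ Hf); rewrite /disc.
    have := Cmod_triangle_minus y z1 c; rewrite /disc /rho /a in Hy; lra.
  apply: cdiff_scal; exact: cdiff_minus (cdiff_id _) (cdiff_const _ _).
have Hmv := mean_value F z1 (2 * rho) rho HF ltac:(lra).
have Hp := two_PI_pos.
have HexF : ex_CInt (fun t => F (circle_point z1 rho t)) 0 (2 * PI).
  apply: (ex_circle_int F z1 rho); first lra.
  by move=> y Hy; apply: (holomorphic_continuous _ _ _ HF); rewrite /disc; lra.
have HI := Re_CInt _ _ _ HexF.
rewrite -/(circle_int F z1 rho) Hmv re_scal_l in HI.
have EF : F z1 = f z1 by rewrite /F; ring.
rewrite EF in HI.
have Hle : 2 * PI * Re (f z1) <= (2 * PI - 0) * (Re (f z1) - e * rho ^ 2).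
  rewrite -(is_RInt_unique _ _ _ _ HI).
  have -> : (2 * PI - 0) * (Re (f z1) - e * rho ^ 2) =
    RInt (fun _ => Re (f z1) - e * rho ^ 2) 0 (2 * PI) by rewrite RInt_const.
  apply: RInt_le; first lra.
  - by eexists; exact: HI.
  - exact: ex_RInt_const.
  move=> t _; set y := circle_point z1 rho t.
  have Hy : Cmod (y - z1) = rho by apply: Cmod_circle_point; lra.
  have Hyc : Cmod (y - c) <= r.
    have := Cmod_triangle_minus y z1 c; rewrite Hy /rho /a; lra.
  have E : Cmod (y - c) ^ 2 = Cmod a ^ 2 + rho ^ 2 + 2 * Re (Cconj a * (y - z1))%C.
    rewrite -Hy !Cmod2_alt /a.
    have -> : Re (y - c) = Re (z1 - c) + Re (y - z1) by rewrite /=; ring.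
    have -> : Im (y - c) = Im (z1 - c) + Im (y - z1) by rewrite /=; ring.
    rewrite re_mult re_conj im_conj; ring.
  have EF2 : Re (F y) = Re (f y) + 2 * e * Re (Cconj a * (y - z1))%C.
    have -> : F y = (f y + RtoC (2 * e) * (Cconj a * (y - z1)))%C by rewrite /F; ring.
    by rewrite re_plus re_scal_l.
  have := Hmax y Hyc; rewrite E EF2 /a; lra.
have : 0 < e * rho ^ 2 by apply: Rmult_lt_0_compat => //; apply: pow_lt.
nra.
Qed.

Lemma Re_max_principle_center (f : C -> C) (R0 r M : R) :
  holomorphic_on (disc (RtoC 0) R0) f -> 0 < r < R0 ->
  (forall z, Cmod z = r -> Re (f z) <= M) ->
  forall z, Cmod z <= r -> Re (f z) <= M.
Proof.
move=> Hf Hr HM z Hz; apply: (Re_max_principle f (RtoC 0) R0 r) => //.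
  by move=> y; rewrite Cminus_0_r; exact: HM.
by rewrite Cminus_0_r.
Qed.

(** A unimodular factor [u] turns [f z] into its modulus, and the principle for real parts applies
    to [u * f]. *)
Lemma max_modulus (f : C -> C) (c : C) (R0 r M : R) :
  holomorphic_on (disc c R0) f -> 0 < r < R0 ->
  (forall z, Cmod (z - c) = r -> Cmod (f z) <= M) ->
  forall z, Cmod (z - c) <= r -> Cmod (f z) <= M.
Proof.
move=> Hf Hr HM z Hz.
case: (Req_dec (Cmod (f z)) 0) => [-> | H0].
  have H1 : Cmod (c + RtoC r - c) = r.
    have -> : (c + RtoC r - c = RtoC r)%C by ring.
    by rewrite Cmod_RtoC_nonneg; lra.
  by apply: Rle_trans (Cmod_ge_0 _) (HM _ H1).
have Hp : 0 < Cmod (f z) by have := Cmod_ge_0 (f z); lra.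
pose u := (Cconj (f z) / RtoC (Cmod (f z)))%C.
have Hu : Cmod u = 1.
  rewrite /u Cmod_div; last by move/RtoC_inj.
  by rewrite Cmod_conj Cmod_RtoC_nonneg; [field | lra].
have -> : Cmod (f z) = Re (u * f z)%C.
  have -> : (u * f z = RtoC (Cmod (f z)))%C.
    have := Cmod2_conj (f z); rewrite /u => E.
    have E2 : (Cconj (f z) * f z = RtoC (Cmod (f z)) * RtoC (Cmod (f z)))%C.
      by rewrite Cmult_comm -E -RtoC_mult; congr RtoC; ring.
    have -> : (Cconj (f z) / RtoC (Cmod (f z)) * f z
      = (Cconj (f z) * f z) / RtoC (Cmod (f z)))%C by field; move/RtoC_inj.
    by rewrite E2; field; move/RtoC_inj.
  by [].
apply: (Re_max_principle (fun y => u * f y)%C c R0 r) => //.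
- apply: (holomorphic_intro _ _ (fun y => u * C_derive f y)%C) => y Hy.
  by apply: cdiff_scal; exact: holomorphic_cdiff Hf Hy.
- move=> y Hy; apply: Rle_trans (Rle_abs _) _; apply: Rle_trans (re_le_Cmod _) _.
  by rewrite Cmod_mult Hu Rmult_1_l; exact: HM.
Qed.

(** * Weighted radial means *)

(** On power series this divides the coefficient of [z^n] by [n + k + 1]; thus [z^(k+1)] times it is
    the primitive of [z^k F] that vanishes at 0. *)
Definition radial_mean (k : nat) (F : C -> C) (z : C) : C :=
  CInt (fun t => RtoC (t ^ k) * F (RtoC t * z))%C 0 1.

Lemma disc0_scale (R0 t : R) (z : C) :
  disc (RtoC 0) R0 z -> 0 <= t <= 1 -> disc (RtoC 0) R0 (RtoC t * z)%C.
Proof.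
rewrite /disc !Cminus_0_r => Hz Ht; rewrite Cmod_mult Cmod_RtoC_nonneg; last lra.
have := Cmod_ge_0 z; nra.
Qed.

Section RadialMean.

Variables (R0 : R) (F : C -> C).
Hypothesis HF : holomorphic_on (disc (RtoC 0) R0) F.

Let HF' : holomorphic_on (disc (RtoC 0) R0) (C_derive F) := holomorphic_derive _ _ _ HF.

Lemma continuous_pow_RtoC {T : UniformSpace} (k : nat) (u : T -> R) (x : T) :
  continuous u x -> ccont (fun y => RtoC (u y ^ k)) x.
Proof.
move=> Hu; elim: k => [|k IH] /=; first exact: continuous_const.
apply: (continuous_ext (fun y => RtoC (u y) * RtoC (u y ^ k))%C).
  by move=> y; rewrite RtoC_mult.
by apply: continuous_Cmult => //; exact: continuous_RtoC.
Qed.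

Lemma radial_integrand_continuous (k : nat) (G : C -> C) (z : C) (t : R) :
  holomorphic_on (disc (RtoC 0) R0) G -> disc (RtoC 0) R0 z -> 0 <= t <= 1 ->
  ccont_CR
    (fun p => RtoC (snd p ^ k) * G (RtoC (snd p) * fst p))%C (z, t).
Proof.
move=> HG Hz Ht; apply: continuous_Cmult.
  by apply: continuous_pow_RtoC; exact: continuous_snd.
apply: (continuous_comp (V := C_UniformSpace) (fun p => RtoC (snd p) * fst p)%C G).
  apply: continuous_Cmult; last exact: continuous_fst.
  by apply: continuous_RtoC; exact: continuous_snd.
by apply: holomorphic_continuous HG _; exact: disc0_scale.
Qed.

Lemma ex_radial_mean (k : nat) (G : C -> C) (z : C) :
  holomorphic_on (disc (RtoC 0) R0) G -> disc (RtoC 0) R0 z ->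
  ex_CInt (fun t => RtoC (t ^ k) * G (RtoC t * z))%C 0 1.
Proof.
move=> HG Hz; apply: ex_CInt_continuous; first lra.
move=> t Ht.
by apply: (continuous_slice (fun z t => RtoC (t ^ k) * G (RtoC t * z))%C); exact: radial_integrand_continuous.
Qed.

Lemma cdiff_scale (z c l : C) (G : C -> C) :
  cdiff G (c * z)%C l -> cdiff (fun y => G (c * y)%C) z (c * l)%C.
Proof.
move=> H; have H1 := cdiff_scal _ _ _ (cdiff_id z) c.
by apply: cdiff_eq (cdiff_comp _ G _ _ _ H1 H) _; ring.
Qed.

Lemma cdiff_radial_mean (k : nat) (z : C) :
  disc (RtoC 0) R0 z ->
  cdiff (radial_mean k F) z (radial_mean (S k) (C_derive F) z).
Proof.
move=> Hz;
have Hin : forall w, Cmod (w - z) < R0 - Cmod z -> disc (RtoC 0) R0 w.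
  move=> w Hw; rewrite /disc.
  by have := Cmod_triangle_minus w z (RtoC 0); rewrite !Cminus_0_r; lra.
apply: (cdiff_CInt_param (fun w t => RtoC (t ^ k) * F (RtoC t * w))%C
  (fun w t => RtoC (t ^ S k) * C_derive F (RtoC t * w))%C 0 1 z (R0 - Cmod z)).
- lra.
- by move: Hz; rewrite /disc Cminus_0_r; lra.
- move=> w t /Hin Hw Ht.
  have H := cdiff_scal _ _ _ (cdiff_scale w (RtoC t) _ F
     (holomorphic_cdiff _ _ _ HF (disc0_scale _ _ _ Hw Ht))) (RtoC (t ^ k)).
  by apply: cdiff_eq H _; rewrite /= RtoC_mult; ring.
- by move=> w t /Hin Hw Ht; exact: radial_integrand_continuous.
- by move=> w /Hin Hw; exact: ex_radial_mean.
Qed.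

Lemma radial_mean_holomorphic (k : nat) : holomorphic_on (disc (RtoC 0) R0) (radial_mean k F).
Proof. by apply: holomorphic_intro => z Hz; exact: cdiff_radial_mean. Qed.

(* Integration of [d/dt (t^(k+1) F (t z))] over [0, 1]. *)
Lemma radial_mean_ode (k : nat) (z : C) :
  disc (RtoC 0) R0 z ->
  (RtoC (INR (S k)) * radial_mean k F z + z * radial_mean (S k) (C_derive F) z = F z)%C.
Proof.
move=> Hz.
have HI1 := ex_radial_mean k F z HF Hz.
have HI2 := ex_radial_mean (S k) (C_derive F) z HF' Hz.
rewrite /radial_mean -!CInt_scal //.
have Hsc : forall (g : R -> C) c, ex_CInt g 0 1 -> ex_CInt (fun t => c * g t)%C 0 1.
  by move=> g c [l Hl]; exists (c * l)%C; exact: is_CInt_scal.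
rewrite -CInt_plus; [|exact: Hsc|exact: Hsc].
have Dpow : forall n u, cdiff (fun v => v ^ S n)%C u (RtoC (INR (S n)) * u ^ n)%C.
  elim=> [|n IH] u.
    apply: (cdiff_ext (fun v => v)) => [v|]; first by rewrite Cpow_1_r.
    by apply: cdiff_eq (cdiff_id u) _; rewrite /= Cmult_1_l.
  apply: (cdiff_ext (fun v => v * v ^ S n)%C) => [v|]; first by rewrite /=.
  apply: cdiff_eq (cdiff_mult _ _ _ _ _ (cdiff_id u) (IH u)) _.
  by rewrite [INR (S (S n))]S_INR RtoC_plus Cpow_S; ring.
have := CInt_FTC (fun u => u ^ S k * F (u * z))%C
  (fun u => RtoC (INR (S k)) * (u ^ k * F (u * z)) + z * (u ^ S k * C_derive F (u * z)))%C 0 1.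
have Epow : forall (t : R) n, (RtoC t ^ n)%C = RtoC (t ^ n) by move=> t n; rewrite RtoC_pow.
move=> HFTC; transitivity (RtoC 1 ^ S k * F (RtoC 1 * z) - RtoC 0 ^ S k * F (RtoC 0 * z))%C; last first.
  by rewrite Cpow_1_l !Cmult_1_l Cpow_S !Cmult_0_l; ring.
rewrite -HFTC; last first.
- move=> t Ht; apply: continuous_Cplus; (apply: continuous_Cmult; first exact: continuous_const).
  + apply: (continuous_ext (fun s => RtoC (s ^ k) * F (RtoC s * z))%C).
      by move=> s; rewrite Epow.
    by apply: (continuous_slice (fun z t => RtoC (t ^ k) * F (RtoC t * z))%C); exact: radial_integrand_continuous.
  + apply: (continuous_ext (fun s => RtoC (s ^ S k) * C_derive F (RtoC s * z))%C).
      by move=> s; rewrite Epow.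
    by apply: (continuous_slice (fun z t => RtoC (t ^ S k) * C_derive F (RtoC t * z))%C); exact: radial_integrand_continuous.
- move=> t Ht.
  have H0 := holomorphic_cdiff _ _ _ HF (disc0_scale _ _ _ Hz Ht).
  rewrite Cmult_comm in H0.
  have H1 := cdiff_scale (RtoC t) z _ F H0.
  have H2 : cdiff (fun u => F (u * z)%C) (RtoC t) (z * C_derive F (z * RtoC t)%C)%C.
    by move: H1; apply: cdiff_ext => v; congr F; ring.
  apply: cdiff_eq (cdiff_mult _ _ _ _ _ (Dpow k (RtoC t)) H2) _.
  by rewrite (Cmult_comm z (RtoC t)); ring.
- lra.
apply: CInt_ext; first lra.
by move=> t _; rewrite !Epow.
Qed.

Lemma cdiff_primitive (z : C) :
  disc (RtoC 0) R0 z -> cdiff (fun y => y * radial_mean 0 F y)%C z (F z).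
Proof.
move=> Hz.
apply: cdiff_eq (cdiff_mult _ _ _ _ _ (cdiff_id z) (cdiff_radial_mean 0 z Hz)) _.
by rewrite -[RHS](radial_mean_ode 0 z Hz) /=; ring.
Qed.

Lemma radial_mean_0 (k : nat) : 0 < R0 -> (RtoC (INR (S k)) * radial_mean k F (RtoC 0) = F (RtoC 0))%C.
Proof.
move=> HR; have := radial_mean_ode k (RtoC 0) (disc_center _ _ HR).
by rewrite Cmult_0_l Cplus_0_r.
Qed.

End RadialMean.

Lemma constant_of_zero_derivative (f : C -> C) (R0 : R) (z : C) :
  holomorphic_on (disc (RtoC 0) R0) f ->
  (forall y, disc (RtoC 0) R0 y -> cdiff f y (RtoC 0)) ->
  disc (RtoC 0) R0 z -> f z = f (RtoC 0).
Proof.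
move=> Hf Hd Hz.
have := CInt_FTC (fun u => f (u * z)%C) (fun u => RtoC 0) 0 1.
rewrite CInt_const Cmult_0_r Cmult_1_l Cmult_0_l.
move=> H; have {}H : (RtoC 0 = f z - f (RtoC 0))%C.
  apply: H; first lra.
    move=> t Ht; have H0 := Hd _ (disc0_scale _ _ _ Hz Ht); rewrite Cmult_comm in H0.
    apply: (cdiff_ext (fun u => f (z * u)%C)) => [v|]; first by congr f; ring.
    by apply: cdiff_eq (cdiff_scale _ _ _ _ H0) _; ring.
  by move=> t _; exact: continuous_const.
by apply/Ceq_minus; rewrite -H.
Qed.

(** Exhibits [(f z - f 0) / z] as a function that is holomorphic at 0 as well. *)
Lemma holomorphic_quotient (f : C -> C) (R0 : R) (z : C) :
  holomorphic_on (disc (RtoC 0) R0) f -> disc (RtoC 0) R0 z ->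
  f z = (f (RtoC 0) + z * radial_mean 0 (C_derive f) z)%C.
Proof.
move=> Hf Hz.
have Hf' := holomorphic_derive _ _ _ Hf.
have HR : 0 < R0 by apply: Rle_lt_trans (Cmod_ge_0 _) Hz.
have Hd : forall y, disc (RtoC 0) R0 y ->
    cdiff (fun y => f y - y * radial_mean 0 (C_derive f) y)%C y (RtoC 0).
  move=> y Hy; apply: cdiff_eq (cdiff_minus _ _ _ _ _ (holomorphic_cdiff _ _ _ Hf Hy)
    (cdiff_primitive _ _ Hf' y Hy)) _; ring.
have := constant_of_zero_derivative _ R0 z (holomorphic_intro _ _ _ Hd) Hd Hz.
rewrite Cmult_0_l => E.
have -> : (f z = (f z - z * radial_mean 0 (C_derive f) z) + z * radial_mean 0 (C_derive f) z)%C by ring.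
by rewrite E; ring.
Qed.

(** * Schwarz's lemma and the strong maximum principle *)

Lemma unit_disc_disc (z : C) : unit_disc z <-> disc (RtoC 0) 1 z.
Proof. by rewrite /unit_disc /disc Cminus_0_r. Qed.

Lemma holomorphic_unit_disc (f : C -> C) :
  holomorphic_on unit_disc f <-> holomorphic_on (disc (RtoC 0) 1) f.
Proof.
split; apply: holomorphic_subset => z Hz.
  exact: (proj2 (unit_disc_disc z) Hz).
exact: (proj1 (unit_disc_disc z) Hz).
Qed.

Lemma unit_disc_0 : unit_disc (RtoC 0).
Proof. by rewrite /unit_disc Cmod_0; lra. Qed.

(** The passage [r -> 1] in Schwarz's lemma; the radius chosen exceeds [y] and has inverse at most
    [1 + e]. *)
Lemma le_1_of_le_inv (x y : R) : 0 <= y -> (forall r, y < r < 1 -> x <= / r) -> y < 1 -> x <= 1.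
Proof.
move=> Hy H Hy1; apply: le_epsilon => e He.
have H1 := Rmax_l ((1 + y) / 2) (/ (1 + e)); have H2 := Rmax_r ((1 + y) / 2) (/ (1 + e)).
have Hi : / (1 + e) < 1 by rewrite -Rinv_1; apply: Rinv_lt_contravar; lra.
have Hip : 0 < / (1 + e) by apply: Rinv_0_lt_compat; lra.
have H3 : Rmax ((1 + y) / 2) (/ (1 + e)) < 1 by apply: Rmax_lub_lt; lra.
apply: Rle_trans (H _ (conj _ H3)) _; first lra.
by apply: Rle_trans (Rinv_le_contravar _ _ Hip H2) _; rewrite Rinv_inv; lra.
Qed.

(** Schwarz's lemma with the quotient kept as a function: Schur's algorithm continues with [phi],
    whose value at 0 carries the prescribed coefficient. *)
Lemma schwarz_quotient (w : C -> C) :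
  holomorphic_on unit_disc w -> w (RtoC 0) = RtoC 0 ->
  (forall z, unit_disc z -> Cmod (w z) <= 1) ->
  exists phi, holomorphic_on unit_disc phi /\ C_derive w (RtoC 0) = phi (RtoC 0) /\
    (forall z, unit_disc z -> w z = (z * phi z)%C) /\
    (forall z, unit_disc z -> Cmod (phi z) <= 1).
Proof.
move=> /holomorphic_unit_disc Hw Hw0 Hb.
have Hw' := holomorphic_derive _ _ _ Hw.
pose phi := radial_mean 0 (C_derive w).
have Hphi : holomorphic_on (disc (RtoC 0) 1) phi by exact: radial_mean_holomorphic.
have E : forall z, unit_disc z -> w z = (z * phi z)%C.
  by move=> z /unit_disc_disc Hz; rewrite (holomorphic_quotient w 1 z Hw Hz) Hw0 /phi; ring.
exists phi; split; first by apply/holomorphic_unit_disc.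
split; first by rewrite -(radial_mean_0 1 (C_derive w) Hw' 0 Rlt_0_1) /= Cmult_1_l.
split => // z Hz.
apply: (le_1_of_le_inv _ (Cmod z)); [exact: Cmod_ge_0 | | exact: Hz].
move=> r Hr; have Hm := Cmod_ge_0 z.
apply: (max_modulus phi (RtoC 0) 1 r) => //; first lra.
  move=> y; rewrite Cminus_0_r => Hy.
  have Hyd : unit_disc y by rewrite /unit_disc; lra.
  have := Hb y Hyd; rewrite (E y Hyd) Cmod_mult Hy => H.
  apply: (Rmult_le_reg_l r); first lra.
  by rewrite Rinv_r; lra.
by rewrite Cminus_0_r; lra.
Qed.

Lemma schwarz_lemma (w : C -> C) (z : C) :
  holomorphic_on unit_disc w -> w (RtoC 0) = RtoC 0 ->
  (forall z, unit_disc z -> Cmod (w z) <= 1) -> unit_disc z -> Cmod (w z) <= Cmod z.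
Proof.
move=> Hw H0 Hb Hz; have [phi [_ [_ [E Hphi]]]] := schwarz_quotient w Hw H0 Hb.
rewrite E // Cmod_mult; have := Hphi z Hz; have := Cmod_ge_0 z; nra.
Qed.

Lemma Cmod_le_of_sq (u v : C) : Cmod u ^ 2 <= Cmod v ^ 2 -> Cmod u <= Cmod v.
Proof. by move=> H; apply: Rsqr_incr_0_var; [rewrite !Rsqr_pow2 | exact: Cmod_ge_0]. Qed.

(* Schwarz's lemma for the left half plane: [f] is compared with the
   reflection of [f 0] in the imaginary axis. *)
Lemma half_plane_schwarz (f : C -> C) (z : C) :
  holomorphic_on unit_disc f -> (forall y, unit_disc y -> Re (f y) <= 0) ->
  Re (f (RtoC 0)) < 0 -> unit_disc z ->
  Cmod (f z - f (RtoC 0)) <= Cmod z * Cmod (f z + Cconj (f (RtoC 0))).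
Proof.
move=> Hf Hneg H0 Hz.
set u := f (RtoC 0).
have Hne : forall y, unit_disc y -> (f y + Cconj u <> 0)%C.
  move=> y Hy E; have := Hneg y Hy.
  have : Re (f y + Cconj u) = 0 by rewrite E.
  by rewrite re_plus re_conj /u; lra.
pose w y := ((f y - u) / (f y + Cconj u))%C.
have Hw : Cmod (w z) <= Cmod z.
  apply: schwarz_lemma => //.
  - apply: (holomorphic_intro _ _ _).
    move=> y Hy; have H1 := holomorphic_cdiff _ _ _ Hf Hy.
    apply: cdiff_div; [| | exact: Hne].
      exact: cdiff_minus H1 (cdiff_const _ _).
    exact: cdiff_plus H1 (cdiff_const _ _).
  - by rewrite /w -/u Cminus_diag /Cdiv Cmult_0_l.
  - move=> y Hy; have Hn := Hne y Hy; rewrite /w Cmod_div //.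
    have Hp : 0 < Cmod (f y + Cconj u) by apply/Cmod_gt_0.
    apply/Rle_div_l => //; rewrite Rmult_1_l; apply: Cmod_le_of_sq.
    rewrite !Cmod2_alt re_plus im_plus re_conj im_conj.
    have -> : Re (f y - u) = Re (f y) - Re u by [].
    have -> : Im (f y - u) = Im (f y) - Im u by [].
    have := Hneg y Hy; have : Re u < 0 by []; nra.
have Hn := Hne z Hz; have Hp : 0 < Cmod (f z + Cconj u) by apply/Cmod_gt_0.
move: Hw; rewrite /w Cmod_div // => /Rle_div_l; exact.
Qed.

(** If [Re (f 0) < 0], the two moduli in [half_plane_schwarz] coincide at [a], which contradicts
    [|a| < 1]. So [Re (f 0) = 0], and the subtraction of 1 below restores strict negativity; the
    inequality for every [n] bounds [n |g| (1 - |z|)] by 2 and forces [g = 0]. *)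
Theorem strong_max_principle (f : C -> C) (a : C) :
  holomorphic_on unit_disc f -> (forall z, unit_disc z -> Re (f z) <= 0) ->
  unit_disc a -> Re (f a) = 0 -> forall z, unit_disc z -> f z = f (RtoC 0).
Proof.
move=> Hf Hneg Ha Hfa.
have H00 := unit_disc_0.
have H0 : Re (f (RtoC 0)) = 0.
  apply: NNPP => Hn; have Hlt : Re (f (RtoC 0)) < 0 by have := Hneg _ H00; lra.
  have := half_plane_schwarz f a Hf Hneg Hlt Ha.
  set u := f (RtoC 0) in Hlt *.
  have E : Cmod (f a + Cconj u) = Cmod (f a - u).
    apply: Rle_antisym; apply: Cmod_le_of_sq; rewrite !Cmod2_alt;
      rewrite re_plus im_plus re_conj im_conj Hfa;
      (have -> : Re (f a - u) = Re (f a) - Re u by []);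
      (have -> : Im (f a - u) = Im (f a) - Im u by []);
      by rewrite Hfa; apply: Req_le; ring.
  rewrite E => H.
  have Hp : 0 < Cmod (f a - u).
    by apply/Cmod_gt_0; apply: Cminus_neq_0 => E2; rewrite -E2 Hfa in Hlt; lra.
  by rewrite /unit_disc in Ha; nra.
move=> z Hz.
(* Compare [n (f - f 0)] - 1 with its central value -1, for every n. *)
pose g := (f z - f (RtoC 0))%C.
have Hn : forall n : R, 0 < n -> n * (Cmod g * (1 - Cmod z)) <= 2.
  move=> n Hn.
  pose F y := (RtoC n * (f y - f (RtoC 0)) - 1)%C.
  have F0 : F (RtoC 0) = (- (1))%C by rewrite /F; ring.
  have ReF : forall y, Re (F y) = n * Re (f y) - 1.
    move=> y; have -> : Re (F y) = Re (RtoC n * (f y - f (RtoC 0)))%C - 1 by [].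
    rewrite re_scal_l; have -> : Re (f y - f (RtoC 0)) = Re (f y) - Re (f (RtoC 0)) by [].
    by rewrite H0; ring.
  have := half_plane_schwarz F z _ _ _ Hz.
  rewrite F0; have -> : (F z - - (1) = RtoC n * g)%C by rewrite /F /g; ring.
  have -> : Cconj (- (1)) = (- (1))%C by rewrite Copp_conj; congr Copp; apply: C_ext => /=; ring.
  have -> : (F z + - (1) = RtoC n * g - RtoC 2)%C.
    by rewrite /F /g; apply: C_ext => /=; ring.
  move=> H.
  have {}H : Cmod (RtoC n * g)%C <= Cmod z * Cmod (RtoC n * g - RtoC 2)%C.
    apply: H.
    - apply: (holomorphic_intro _ _ (fun y => RtoC n * (C_derive f y - 0) - 0)%C) => y Hy.
      apply: cdiff_minus; last exact: cdiff_const.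
      by apply: cdiff_scal; apply: cdiff_minus; [exact: holomorphic_cdiff Hf Hy | exact: cdiff_const].
    - move=> y Hy; rewrite ReF; have := Hneg y Hy; nra.
    - rewrite /=; lra.
  have H2 : Cmod (RtoC n * g - RtoC 2)%C <= n * Cmod g + 2.
    apply: Rle_trans (Cmod_triangle _ _) _.
    by rewrite Cmod_opp Cmod_mult !Cmod_RtoC_nonneg; lra.
  rewrite Cmod_mult Cmod_RtoC_nonneg in H; last lra.
  have := Cmod_ge_0 z; have := Hz; rewrite /unit_disc => ? ?; nra.
have Hz1 : 0 < 1 - Cmod z by rewrite /unit_disc in Hz; lra.
apply/Ceq_minus; apply: Cmod_eq_0; rewrite -/g.
apply: NNPP => Hg; have Hgp : 0 < Cmod g by have := Cmod_ge_0 g; lra.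
have Hp : 0 < Cmod g * (1 - Cmod z) by apply: Rmult_lt_0_compat.
have := Hn (3 / (Cmod g * (1 - Cmod z))) ltac:(apply: Rdiv_lt_0_compat; lra).
have -> : 3 / (Cmod g * (1 - Cmod z)) * (Cmod g * (1 - Cmod z)) = 3 by field; lra.
lra.
Qed.

(** The function [Cconj (f a) * f - 1] has nonpositive real part and vanishes at [a]. *)
Lemma strong_max_modulus (f : C -> C) (a : C) :
  holomorphic_on unit_disc f -> (forall z, unit_disc z -> Cmod (f z) <= 1) ->
  unit_disc a -> Cmod (f a) = 1 -> forall z, unit_disc z -> f z = f a.
Proof.
move=> Hf Hb Ha Hfa.
pose F y := (Cconj (f a) * f y - 1)%C.
have E : (Cconj (f a) * f a = 1)%C by rewrite Cmult_comm -Cmod2_conj Hfa; congr RtoC; ring.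
have HF : forall z, unit_disc z -> F z = F (RtoC 0).
  apply: (strong_max_principle F a) => //.
  - apply: (holomorphic_intro _ _ (fun y => Cconj (f a) * C_derive f y - 0)%C) => y Hy.
    apply: cdiff_minus; last exact: cdiff_const.
    by apply: cdiff_scal; exact: holomorphic_cdiff Hf Hy.
  - move=> z Hz; have -> : Re (F z) = Re (Cconj (f a) * f z)%C - 1 by [].
    have := Rle_trans _ _ _ (Rle_abs _) (re_le_Cmod (Cconj (f a) * f z)%C).
    rewrite Cmod_mult Cmod_conj Hfa; have := Hb z Hz; lra.
  - by rewrite /F E /=; ring.
move=> z Hz.
have EF : F z = F a by rewrite HF // HF.
have -> : (f z = f a * (F z + 1))%C.
  have -> : (f a * (F z + 1) = Cconj (f a) * f a * f z)%C by rewrite /F; ring.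
  by rewrite E; ring.
by rewrite EF /F E; ring.
Qed.

(** * Injective holomorphic maps *)

Lemma Cmult_eq_0_l (x y : C) : (x * y = 0)%C -> x <> RtoC 0 -> y = RtoC 0.
Proof.
move=> E Hx; have -> : y = (/ x * (x * y))%C by field.
by rewrite E; ring.
Qed.

Lemma Cmod_div_le (x y : C) (M : R) :
  y <> RtoC 0 -> Cmod x <= M * Cmod y -> Cmod (x / y) <= M.
Proof.
move=> Hy H; rewrite Cmod_div //; apply/Rle_div_l => //.
by apply/Cmod_gt_0.
Qed.

Lemma unit_disc_disc_at (a z : C) : disc a (1 - Cmod a) z -> unit_disc z.
Proof.
rewrite /disc /unit_disc => H; have H1 := Cmod_triangle_minus z a (RtoC 0).
by rewrite !Cminus_0_r in H1; lra.
Qed.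

Lemma unit_disc_locally (z : C) : unit_disc z -> locally (T := C_UniformSpace) z unit_disc.
Proof.
move=> Hz; apply/locally_Cmod; exists (1 - Cmod z); split; first by rewrite /unit_disc in Hz; lra.
by move=> y Hy; apply: (unit_disc_disc_at z).
Qed.

Section Injective.

Variable P : C -> C.
Hypothesis HP : holomorphic_on unit_disc P.

(** The Caratheodory slope at [b] serves. Off [b] it is a quotient; near [b] it is the radial mean
    of the derivative of the translate [Pb], hence holomorphic there too. *)
Lemma divided_difference (b : C) :
  unit_disc b ->
  exists psi, holomorphic_on unit_disc psi /\ psi b = C_derive P b /\
    forall z, P z = (P b + (z - b) * psi z)%C.
Proof.
move=> Hb.
have [psi [Cpsi [Epsi Hpsi]]] := holomorphic_cdiff _ _ _ HP Hb.
exists psi; split; last by split.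
have Hquot : forall z, z <> b -> psi z = ((P z - P b) / (z - b))%C.
  by move=> z Hz; rewrite (Hpsi z); field; exact: Cminus_neq_0.
move=> z Hz; case: (classic (z = b)) => [-> | Hzb]; last first.
  eexists; apply/cdiff_is_derive.
  apply: (cdiff_ext_loc (fun z => (P z - P b) / (z - b))%C); last first.
    apply: cdiff_div; [| | exact: Cminus_neq_0].
      exact: cdiff_minus (holomorphic_cdiff _ _ _ HP Hz) (cdiff_const _ _).
    exact: cdiff_minus (cdiff_id _) (cdiff_const _ _).
  apply/locally_Cmod; exists (Cmod (z - b)); split.
    by apply/Cmod_gt_0; exact: Cminus_neq_0.
  move=> y Hy; rewrite Hquot // => E; rewrite E Cmod_minus_sym in Hy; lra.
pose Pb y := P (b + y)%C.
have Hin : forall y, disc (RtoC 0) (1 - Cmod b) y -> unit_disc (b + y)%C.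
  move=> y Hy; apply: (unit_disc_disc_at b); move: Hy; rewrite /disc.
  by have -> : (b + y - b = y - 0)%C by ring.
have HPb : holomorphic_on (disc (RtoC 0) (1 - Cmod b)) Pb.
  apply: (holomorphic_intro _ _ (fun y => C_derive P (b + y)%C)) => y Hy.
  by apply/cdiff_shift; apply: holomorphic_cdiff HP (Hin _ Hy).
have Hpos : 0 < 1 - Cmod b by rewrite /unit_disc in Hb; lra.
have HPb' := holomorphic_derive _ _ _ HPb.
have HS := radial_mean_holomorphic _ _ HPb' 0.
have D0 := disc_center (RtoC 0) _ Hpos.
have Sval : forall y, disc (RtoC 0) (1 - Cmod b) y ->
    radial_mean 0 (C_derive Pb) y = psi (b + y)%C.
  move=> y Hy; case: (classic (y = RtoC 0)) => [-> | Hy0].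
    have := radial_mean_0 _ _ HPb' 0 Hpos; rewrite /= Cmult_1_l Cplus_0_r => ->.
    rewrite Epsi; apply: cdiff_C_derive; apply/cdiff_shift.
    by rewrite Cplus_0_r; exact: holomorphic_cdiff HP Hb.
  have E1 := holomorphic_quotient _ _ _ HPb Hy.
  have E2 := Hpsi (b + y)%C; rewrite -/(Pb y) E1 /Pb Cplus_0_r in E2.
  apply/Ceq_minus; apply: (Cmult_eq_0_l y) => //.
  have -> : (y * (radial_mean 0 (C_derive Pb) y - psi (b + y)) =
    (P b + y * radial_mean 0 (C_derive Pb) y) - (P b + (b + y - b) * psi (b + y)))%C by ring.
  by rewrite /Pb E2; ring.
eexists; apply/cdiff_is_derive.
have Eb : (b = b + 0)%C by ring.
rewrite Eb; apply/cdiff_shift.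
apply: (cdiff_ext_loc (radial_mean 0 (C_derive Pb))).
  by apply: locally_imp (disc_locally _ _ _ D0) => y; exact: Sval.
exact: holomorphic_cdiff HS D0.
Qed.

Hypothesis Hinj : injective_on unit_disc P.

(** Since extrema are available on closed discs, the minimum over the circle is replaced by that of
    [|P z - P a| + (r - |z - a|)] over the disc. The penalty vanishes on the circle and is positive
    inside; on the circle injectivity keeps the first term positive. *)
Lemma injective_circle_gap (a : C) (r : R) :
  unit_disc a -> 0 < r < 1 - Cmod a ->
  exists d, 0 < d /\ forall z, Cmod (z - a) = r -> d <= Cmod (P z - P a).
Proof.
move=> Ha Hr.
have Hcont : forall z, Cmod (z - a) <= r ->
    continuous (T := C_UniformSpace) (fun z => - (Cmod (P z - P a) + (r - Cmod (z - a)))) z.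
  move=> z Hz; apply: (continuous_opp (V := R_NormedModule) (U := C_UniformSpace)).
  apply: (continuous_plus (V := R_NormedModule) (U := C_UniformSpace)
    (fun z => Cmod (P z - P a)) (fun z => r - Cmod (z - a))).
    apply: continuous_Cmod; apply: continuous_Cminus; last exact: continuous_const.
    apply: (holomorphic_continuous _ _ _ HP); apply: (unit_disc_disc_at a); rewrite /disc; lra.
  apply: (continuous_minus (V := R_NormedModule) (U := C_UniformSpace)
    (fun _ => r) (fun z : C => Cmod (z - a))); first exact: continuous_const.
  apply: continuous_Cmod; apply: continuous_Cminus; last exact: continuous_const.
  exact: continuous_id.
have [z1 [Hz1 Hmax]] := closed_disc_max a r _ ltac:(lra) Hcont.
exists (Cmod (P z1 - P a) + (r - Cmod (z1 - a))); split; last first.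
  by move=> z Hz; have := Hmax z (Req_le _ _ Hz); rewrite Hz; lra.
case: Hz1 => Hz1; first by have := Cmod_ge_0 (P z1 - P a); lra.
suff : 0 < Cmod (P z1 - P a) by lra.
apply/Cmod_gt_0; apply: Cminus_neq_0 => E.
have Hz1d : unit_disc z1 by apply: (unit_disc_disc_at a); rewrite /disc; lra.
have E1 := Hinj _ _ Hz1d Ha E; rewrite E1 in Hz1.
by rewrite Cminus_diag Cmod_0 in Hz1; lra.
Qed.

(* If [P' a = 0] and [P' b <> 0], the divided difference at [b] has no zero, so
   its modulus at [a] is bounded below by its modulus on a circle about [a];
   letting [b] tend to [a] contradicts [P' a = 0]. *)
Theorem injective_derive_neq_0 (a : C) : unit_disc a -> C_derive P a <> RtoC 0.
Proof.
move=> Ha Ha0.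
have Hma := Cmod_ge_0 a.
pose r := (1 - Cmod a) / 2.
have Hr : 0 < r < 1 - Cmod a by rewrite /r; rewrite /unit_disc in Ha; lra.
have [d [Hd Hgap]] := injective_circle_gap a r Ha Hr.
have HdP := holomorphic_cdiff _ _ _ HP Ha; rewrite Ha0 in HdP.
(* On the circle [|P z - P b| >= d / 2] and [|z - b| <= 2 * r], so the divided difference is at
   least [d / (4 * r)] in modulus; half of that is contradictory at [a]. *)
have He : 0 < d / (8 * r) by apply: Rdiv_lt_0_compat; lra.
have [d1 [Hd1 Hsmall]] := proj1 (cdiff_eps _ _ _) HdP _ He.
have Cont := proj1 (continuous_C_iff _ _) (cdiff_continuous _ _ _ HdP) (d / 2) ltac:(lra).
have [d2 [Hd2 Hclose]] := proj1 (locally_Cmod _ _) Cont.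
pose dm := Rmin r (Rmin d1 d2).
have Hdm : 0 < dm by apply: Rmin_pos; [lra | apply: Rmin_pos; lra].
have Hdm0 : dm <= r by exact: Rmin_l.
have Hdm1 : dm <= d1 by apply: Rle_trans (Rmin_r _ _) (Rmin_l _ _).
have Hdm2 : dm <= d2 by apply: Rle_trans (Rmin_r _ _) (Rmin_r _ _).
have Hzero : forall b, disc a dm b -> C_derive P b = RtoC 0.
  move=> b Hb; rewrite /disc in Hb.
  case: (classic (b = a)) => [-> // | Hba]; apply: NNPP => Hb0.
  have Hbd : unit_disc b by apply: (unit_disc_disc_at a); rewrite /disc; lra.
  have [psi [Hpsi [Epsi Qpsi]]] := divided_difference b Hbd.
  have Hnz : forall z, unit_disc z -> psi z <> RtoC 0.
    move=> z Hz E; case: (classic (z = b)) => [E1 | Hzb].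
      by apply: Hb0; rewrite -Epsi -E1.
    apply: Hzb; apply: Hinj => //; rewrite (Qpsi z) E; ring.
  have Hinv : holomorphic_on (disc a (1 - Cmod a)) (fun z => / psi z)%C.
    move=> z /unit_disc_disc_at Hz; eexists; apply/cdiff_is_derive.
    by apply: cdiff_inv; [exact: holomorphic_cdiff Hpsi Hz | exact: Hnz].
  have Hcl := Hclose b ltac:(lra).
  have Hbound : forall z, Cmod (z - a) = r -> Cmod (/ psi z) <= 4 * r / d.
    move=> z Hz; have Hzd : unit_disc z by apply: (unit_disc_disc_at a); rewrite /disc; lra.
    have H1 := Hgap z Hz.
    have H2 := Cmod_triangle_minus (P z) (P b) (P a).
    have H3 := Cmod_triangle_minus z a b; rewrite (Cmod_minus_sym a b) in H3.
    have H4 : Cmod (P z - P b) = Cmod (z - b) * Cmod (psi z).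
      by rewrite -Cmod_mult (Qpsi z); congr Cmod; ring.
    have Hpp : 0 < Cmod (psi z) by apply/Cmod_gt_0; exact: Hnz.
    rewrite Cmod_inv; last exact: Hnz.
    have H5 : d / (4 * r) <= Cmod (psi z).
      apply/Rle_div_l; first lra.
      nra.
    have -> : 4 * r / d = / (d / (4 * r)) by field; lra.
    by apply: Rinv_le_contravar => //; apply: Rdiv_lt_0_compat; lra.
  have E0 : Cmod (a - a) <= r.
    by rewrite Cminus_diag Cmod_0; lra.
  have Hca := max_modulus _ a _ r _ Hinv Hr Hbound a E0.
  have Hpa : 0 < Cmod (psi a) by apply/Cmod_gt_0; exact: Hnz.
  rewrite Cmod_inv in Hca; last exact: Hnz.
  have H5 : d / (4 * r) <= Cmod (psi a).
    rewrite -(Rinv_inv (Cmod (psi a))); have -> : d / (4 * r) = / (4 * r / d) by field; lra.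
    by apply: Rinv_le_contravar => //; apply: Rinv_0_lt_compat.
  have H6 := Hsmall b ltac:(lra).
  rewrite Cmult_0_r in H6.
  have H7 : Cmod (P b - P a - 0) = Cmod (b - a) * Cmod (psi a).
    by rewrite (Qpsi a) -Cmod_mult; congr Cmod; ring.
  rewrite H7 in H6.
  have Hp : 0 < Cmod (b - a) by apply/Cmod_gt_0; exact: Cminus_neq_0.
  have H8 : d / (4 * r) = 2 * (d / (8 * r)) by field; lra.
  by rewrite H8 in H5; nra.
(* The derivative now vanishes on a whole disc about [a], so [P] is constant there, against
   injectivity. *)
pose Pa y := P (a + y)%C.
have Hin : forall y, disc (RtoC 0) dm y -> disc a dm (a + y)%C.
  by move=> y; rewrite /disc; have -> : (a + y - a = y - 0)%C by ring.
have HPa0 : forall y, disc (RtoC 0) dm y -> cdiff Pa y (RtoC 0).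
  move=> y /Hin Hy; apply/cdiff_shift; rewrite -(Hzero _ Hy).
  by apply: holomorphic_cdiff HP _; apply: (unit_disc_disc_at a); move: Hy; rewrite /disc; lra.
pose y0 := RtoC (dm / 2).
have Hy0 : disc (RtoC 0) dm y0.
  rewrite /disc /y0; have -> : (RtoC (dm / 2) - 0 = RtoC (dm / 2))%C by ring.
  by rewrite Cmod_RtoC_nonneg; lra.
have := constant_of_zero_derivative Pa dm y0 (holomorphic_intro _ _ _ HPa0) HPa0 Hy0.
rewrite /Pa Cplus_0_r => E.
have Ha1 : unit_disc (a + y0)%C.
  by apply: (unit_disc_disc_at a); have := Hin _ Hy0; rewrite /disc; lra.
have E1 := Hinj _ _ Ha1 Ha E.
have : y0 = RtoC 0.
  have -> : (y0 = (a + y0) - a)%C by ring.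
  by rewrite E1; ring.
by move/RtoC_inj; lra.
Qed.

(** If [w] were omitted on the disc, [/ (P z - w)] would be holomorphic there, at most [2 / d] in
    modulus on the circle of radius [rho / 2], and larger than that at the centre. *)
Theorem injective_open (a : C) (rho : R) :
  unit_disc a -> 0 < rho <= 1 - Cmod a ->
  exists d, 0 < d /\ forall w, Cmod (w - P a) < d -> exists z, disc a rho z /\ P z = w.
Proof.
move=> Ha Hrho.
have [d [Hd Hgap]] := injective_circle_gap a (rho / 2) Ha ltac:(lra).
exists (d / 2); split; first lra.
move=> w Hw; apply: NNPP => Hn.
have Hne : forall z, disc a rho z -> (P z - w <> 0)%C.
  by move=> z Hz; apply: Cminus_neq_0 => E; apply: Hn; exists z.
have Hin : forall z, disc a rho z -> unit_disc z.
  by move=> z Hz; apply: (unit_disc_disc_at a); move: Hz; rewrite /disc; lra.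
have Hinv : holomorphic_on (disc a rho) (fun z => / (P z - w))%C.
  move=> z Hz; eexists; apply/cdiff_is_derive; apply: cdiff_inv; last exact: Hne.
  exact: cdiff_minus (holomorphic_cdiff _ _ _ HP (Hin _ Hz)) (cdiff_const _ _).
have Hbound : forall z, Cmod (z - a) = rho / 2 -> Cmod (/ (P z - w)) <= / (d / 2).
  move=> z Hz; rewrite Cmod_inv; last by apply: Hne; rewrite /disc; lra.
  apply: Rinv_le_contravar; first lra.
  by have := Hgap z Hz; have := Cmod_triangle_minus (P z) w (P a); lra.
have E0 : Cmod (a - a) <= rho / 2.
  by rewrite Cminus_diag Cmod_0; lra.
have Hca := max_modulus _ a rho (rho / 2) _ Hinv ltac:(lra) Hbound a E0.
have Hna : (P a - w <> 0)%C by apply: Hne; apply: disc_center; lra.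
have Hpa : 0 < Cmod (P a - w) by apply/Cmod_gt_0.
rewrite Cmod_inv // in Hca.
have : d / 2 <= Cmod (P a - w).
  rewrite -(Rinv_inv (d / 2)) -(Rinv_inv (Cmod (P a - w))).
  by apply: Rinv_le_contravar => //; apply: Rinv_0_lt_compat.
by rewrite Cmod_minus_sym; lra.
Qed.

Lemma injective_image_open : open (T := C_UniformSpace) (image P unit_disc).
Proof.
move=> w [a [Ha ->]].
have [d [Hd H]] := injective_open a (1 - Cmod a) Ha
  ltac:(rewrite /unit_disc in Ha; lra).
apply/locally_Cmod; exists d; split => // v /H [z [Hz <-]].
by exists z; split => //; apply: (unit_disc_disc_at a).
Qed.

Definition disc_inverse (w : C) : C :=
  epsilon (inhabits (RtoC 0)) (fun z => unit_disc z /\ w = P z).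

Lemma disc_inverse_spec (w : C) :
  image P unit_disc w -> unit_disc (disc_inverse w) /\ w = P (disc_inverse w).
Proof. exact: epsilon_spec. Qed.

Lemma disc_inverse_left (z : C) : unit_disc z -> disc_inverse (P z) = z.
Proof.
move=> Hz; have [H1 H2] := disc_inverse_spec (P z) (ex_intro _ z (conj Hz eq_refl)).
exact: Hinj.
Qed.

(** Openness makes the inverse continuous. Its slope at [P z] is the reciprocal of the slope of [P]
    at [z], read at the preimage, and is continuous because [P'] has no zero. *)
Theorem disc_inverse_cdiff (z : C) :
  unit_disc z -> cdiff disc_inverse (P z) (/ C_derive P z)%C.
Proof.
move=> Hz; have Hz1 : Cmod z < 1 := Hz.
have Hcont : ccont_C disc_inverse (P z).
  apply/continuous_C_iff => e He; apply/locally_Cmod.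
  have [d [Hd H]] := injective_open z (Rmin e (1 - Cmod z)) Hz
    ltac:(split; [apply: Rmin_pos; lra | exact: Rmin_r]).
  exists d; split => // v /H [y [Hy <-]].
  have Hye : Cmod (y - z) < e by apply: Rlt_le_trans Hy (Rmin_l _ _).
  rewrite !disc_inverse_left //; apply: (unit_disc_disc_at z).
  by apply: Rlt_le_trans Hy (Rmin_r _ _).
have [phi [Cphi [Ephi Hphi]]] := holomorphic_cdiff _ _ _ HP Hz.
have Hne : phi z <> RtoC 0 by rewrite Ephi; exact: injective_derive_neq_0.
have Cphi2 : ccont_C
    (fun v => phi (disc_inverse v)) (P z).
  by apply: (continuous_comp (V := C_UniformSpace) disc_inverse phi) => //; rewrite disc_inverse_left.
have Hloc1 : locally (T := C_UniformSpace) (P z) (fun v => phi (disc_inverse v) <> RtoC 0).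
  have Hp : 0 < Cmod (phi z) by apply/Cmod_gt_0.
  have := proj1 (continuous_C_iff _ _) Cphi2 _ Hp; rewrite disc_inverse_left //.
  apply: locally_imp => v Hv E; rewrite E in Hv.
  have E0 : (RtoC 0 - phi z = - phi z)%C by ring.
  by rewrite E0 Cmod_opp in Hv; lra.
have Hloc2 := injective_image_open (P z) (ex_intro _ z (conj Hz eq_refl)).
apply: (cdiff_ext_loc (fun v => z + (v - P z) * / phi (disc_inverse v))%C).
  apply: locally_imp (locally_and _ _ _ Hloc1 Hloc2) => v [Hv1 Hv2].
  have [_ E] := disc_inverse_spec v Hv2.
  have {}E : v = (P z + (disc_inverse v - z) * phi (disc_inverse v))%C.
    by transitivity (P (disc_inverse v)); [exact: E | exact: Hphi].
  have sub_eq : forall u a b : C, u = (a + b)%C -> (u - a)%C = b by move=> u a b ->; ring.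
  rewrite (sub_eq _ _ _ E).
  by field.
exists (fun v => / phi (disc_inverse v))%C; split; last split.
- by apply: continuous_Cinv => //; rewrite disc_inverse_left.
- by rewrite disc_inverse_left // Ephi.
- by move=> y; rewrite Cminus_diag Cmult_0_l Cplus_0_r.
Qed.

End Injective.

(** * Schur's algorithm for functions subordinate to a convex map *)

(** For [|g| < 1] the disc automorphism [T] of the overview, with inverse [moebius (- g)]. *)
Definition moebius (g u : C) : C := ((u + g) / (RtoC 1 + Cconj g * u))%C.

Definition moebius' (g u : C) : C :=
  ((RtoC 1 - g * Cconj g) / ((RtoC 1 + Cconj g * u) * (RtoC 1 + Cconj g * u)))%C.

Lemma moebius_denominator (g u : C) : Cmod g * Cmod u < 1 -> (RtoC 1 + Cconj g * u <> 0)%C.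
Proof.
move=> H E; have : Cmod (Cconj g * u) = 1.
  have -> : (Cconj g * u = - (1))%C.
    have -> : (Cconj g * u = (1 + Cconj g * u) - 1)%C by ring.
    by rewrite E; ring.
  exact: Cmod_m1.
by rewrite Cmod_mult Cmod_conj; lra.
Qed.

Lemma Cmod_lt_prod (x y : C) : Cmod x < 1 -> Cmod y <= 1 -> Cmod x * Cmod y < 1.
Proof. by move=> Hx Hy; have := Cmod_ge_0 x; have := Cmod_ge_0 y; nra. Qed.

Lemma Cmod_le_prod (x y : C) : Cmod x <= 1 -> Cmod y < 1 -> Cmod x * Cmod y < 1.
Proof. by move=> Hx Hy; have := Cmod_ge_0 x; have := Cmod_ge_0 y; nra. Qed.

Lemma moebius_modulus_identity (g u : C) :
  Cmod (RtoC 1 + Cconj g * u) ^ 2 - Cmod (u + g) ^ 2 = (1 - Cmod g ^ 2) * (1 - Cmod u ^ 2).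
Proof.
rewrite !Cmod2_alt !re_plus !im_plus re_mult im_mult re_conj im_conj.
by have -> : Re (RtoC 1) = 1; [|have -> : Im (RtoC 1) = 0; [|ring]].
Qed.

Lemma Cmod_sq_le_1 (u : C) : Cmod u <= 1 -> Cmod u ^ 2 <= 1.
Proof. by move=> H; have := Cmod_ge_0 u; nra. Qed.

Lemma moebius_le_1 (g u : C) : Cmod g < 1 -> Cmod u <= 1 -> Cmod (moebius g u) <= 1.
Proof.
move=> Hg Hu; have Hn := moebius_denominator g u (Cmod_lt_prod _ _ Hg Hu).
apply: Cmod_div_le => //; rewrite Rmult_1_l; apply: Cmod_le_of_sq.
have := moebius_modulus_identity g u; have := Cmod_sq_le_1 u Hu.
have := Cmod_sq_le_1 g (Rlt_le _ _ Hg); nra.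
Qed.

Lemma moebius_lt_1 (g u : C) : Cmod g < 1 -> Cmod u < 1 -> Cmod (moebius g u) < 1.
Proof.
move=> Hg Hu; have Hn := moebius_denominator g u (Cmod_lt_prod _ _ Hg (Rlt_le _ _ Hu)).
rewrite /moebius Cmod_div //; apply/Rlt_div_l; first by apply/Cmod_gt_0.
rewrite Rmult_1_l.
have H1 := moebius_modulus_identity g u.
have Hg0 := Cmod_ge_0 g; have Hu0 := Cmod_ge_0 u.
have Hpos : 0 < (1 - Cmod g ^ 2) * (1 - Cmod u ^ 2) by apply: Rmult_lt_0_compat; nra.
have := Cmod_ge_0 (u + g); have := Cmod_ge_0 (RtoC 1 + Cconj g * u); nra.
Qed.

Lemma cdiff_moebius (g u : C) :
  Cmod g * Cmod u < 1 -> cdiff (moebius g) u (moebius' g u).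
Proof.
move=> H; have Hn := moebius_denominator g u H.
have H1 := cdiff_plus _ _ _ _ _ (cdiff_id u) (cdiff_const g u).
have H2 := cdiff_plus _ _ _ _ _ (cdiff_const (RtoC 1) u) (cdiff_scal _ _ _ (cdiff_id u) (Cconj g)).
apply: cdiff_eq (cdiff_div _ _ _ _ _ H1 H2 Hn) _.
by rewrite /moebius'; field.
Qed.

Lemma one_minus_gg_neq_0 (g : C) : Cmod g < 1 -> (RtoC 1 - g * Cconj g <> 0)%C.
Proof.
move=> Hg; apply: Cminus_neq_0 => E.
have : Cmod (g * Cconj g) = 1 by rewrite -E Cmod_1.
by rewrite Cmod_mult Cmod_conj; have := Cmod_ge_0 g; nra.
Qed.

Lemma moebius_inverse (g u : C) :
  Cmod g < 1 -> Cmod u <= 1 -> moebius (- g) (moebius g u) = u.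
Proof.
move=> Hg Hu; have Hn := moebius_denominator g u (Cmod_lt_prod _ _ Hg Hu).
have H1 := one_minus_gg_neq_0 g Hg.
rewrite /moebius Copp_conj.
have E : (1 + - Cconj g * ((u + g) / (1 + Cconj g * u)) = (1 - g * Cconj g) / (1 + Cconj g * u))%C.
  by field.
by rewrite E; field; split.
Qed.

Lemma moebius_inverse' (g u : C) :
  Cmod g < 1 -> Cmod u <= 1 -> (moebius' (- g) (moebius g u) * moebius' g u = 1)%C.
Proof.
move=> Hg Hu; have Hn := moebius_denominator g u (Cmod_lt_prod _ _ Hg Hu).
have H1 := one_minus_gg_neq_0 g Hg.
rewrite /moebius' /moebius Copp_conj.
have E : (1 + - Cconj g * ((u + g) / (1 + Cconj g * u)) = (1 - g * Cconj g) / (1 + Cconj g * u))%C.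
  by field.
by rewrite E; field; split.
Qed.

Lemma moebius'_neq_0 (g u : C) : Cmod g < 1 -> Cmod u <= 1 -> moebius' g u <> RtoC 0.
Proof.
move=> Hg Hu E; have := moebius_inverse' g u Hg Hu.
by rewrite E Cmult_0_r => H; apply: C1_nz; rewrite H.
Qed.

Lemma moebius_0 (g : C) : moebius g (RtoC 0) = g.
Proof. by rewrite /moebius; field; rewrite Cmult_0_r Cplus_0_r; exact: C1_nz. Qed.

Lemma right_derivative_nonpos (E : C -> C) (v : C) :
  cdiff E (RtoC 0) v -> (forall t, 0 < t <= 1 -> Re (E (RtoC t)) <= Re (E (RtoC 0))) -> Re v <= 0.
Proof.
move=> /cdiff_eps H Hle; apply: le_epsilon => e He.
have [d [Hd HE]] := H e He.
pose t := Rmin 1 (d / 2).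
have Ht0 : 0 < t by apply: Rmin_pos; lra.
have Ht1 : t <= 1 by exact: Rmin_l.
have Ht2 : t <= d / 2 by exact: Rmin_r.
have E0 : (RtoC t - 0 = RtoC t)%C by ring.
have := HE (RtoC t); rewrite E0 Cmod_RtoC_nonneg; last lra.
move=> /(_ ltac:(lra)) H1.
have H2 := Rle_trans _ _ _ (re_le_Cmod _) H1.
have H3 : Re (E (RtoC t) - E 0 - RtoC t * v)%C = Re (E (RtoC t)) - Re (E (RtoC 0)) - t * Re v.
  by rewrite -re_scal_l.
rewrite H3 in H2.
have := Hle t (conj Ht0 Ht1).
move: H2 => /Rabs_le_between H2; nra.
Qed.

Section Schur.

Variables (Om : C -> Prop) (P : C -> C).
Hypothesis Om_convex : convex_set Om.
Hypothesis HP : holomorphic_on unit_disc P.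
Hypothesis Hinj : injective_on unit_disc P.
Hypothesis Honto : forall w, image P unit_disc w <-> Om w.

(* The functions subordinate to [P] whose Schwarz function has derivative [g] at 0. *)
Definition schur_class (g : C) (q : C -> C) : Prop :=
  holomorphic_on unit_disc q /\ (forall z, unit_disc z -> Om (q z)) /\
  q (RtoC 0) = P (RtoC 0) /\ C_derive q (RtoC 0) = (g * C_derive P (RtoC 0))%C.

(** The value [h_z(e)] of the overview. For fixed [e] it is the member of the class whose Schur
    parameter [psi] is the constant [e]. *)
Definition extremal (g e z : C) : C := P (z * moebius g (z * e))%C.

Lemma schur_class_convex (g : C) (q1 q2 : C -> C) (t : R) :
  schur_class g q1 -> schur_class g q2 -> 0 <= t <= 1 ->
  schur_class g (fun z => RtoC (1 - t) * q1 z + RtoC t * q2 z)%C.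
Proof.
move=> [H1 [O1 [E1 D1]]] [H2 [O2 [E2 D2]]] Ht.
have Hd : forall z, unit_disc z -> cdiff (fun z => RtoC (1 - t) * q1 z + RtoC t * q2 z)%C z
    (RtoC (1 - t) * C_derive q1 z + RtoC t * C_derive q2 z)%C.
  move=> z Hz; apply: cdiff_plus; apply: cdiff_scal.
    exact: holomorphic_cdiff H1 Hz.
  exact: holomorphic_cdiff H2 Hz.
split; first exact: holomorphic_intro Hd.
split; first by move=> z Hz; apply: Om_convex => //; [exact: O1 | exact: O2].
split; first by rewrite E1 E2 RtoC_minus; ring.
by rewrite (cdiff_C_derive _ _ _ (Hd _ unit_disc_0)) D1 D2 RtoC_minus; ring.
Qed.

(** The inverse of [P] composed with [q] is a Schwarz function, and [phi] is its quotient by [z];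
    the chain rule at 0 cancels [P' 0] and leaves [phi 0 = g]. *)
Lemma schwarz_function (g : C) (q : C -> C) :
  schur_class g q ->
  exists phi, holomorphic_on unit_disc phi /\ phi (RtoC 0) = g /\
    (forall z, unit_disc z -> Cmod (phi z) <= 1) /\
    (forall z, unit_disc z -> unit_disc (z * phi z)%C /\ q z = P (z * phi z)%C).
Proof.
move=> [Hq [Oq [Eq Dq]]].
have H0 := injective_derive_neq_0 P HP Hinj _ unit_disc_0.
pose w z := disc_inverse P (q z).
have Hw : forall z, unit_disc z -> unit_disc (w z) /\ q z = P (w z).
  by move=> z Hz; apply: disc_inverse_spec; apply/Honto; exact: Oq.
have Dw : forall z, unit_disc z -> cdiff w z (C_derive q z * / C_derive P (w z))%C.
  move=> z Hz; apply: cdiff_comp; first exact: holomorphic_cdiff Hq Hz.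
  have [H1 ->] := Hw z Hz; exact: disc_inverse_cdiff.
have w0 : w (RtoC 0) = RtoC 0.
  by rewrite /w Eq; apply: disc_inverse_left => //; exact: unit_disc_0.
have [|phi [H1 [H2 [H3 H4]]]] := schwarz_quotient w (holomorphic_intro _ _ _ Dw) w0.
  by move=> z /Hw [Hz _]; apply: Rlt_le.
exists phi; split => //; split; last split => //.
  rewrite -H2 (cdiff_C_derive _ _ _ (Dw _ unit_disc_0)) Dq w0; field.
  exact: H0.
by move=> z Hz; rewrite -H3 //; exact: Hw.
Qed.

(** Here [phi] attains modulus 1 at the centre and is therefore constant; this is the case of a
    one-point region. *)
Lemma schur_class_unimodular (g : C) (q : C -> C) :
  Cmod g = 1 -> schur_class g q -> forall z, unit_disc z -> q z = P (g * z)%C.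
Proof.
move=> Hg /schwarz_function [phi [H1 [H2 [H3 H4]]]] z Hz.
have [_ ->] := H4 z Hz; congr P.
rewrite (strong_max_modulus phi (RtoC 0) H1 H3 unit_disc_0) //; rewrite H2 //.
ring.
Qed.

Lemma rotation_schur_class (g : C) :
  Cmod g <= 1 -> schur_class g (fun z => P (g * z)%C).
Proof.
move=> Hg.
have Hin : forall z, unit_disc z -> unit_disc (g * z)%C.
  by move=> z Hz; rewrite /unit_disc Cmod_mult; exact: Cmod_le_prod.
have Hd : forall z, unit_disc z -> cdiff (fun z => P (g * z)%C) z (g * C_derive P (g * z))%C.
  by move=> z /Hin Hz; apply: cdiff_scale; exact: holomorphic_cdiff HP Hz.
split; first exact: holomorphic_intro Hd.
split; first by move=> z Hz; apply/Honto; exists (g * z)%C; split => //; exact: Hin.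
split; first by rewrite Cmult_0_r.
by rewrite (cdiff_C_derive _ _ _ (Hd _ unit_disc_0)) Cmult_0_r.
Qed.

Variable g : C.
Hypothesis Hg : Cmod g < 1.

Lemma schur_step (q : C -> C) (z : C) :
  schur_class g q -> unit_disc z -> exists e, Cmod e <= 1 /\ q z = extremal g e z.
Proof.
move=> /schwarz_function [phi [H1 [H2 [H3 H4]]]] Hz.
have Hg' : Cmod (- g) < 1 by rewrite Cmod_opp.
pose psi y := moebius (- g) (phi y).
have Hpsi : holomorphic_on unit_disc psi.
  move=> y Hy; eexists; apply/cdiff_is_derive; apply: cdiff_comp.
    exact: holomorphic_cdiff H1 Hy.
  by apply: cdiff_moebius; apply: Cmod_lt_prod => //; exact: H3.
have psi0 : psi (RtoC 0) = RtoC 0.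
  rewrite /psi H2 -{2}(moebius_0 g); apply: moebius_inverse => //.
  by rewrite Cmod_0; lra.
have Hb : forall y, unit_disc y -> Cmod (psi y) <= 1.
  by move=> y Hy; apply: moebius_le_1 => //; exact: H3.
have Hs := schwarz_lemma psi z Hpsi psi0 Hb Hz.
have Ephi : phi z = moebius g (psi z).
  have := moebius_inverse (- g) (phi z) Hg' (H3 z Hz).
  by have -> : (- - g = g)%C by ring.
have [_ Eq] := H4 z Hz.
(* At [z = 0] every [extremal g e] takes the value [P 0], so any parameter serves; elsewhere [e] is
   [psi z / z], bounded by Schwarz's lemma. *)
case: (classic (z = RtoC 0)) => [E | Hz0].
  exists (RtoC 0); split; first by rewrite Cmod_0; lra.
  by rewrite Eq /extremal E !Cmult_0_l.
exists (psi z / z)%C; split; first by apply: Cmod_div_le => //; lra.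
rewrite Eq Ephi /extremal; congr (P (_ * moebius g _)%C); field.
exact: Hz0.
Qed.

Section Extremal.

Variable e : C.

Lemma extremal_in_disc (z : C) :
  unit_disc z -> Cmod (z * e) < 1 -> unit_disc (z * moebius g (z * e))%C.
Proof.
move=> Hz He; rewrite /unit_disc Cmod_mult.
by have := moebius_lt_1 g _ Hg He; have := Cmod_ge_0 (moebius g (z * e)); have := Cmod_ge_0 z;
  rewrite /unit_disc in Hz; nra.
Qed.

Lemma cdiff_extremal (z : C) :
  unit_disc z -> Cmod (z * e) < 1 ->
  cdiff (extremal g e) z
    ((moebius g (z * e) + z * (e * moebius' g (z * e))) * C_derive P (z * moebius g (z * e)))%C.
Proof.
move=> Hz He.
have Hm : Cmod g * Cmod (z * e) < 1 by apply: Cmod_lt_prod => //; lra.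
have H1 : cdiff (fun z => moebius g (z * e)%C) z (e * moebius' g (z * e))%C.
  have H0 := cdiff_mult _ _ _ _ _ (cdiff_id z) (cdiff_const e z).
  by apply: cdiff_eq (cdiff_comp _ (moebius g) _ _ _ H0 (cdiff_moebius g _ Hm)) _; ring.
apply: cdiff_eq (cdiff_comp _ P _ _ _ (cdiff_mult _ _ _ _ _ (cdiff_id z) H1) _) _.
  exact: holomorphic_cdiff HP (extremal_in_disc z Hz He).
ring.
Qed.

Lemma extremal_schur_class : Cmod e <= 1 -> schur_class g (extremal g e).
Proof.
move=> He.
have Hze : forall z, unit_disc z -> Cmod (z * e) < 1.
  by move=> z Hz; rewrite Cmod_mult; exact: Cmod_lt_prod.
split; first by apply: holomorphic_intro => z Hz; exact: cdiff_extremal Hz (Hze _ Hz).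
split.
  move=> z Hz; apply/Honto; exists (z * moebius g (z * e))%C; split => //.
  by apply: extremal_in_disc => //; exact: Hze.
split; first by rewrite /extremal Cmult_0_l.
rewrite (cdiff_C_derive _ _ _ (cdiff_extremal _ unit_disc_0 (Hze _ unit_disc_0))).
by rewrite !Cmult_0_l moebius_0 Cplus_0_r.
Qed.

End Extremal.

(** The prime stands for the derivative in the parameter [e], not in [z]. *)
Definition extremal' (z e : C) : C :=
  (z * z * moebius' g (z * e) * C_derive P (z * moebius g (z * e)))%C.

Lemma cdiff_extremal_parameter (z e : C) :
  unit_disc z -> Cmod (z * e) < 1 -> cdiff (fun e => extremal g e z) e (extremal' z e).
Proof.
move=> Hz He.
have Hm : Cmod g * Cmod (z * e) < 1 by apply: Cmod_lt_prod => //; lra.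
have H1 : cdiff (fun e => z * moebius g (z * e))%C e (z * (z * moebius' g (z * e)))%C.
  by apply: cdiff_scal; apply: cdiff_scale; exact: cdiff_moebius.
apply: cdiff_eq (cdiff_comp _ P _ _ _ H1 (holomorphic_cdiff _ _ _ HP (extremal_in_disc e z Hz He))) _.
rewrite /extremal'; ring.
Qed.

Lemma extremal'_neq_0 (z e : C) :
  unit_disc z -> z <> RtoC 0 -> Cmod (z * e) < 1 -> extremal' z e <> RtoC 0.
Proof.
move=> Hz Hz0 He; apply: Cmult_neq_0; last first.
  by apply: injective_derive_neq_0 => //; exact: extremal_in_disc.
apply: Cmult_neq_0; first exact: Cmult_neq_0.
by apply: moebius'_neq_0 => //; lra.
Qed.

Lemma Cconj_unimodular (e : C) : Cmod e = 1 -> (Cconj e * e = 1)%C.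
Proof. by move=> He; rewrite Cmult_comm -Cmod2_conj He; congr RtoC; ring. Qed.

Lemma unimodular_neq_0 (e : C) : Cmod e = 1 -> e <> RtoC 0.
Proof. by move=> He E; rewrite E Cmod_0 in He; lra. Qed.

(* Convexity of the class makes [(1-t) extremal + t q] again of the form
   [extremal e_t] with [|e_t| <= 1 = |e_0|]; differentiate [e_t] at [t = 0]. *)
Theorem support_inequality (q : C -> C) (e z : C) :
  schur_class g q -> Cmod e = 1 -> unit_disc z -> z <> RtoC 0 ->
  Re ((q z - extremal g e z) / (e * extremal' z e))%C <= 0.
Proof.
move=> Hq He Hz Hz0.
have Hzlt : forall e, Cmod e <= 1 -> Cmod (z * e) < 1.
  by move=> e1 He1; rewrite Cmod_mult; exact: Cmod_lt_prod.
have Hze := Hzlt e (Req_le _ _ He).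
pose om := (z * moebius g (z * e))%C.
have Hom : unit_disc om by exact: extremal_in_disc.
pose line t := (extremal g e z + t * (q z - extremal g e z))%C.
(* The inverse of [e |-> z * moebius g (z * e)]. Composed with the inverse of [P], it reads off the
   parameter [e_t] from the point [line t]. *)
pose Phi w := (moebius (- g) (w / z) / z)%C.
have HPhi : forall e1, Cmod e1 <= 1 -> Phi (z * moebius g (z * e1))%C = e1.
  move=> e1 He1; have H1 := Hzlt e1 He1; rewrite /Phi.
  have -> : (z * moebius g (z * e1) / z = moebius g (z * e1))%C by field.
  by rewrite moebius_inverse //; [field | lra].
have Hg' : Cmod (- g) < 1 by rewrite Cmod_opp.
have DPhi : cdiff Phi om (/ (z * z * moebius' g (z * e)))%C.
  have E1 : (om / z = moebius g (z * e))%C by rewrite /om; field.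
  have H0 : cdiff (fun w => w / z)%C om (/ z)%C.
    by apply: cdiff_eq (cdiff_mult _ _ _ _ _ (cdiff_id om) (cdiff_const (/ z)%C om)) _; ring.
  have H1 : cdiff (moebius (- g)) (om / z)%C (moebius' (- g) (moebius g (z * e))).
    rewrite E1; apply: cdiff_moebius; apply: Cmod_lt_prod => //.
    by apply: moebius_le_1 => //; lra.
  have H2 := cdiff_mult _ _ _ _ _ (cdiff_comp _ _ _ _ _ H0 H1) (cdiff_const (/ z)%C om).
  apply: cdiff_eq H2 _.
  have Em := moebius_inverse' g (z * e) Hg (Rlt_le _ _ Hze).
  have Hn := moebius'_neq_0 g (z * e) Hg (Rlt_le _ _ Hze).
  have -> : moebius' (- g) (moebius g (z * e)) = (/ moebius' g (z * e))%C.
    have -> : (moebius' (- g) (moebius g (z * e)) =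
      (moebius' (- g) (moebius g (z * e)) * moebius' g (z * e)) / moebius' g (z * e))%C by field.
    by rewrite Em; field.
  by field; split.
have HP0 := injective_derive_neq_0 P HP Hinj om Hom.
have L0 : line (RtoC 0) = P om by rewrite /line /extremal -/om; ring.
have R0 : disc_inverse P (line (RtoC 0)) = om by rewrite L0; exact: disc_inverse_left.
(* At real [t] in [[0, 1]] this is [Cconj e * e_t]: it equals 1 at [t = 0] and has modulus at most
   1, so its right derivative there has nonpositive real part. *)
pose E t := (Cconj e * Phi (disc_inverse P (line t)))%C.
have DE : cdiff E (RtoC 0) (Cconj e * ((q z - extremal g e z) * / C_derive P om * / (z * z * moebius' g (z * e))))%C.
  apply: cdiff_scal; apply: cdiff_comp; last by rewrite R0; exact: DPhi.
  apply: cdiff_comp; last by rewrite L0; exact: disc_inverse_cdiff.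
  have H0 := cdiff_plus _ _ _ _ _ (cdiff_const (extremal g e z) (RtoC 0))
    (cdiff_mult _ _ _ _ _ (cdiff_id (RtoC 0)) (cdiff_const (q z - extremal g e z)%C (RtoC 0))).
  by apply: cdiff_eq H0 _; ring.
have Hne := extremal'_neq_0 z e Hz Hz0 Hze.
have He0 := unimodular_neq_0 e He.
have Hn := moebius'_neq_0 g (z * e) Hg (Rlt_le _ _ Hze).
have -> : ((q z - extremal g e z) / (e * extremal' z e) =
   Cconj e * ((q z - extremal g e z) * / C_derive P om * / (z * z * moebius' g (z * e))))%C.
  have -> : Cconj e = (/ e)%C.
    have -> : (Cconj e = (Cconj e * e) / e)%C by field.
    by rewrite Cconj_unimodular //; field.
  by rewrite /extremal' -/om; field; repeat split.
apply: right_derivative_nonpos DE _ => t Ht.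
have Hcl : schur_class g (fun y => RtoC (1 - t) * extremal g e y + RtoC t * q y)%C.
  by apply: schur_class_convex => //; [apply: extremal_schur_class; lra | lra].
have [e1 [He1 Eq1]] := schur_step _ z Hcl Hz.
have Lt : line (RtoC t) = P (z * moebius g (z * e1))%C.
  by rewrite -/(extremal g e1 z) -Eq1 /line RtoC_minus; ring.
have H1 : E (RtoC t) = (Cconj e * e1)%C.
  rewrite /E Lt disc_inverse_left //; first by rewrite HPhi.
  by apply: extremal_in_disc => //; exact: Hzlt.
have H2 : E (RtoC 0) = RtoC 1.
  by rewrite /E R0 /om HPhi; [exact: Cconj_unimodular | lra].
rewrite H1 H2; apply: Rle_trans (Rle_abs _) _; apply: Rle_trans (re_le_Cmod _) _.
by rewrite Cmod_mult Cmod_conj He /=; lra.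
Qed.

End Schur.

(** * Convexity and starlikeness inequalities *)

Lemma Re_accumulation_nonpos (u : C -> C) (a : C) :
  ccont_C u a ->
  (forall d, 0 < d -> exists y, Cmod (y - a) < d /\ Re (u y) <= 0) -> Re (u a) <= 0.
Proof.
move=> /continuous_C_iff Hu H; apply: le_epsilon => e He.
have [d [Hd Hde]] := proj1 (locally_Cmod _ _) (Hu e He).
have [y [Hy Hy0]] := H d Hd.
have := Rle_lt_trans _ _ _ (re_le_Cmod _) (Hde y Hy).
have -> : Re (u y - u a) = Re (u y) - Re (u a) by [].
by move=> /Rabs_def2; lra.
Qed.

Lemma cdiff_rotation (a tau : C) :
  cdiff (fun y => a * Cexp (Ci * y))%C tau (a * (Ci * Cexp (Ci * tau)))%C.
Proof. by apply: cdiff_scal; apply: cdiff_scale; exact: cdiff_Cexp. Qed.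

(* Second-order expansion of the support inequality along [e exp (i tau)]. *)
Lemma convexity_second_order (h : C -> C) (R0 : R) (e : C) :
  holomorphic_on (disc (RtoC 0) R0) h -> disc (RtoC 0) R0 e -> e <> RtoC 0 ->
  C_derive h e <> RtoC 0 ->
  (forall t : R, Re ((h (e * Cexp (Ci * RtoC t)) - h e) / (e * C_derive h e))%C <= 0) ->
  0 <= Re (RtoC 1 + e * C_derive (C_derive h) e / C_derive h e)%C.
Proof.
move=> Hh He He0 Hd0 Hneg.
have Hh' := holomorphic_derive _ _ _ Hh.
have Hme : 0 < Cmod e by apply/Cmod_gt_0.
have HeR : Cmod e < R0 by move: He; rewrite /disc Cminus_0_r.
(* Since [|e * exp (i t)| = |e| * exp (- Im t)], the curve stays in the domain of [h] for complex
   [t] with [|t| < rho]. *)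
pose rho := ln (R0 / Cmod e).
have Hq : 1 < R0 / Cmod e by apply/Rlt_div_r; lra.
have Hrho : 0 < rho by rewrite /rho -ln_1; apply: ln_increasing; lra.
have Hin : forall t, disc (RtoC 0) rho t -> disc (RtoC 0) R0 (e * Cexp (Ci * t))%C.
  move=> t; rewrite /disc !Cminus_0_r => Ht; rewrite Cmod_mult Cmod_Cexp.
  have -> : Re (Ci * t)%C = - Im t by rewrite /=; rewrite /Im; ring.
  have Hi : - Im t < rho.
    by have := im_le_Cmod t; move=> /Rabs_le_between; lra.
  have := exp_increasing _ _ Hi; rewrite /rho exp_ln; last lra.
  move=> H; have : Cmod e * exp (- Im t) < Cmod e * (R0 / Cmod e) by apply: Rmult_lt_compat_l.
  by have -> : Cmod e * (R0 / Cmod e) = R0 by field; lra.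
pose c := (/ (e * C_derive h e))%C.
pose Y t := (c * (h (e * Cexp (Ci * t)) - h e))%C.
pose Y' t := (c * (e * (Ci * Cexp (Ci * t)) * C_derive h (e * Cexp (Ci * t))))%C.
have DY : forall t, disc (RtoC 0) rho t -> cdiff Y t (Y' t).
  move=> t /Hin Ht; apply: cdiff_scal.
  apply: cdiff_eq (cdiff_minus _ _ _ _ _ (cdiff_comp _ h _ _ _ (cdiff_rotation e t)
     (holomorphic_cdiff _ _ _ Hh Ht)) (cdiff_const (h e) t)) _.
  ring.
have HY := holomorphic_intro _ _ _ DY.
have D0 := disc_center (RtoC 0) _ Hrho.
have E0 : (e * Cexp (Ci * 0) = e)%C by rewrite Cmult_0_r Cexp_0; ring.
have DY' : cdiff Y' (RtoC 0) (- (1 + e * C_derive (C_derive h) e / C_derive h e))%C.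
  have H1 : cdiff (fun t => e * (Ci * Cexp (Ci * t)))%C (RtoC 0) (e * (Ci * (Ci * Cexp (Ci * 0))))%C.
    by apply: cdiff_scal; apply: cdiff_scal; apply: cdiff_scale; exact: cdiff_Cexp.
  have H2 := cdiff_comp _ (C_derive h) _ _ _ (cdiff_rotation e (RtoC 0))
     (holomorphic_cdiff _ _ _ Hh' (Hin _ D0)).
  apply: cdiff_eq (cdiff_scal _ _ _ (cdiff_mult _ _ _ _ _ H1 H2) c) _.
  rewrite E0 Cmult_0_r Cexp_0 /c.
  have Ei : forall u, (e * (Ci * (Ci * 1)) * u = - (e * u))%C.
    by move=> u; have -> : (Ci * (Ci * 1) = - (1))%C; [apply: C_ext => /=; ring | ring].
  rewrite Ei.
  have -> : (e * (Ci * 1) * (e * (Ci * 1) * C_derive (C_derive h) e)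
     = e * (Ci * (Ci * 1)) * (e * C_derive (C_derive h) e))%C by ring.
  by rewrite Ei; field.
have HY' := holomorphic_derive _ _ _ HY.
have EY' : forall t, disc (RtoC 0) rho t -> C_derive Y t = Y' t.
  by move=> t /DY /cdiff_C_derive.
have EY'' : C_derive (C_derive Y) (RtoC 0) = (- (1 + e * C_derive (C_derive h) e / C_derive h e))%C.
  apply: cdiff_C_derive; apply: cdiff_ext_loc DY'.
  by apply: locally_imp (disc_locally _ _ _ D0) => t /EY'.
(* Dividing twice by [t] writes [Y t = i t + t^2 * Y2 t] with [2 * Y2 0 = Y'' 0]. At real [t] the
   linear term is imaginary, so [Re (Y2 t) <= 0] for small [t > 0], hence also at 0. *)
pose Y1 := radial_mean 0 (C_derive Y).
have HY1 : holomorphic_on (disc (RtoC 0) rho) Y1 by exact: radial_mean_holomorphic.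
have Y10 : Y1 (RtoC 0) = Ci.
  have := radial_mean_0 _ _ HY' 0 Hrho; rewrite /= Cmult_1_l /Y1 => ->.
  by rewrite EY' // /Y' E0 Cmult_0_r Cexp_0 /c; field; split.
have Y1' : C_derive Y1 (RtoC 0) = radial_mean 1 (C_derive (C_derive Y)) (RtoC 0).
  by apply: cdiff_C_derive; exact: (cdiff_radial_mean rho _ HY' 0 _ D0).
pose Y2 := radial_mean 0 (C_derive Y1).
have HY1' := holomorphic_derive _ _ _ HY1.
have Y20 : (RtoC 2 * Y2 (RtoC 0) = - (1 + e * C_derive (C_derive h) e / C_derive h e))%C.
  have := radial_mean_0 _ _ HY1' 0 Hrho; rewrite /= Cmult_1_l /Y2 => ->.
  rewrite Y1'.
  by have := radial_mean_0 _ _ (holomorphic_derive _ _ _ HY') 1 Hrho; rewrite EY''.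
have Hexp : forall t, disc (RtoC 0) rho t -> Y t = (Ci * t + t * t * Y2 t)%C.
  move=> t Ht; rewrite (holomorphic_quotient _ _ _ HY Ht) -/Y1.
  have -> : Y (RtoC 0) = RtoC 0 by rewrite /Y E0; ring.
  by rewrite (holomorphic_quotient _ _ _ HY1 Ht) -/Y2 Y10; ring.
have HY2 : Re (Y2 (RtoC 0)) <= 0.
  apply: Re_accumulation_nonpos.
    apply: holomorphic_continuous D0; exact: radial_mean_holomorphic.
  move=> d Hd; pose t := Rmin (rho / 2) (d / 2).
  have Ht0 : 0 < t by apply: Rmin_pos; lra.
  have Ht1 : t <= rho / 2 by exact: Rmin_l.
  have Ht2 : t <= d / 2 by exact: Rmin_r.
  exists (RtoC t); rewrite Cminus_0_r Cmod_RtoC_nonneg; last lra.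
  split; first lra.
  have Htd : disc (RtoC 0) rho (RtoC t) by rewrite /disc Cminus_0_r Cmod_RtoC_nonneg; lra.
  have := Hneg t.
  have -> : ((h (e * Cexp (Ci * RtoC t)) - h e) / (e * C_derive h e) = Y (RtoC t))%C.
    by rewrite /Y /c /Cdiv; ring.
  rewrite Hexp // re_plus -RtoC_mult re_scal_l.
  have -> : Re (Ci * RtoC t) = 0 by rewrite /=; ring.
  have Htt : 0 < t * t by nra.
  by move=> H; nra.
have E : Re (RtoC 2 * Y2 (RtoC 0))%C = 2 * Re (Y2 (RtoC 0)) by rewrite re_scal_l.
rewrite Y20 re_opp in E; lra.
Qed.

(* At a maximum of [Re p] on a closed disc the derivative along the circle
   vanishes and the radial one is nonnegative. *)
Lemma max_on_disc_derivative (p : C -> C) (r : R) (z1 : C) :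
  holomorphic_on unit_disc p -> r < 1 -> Cmod z1 <= r ->
  (forall z, Cmod z <= r -> Re (p z) <= Re (p z1)) ->
  exists x : R, 0 <= x /\ (z1 * C_derive p z1)%C = RtoC x.
Proof.
move=> Hp Hr Hz1 Hmax.
have Hz1d : unit_disc z1 by rewrite /unit_disc; lra.
have Hd := holomorphic_cdiff _ _ _ Hp Hz1d.
have Hrot : forall s : R, Rabs s = 1 -> Re (z1 * (RtoC s * Ci) * C_derive p z1)%C <= 0.
  move=> s Hs.
  have H1 : cdiff (fun t => z1 * Cexp (RtoC s * Ci * t))%C (RtoC 0) (z1 * (RtoC s * Ci))%C.
    apply: cdiff_eq (cdiff_scal _ _ _ (cdiff_scale (RtoC 0) (RtoC s * Ci) _ Cexp (cdiff_Cexp _)) z1) _.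
    by rewrite Cmult_0_r Cexp_0; ring.
  have H2 : cdiff p (z1 * Cexp (RtoC s * Ci * 0))%C (C_derive p z1).
    by rewrite Cmult_0_r Cexp_0 Cmult_1_r.
  apply: right_derivative_nonpos (cdiff_comp _ p _ _ _ H1 H2) _ => t Ht.
  rewrite Cmult_0_r Cexp_0 Cmult_1_r; apply: Hmax.
  rewrite Cmod_mult Cmod_Cexp.
  have -> : Re (RtoC s * Ci * RtoC t)%C = 0 by rewrite /=; ring.
  by rewrite exp_0 Rmult_1_r.
have Hrad : Re (- (z1 * C_derive p z1))%C <= 0.
  have H1 : cdiff (fun t => z1 * (1 - t))%C (RtoC 0) (- z1)%C.
    apply: cdiff_eq (cdiff_scal _ _ _ (cdiff_minus _ _ _ _ _ (cdiff_const (RtoC 1) (RtoC 0))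
      (cdiff_id (RtoC 0))) z1) _; ring.
  have H2 : cdiff p (z1 * (1 - 0))%C (C_derive p z1).
    by have -> : (z1 * (1 - 0) = z1)%C by ring.
  have -> : (- (z1 * C_derive p z1) = - z1 * C_derive p z1)%C by ring.
  apply: right_derivative_nonpos (cdiff_comp _ p _ _ _ H1 H2) _ => t Ht.
  have -> : (z1 * (1 - 0) = z1)%C by ring.
  apply: Hmax; rewrite -RtoC_minus Cmod_mult Cmod_RtoC_nonneg; last lra.
  by have := Cmod_ge_0 z1; nra.
have Hi1 := Hrot 1 Rabs_R1; have Hi2 := Hrot (-1) ltac:(rewrite Rabs_Ropp; exact: Rabs_R1).
exists (Re (z1 * C_derive p z1)%C); split; first by rewrite re_opp in Hrad; lra.
apply: C_ext => //.
have E1 : Re (z1 * (RtoC 1 * Ci) * C_derive p z1)%C = - Im (z1 * C_derive p z1)%C by rewrite /=; ring.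
have E2 : Re (z1 * (RtoC (-1) * Ci) * C_derive p z1)%C = Im (z1 * C_derive p z1)%C by rewrite /=; ring.
by rewrite E1 in Hi1; rewrite E2 in Hi2; rewrite [RHS]/=; lra.
Qed.

(** The number [s] is a positive multiple of [Cconj L]. *)
Lemma Re_pos_of_product (s L : C) (c : R) : 0 < c -> 0 < Re L -> (s * L)%C = RtoC c -> 0 < Re s.
Proof.
move=> Hc HL E.
have H : (s * (L * Cconj L) = RtoC c * Cconj L)%C by rewrite -E; ring.
have HL2 : 0 < Cmod L ^ 2 by rewrite Cmod2_alt; nra.
have : Re (s * (L * Cconj L))%C = Re s * Cmod L ^ 2 by rewrite -Cmod2_conj re_scal_r.
rewrite H re_scal_l re_conj => E2.
have : 0 < c * Re L by nra.
by rewrite E2 => ?; nra.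
Qed.

Section Starlike.

(* [H z = z^2 radial_mean 1 K z] has derivative [z K z]; the hypothesis on
   [L = 2 + z K' / K = 1 + z H'' / H'] says that [H] is convex, and the
   conclusion that it is starlike. *)
Variable K : C -> C.
Hypothesis HK : holomorphic_on unit_disc K.
Hypothesis HK0 : forall z, unit_disc z -> K z <> RtoC 0.

Let HKd : holomorphic_on (disc (RtoC 0) 1) K := proj1 (holomorphic_unit_disc K) HK.

(** This is [H / (z H')], with the common factor [z^2] removed. *)
Let ratio (z : C) : C := (radial_mean 1 K z / K z)%C.

Let ratio_cdiff (z : C) :
  unit_disc z ->
  cdiff ratio z ((radial_mean 2 (C_derive K) z * K z - radial_mean 1 K z * C_derive K z) / (K z * K z))%C.
Proof.
move=> Hz; apply: cdiff_div; last exact: HK0.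
  exact: (cdiff_radial_mean 1 K HKd 1 z (proj1 (unit_disc_disc z) Hz)).
exact: holomorphic_cdiff HK Hz.
Qed.

(** For [r = H / (z H')] this is the identity [r * (1 + z H'' / H') = 1 - z r']. *)
Lemma ratio_ode (z : C) :
  unit_disc z -> (ratio z * (RtoC 2 + z * C_derive K z / K z) = RtoC 1 - z * C_derive ratio z)%C.
Proof.
move=> Hz; have Hn := HK0 z Hz.
rewrite (cdiff_C_derive _ _ _ (ratio_cdiff z Hz)).
have := radial_mean_ode _ _ HKd 1 z (proj1 (unit_disc_disc z) Hz).
have -> : RtoC (INR 2) = RtoC 2 by rewrite /=; congr RtoC; ring.
move=> E.
have E2 : (z * radial_mean 2 (C_derive K) z = K z - RtoC 2 * radial_mean 1 K z)%C by rewrite -{1}E; ring.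
have -> : (z * ((radial_mean 2 (C_derive K) z * K z - radial_mean 1 K z * C_derive K z) / (K z * K z))
   = ((z * radial_mean 2 (C_derive K) z) * K z - z * radial_mean 1 K z * C_derive K z) / (K z * K z))%C.
  by field.
rewrite E2 /ratio; field; exact: Hn.
Qed.

(** At a minimum of [Re ratio] on a closed disc, [- z ratio'] is a real [x >= 0]. The equation then
    reads [ratio * L = 1 + x], which makes [Re ratio] positive at the minimum, hence on the disc. *)
Lemma starlike_of_convex :
  (forall z, unit_disc z -> 0 < Re (RtoC 2 + z * C_derive K z / K z)%C) ->
  forall z, unit_disc z -> 0 < Re (radial_mean 1 K z / K z)%C.
Proof.
move=> HL z Hz.
have Hr : holomorphic_on unit_disc ratio by exact: holomorphic_intro ratio_cdiff.
pose p y := (RtoC (-1) * ratio y)%C.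
have Dp : forall y, unit_disc y -> cdiff p y (RtoC (-1) * C_derive ratio y)%C.
  by move=> y Hy; apply: cdiff_scal; exact: holomorphic_cdiff Hr Hy.
have Hp := holomorphic_intro _ _ _ Dp.
have [z1 [Hz1 Hmax]] := closed_disc_max (RtoC 0) (Cmod z) (fun y => Re (p y)) (Cmod_ge_0 z)
  ltac:(move=> y Hy; apply: continuous_Re; apply: holomorphic_continuous Hp _;
        rewrite Cminus_0_r in Hy; rewrite /unit_disc in Hz |- *; lra).
rewrite Cminus_0_r in Hz1.
have Hz1d : unit_disc z1 by rewrite /unit_disc in Hz |- *; lra.
have [x [Hx Ex]] := max_on_disc_derivative p (Cmod z) z1 Hp Hz Hz1
  ltac:(by move=> y Hy; apply: Hmax; rewrite Cminus_0_r).
rewrite (cdiff_C_derive _ _ _ (Dp z1 Hz1d)) in Ex.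
have E1 : (RtoC 1 - z1 * C_derive ratio z1 = RtoC (1 + x))%C.
  by rewrite RtoC_plus -Ex; ring.
have H1 := ratio_ode z1 Hz1d; rewrite E1 in H1.
have Hpos := Re_pos_of_product _ _ (1 + x) ltac:(lra) (HL z1 Hz1d) H1.
have := Hmax z ltac:(rewrite Cminus_0_r; lra); rewrite /p !re_scal_l /ratio in Hpos *; lra.
Qed.

(* A differential subordination: with [p = D / H], where [D = z^2 radial_mean 1 D1],
   one has [D1 / K = D' / H' = p + z p' (H / z H')]. *)
Lemma quotient_Re_nonpos (D1 : C -> C) (c : C) :
  (forall z, unit_disc z -> 0 < Re (radial_mean 1 K z / K z)%C) ->
  holomorphic_on unit_disc D1 ->
  (forall z, unit_disc z -> Re (c * (D1 z / K z))%C <= 0) ->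
  (forall z, unit_disc z -> radial_mean 1 K z <> RtoC 0) /\
  holomorphic_on unit_disc (fun z => c * (radial_mean 1 D1 z / radial_mean 1 K z))%C /\
  forall z, unit_disc z -> Re (c * (radial_mean 1 D1 z / radial_mean 1 K z))%C <= 0.
Proof.
move=> Hs HD Hneg.
have HDd : holomorphic_on (disc (RtoC 0) 1) D1 by exact: (proj1 (holomorphic_unit_disc D1) HD).
have HH0 : forall z, unit_disc z -> radial_mean 1 K z <> RtoC 0.
  by move=> z Hz E; have := Hs z Hz; rewrite E /Cdiv Cmult_0_l /=; lra.
pose p z := (c * (radial_mean 1 D1 z / radial_mean 1 K z))%C.
pose p' z := (c * ((radial_mean 2 (C_derive D1) z * radial_mean 1 K z
   - radial_mean 1 D1 z * radial_mean 2 (C_derive K) z) / (radial_mean 1 K z * radial_mean 1 K z)))%C.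
have Dp : forall z, unit_disc z -> cdiff p z (p' z).
  move=> z Hz; apply: cdiff_scal; apply: cdiff_div; last exact: HH0.
    exact: (cdiff_radial_mean 1 D1 HDd 1 z (proj1 (unit_disc_disc z) Hz)).
  exact: (cdiff_radial_mean 1 K HKd 1 z (proj1 (unit_disc_disc z) Hz)).
have Hp := holomorphic_intro _ _ _ Dp.
split => //; split => // z Hz.
(* At the maximum, [z1 * p'] is a real [x >= 0], so the extra term [x * (H / (z H'))] has
   nonnegative real part by starlikeness, and [Re p] there is at most [Re (c * (D1 / K)) <= 0]. *)
have [z1 [Hz1 Hmax]] := closed_disc_max (RtoC 0) (Cmod z) (fun y => Re (p y)) (Cmod_ge_0 z)
  ltac:(move=> y Hy; apply: continuous_Re; apply: holomorphic_continuous Hp _;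
        rewrite Cminus_0_r in Hy; rewrite /unit_disc in Hz |- *; lra).
rewrite Cminus_0_r in Hz1.
have Hz1d : unit_disc z1 by rewrite /unit_disc in Hz |- *; lra.
have [x [Hx Ex]] := max_on_disc_derivative p (Cmod z) z1 Hp Hz Hz1
  ltac:(by move=> y Hy; apply: Hmax; rewrite Cminus_0_r).
rewrite (cdiff_C_derive _ _ _ (Dp z1 Hz1d)) in Ex.
apply: Rle_trans (Hmax z ltac:(rewrite Cminus_0_r; lra)) _.
have Hz1d' := proj1 (unit_disc_disc z1) Hz1d.
have E2 : RtoC (INR 2) = RtoC 2 by rewrite /=; congr RtoC; ring.
have OD := radial_mean_ode _ _ HDd 1 z1 Hz1d'; rewrite E2 in OD.
have OK := radial_mean_ode _ _ HKd 1 z1 Hz1d'; rewrite E2 in OK.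
have Hn := HK0 z1 Hz1d; have Hn1 := HH0 z1 Hz1d.
have E : (c * (D1 z1 / K z1) = p z1 + RtoC x * (radial_mean 1 K z1 / K z1))%C.
  rewrite -Ex /p /p'.
  have ED : (z1 * radial_mean 2 (C_derive D1) z1 = D1 z1 - RtoC 2 * radial_mean 1 D1 z1)%C by rewrite -OD; ring.
  have EK : (z1 * radial_mean 2 (C_derive K) z1 = K z1 - RtoC 2 * radial_mean 1 K z1)%C by rewrite -{1}OK; ring.
  have -> : (z1 * (c * ((radial_mean 2 (C_derive D1) z1 * radial_mean 1 K z1
     - radial_mean 1 D1 z1 * radial_mean 2 (C_derive K) z1) / (radial_mean 1 K z1 * radial_mean 1 K z1)))
    = c * (((z1 * radial_mean 2 (C_derive D1) z1) * radial_mean 1 K z1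
     - radial_mean 1 D1 z1 * (z1 * radial_mean 2 (C_derive K) z1)) / (radial_mean 1 K z1 * radial_mean 1 K z1)))%C.
    by field.
  rewrite ED EK; field; split; [exact: Hn | exact: Hn1].
have H1 := Hneg z1 Hz1d; rewrite E re_plus re_scal_l in H1.
have H2 := Hs z1 Hz1d; nra.
Qed.

End Starlike.

(** * Convexity of [P] and starlikeness of the parameter derivative *)

Section ConvexMap.

Variables (Om : C -> Prop) (P : C -> C).
Hypothesis Om_convex : convex_set Om.
Hypothesis HP : holomorphic_on unit_disc P.
Hypothesis Hinj : injective_on unit_disc P.
Hypothesis Honto : forall w, image P unit_disc w <-> Om w.

Let HP' : holomorphic_on unit_disc (C_derive P).
Proof. by apply/holomorphic_unit_disc; apply: holomorphic_derive; apply/holomorphic_unit_disc. Qed.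

Let P'_neq_0 (z : C) : unit_disc z -> C_derive P z <> RtoC 0 := injective_derive_neq_0 P HP Hinj z.

Lemma disc_inv_iff (z e : C) :
  z <> RtoC 0 -> disc (RtoC 0) (/ Cmod z) e <-> Cmod (z * e) < 1.
Proof.
move=> Hz; have Hp : 0 < Cmod z by apply/Cmod_gt_0.
rewrite /disc Cmod_mult Cminus_0_r.
have E : Cmod z * / Cmod z = 1 by field; lra.
split => H.
  by rewrite -E; apply: Rmult_lt_compat_l.
by apply: (Rmult_lt_reg_l (Cmod z)) => //; rewrite E.
Qed.

Section FixedCoefficient.

Variable g : C.
Hypothesis Hg : Cmod g < 1.

Lemma extremal_parameter_holomorphic (z : C) :
  unit_disc z -> z <> RtoC 0 ->
  holomorphic_on (disc (RtoC 0) (/ Cmod z)) (fun e => extremal P g e z).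
Proof.
move=> Hz Hz0; apply: holomorphic_intro => e /(disc_inv_iff z e Hz0) He.
exact: cdiff_extremal_parameter.
Qed.

Lemma extremal_parameter_derive (z e : C) :
  unit_disc z -> z <> RtoC 0 -> Cmod (z * e) < 1 ->
  C_derive (fun e => extremal P g e z) e = extremal' P g z e.
Proof. by move=> Hz Hz0 He; apply: cdiff_C_derive; exact: cdiff_extremal_parameter. Qed.

Lemma extremal'_parameter_holomorphic (z : C) :
  unit_disc z -> z <> RtoC 0 ->
  holomorphic_on (disc (RtoC 0) (/ Cmod z)) (extremal' P g z).
Proof.
move=> Hz Hz0 e He.
have H := holomorphic_cdiff _ _ _ (holomorphic_derive _ _ _ (extremal_parameter_holomorphic z Hz Hz0)) He.
eexists; apply/cdiff_is_derive; apply: (cdiff_ext_loc _ _ _ _ _ H).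
apply: locally_imp (disc_locally _ _ _ He) => y /(disc_inv_iff z y Hz0) Hy.
exact: extremal_parameter_derive.
Qed.

Lemma unimodular_rotation (e : C) (t : R) : Cmod (e * Cexp (Ci * RtoC t)) = Cmod e.
Proof. by rewrite Cmod_mult Cmod_Cexp_Ci Rmult_1_r. Qed.

(** On [|e| = 1], the support inequality is applied to the rotated extremal functions and expanded
    to second order. The expression is holomorphic in [e] beyond the closed disc, so the maximum
    principle carries the sign inside. *)
Lemma parameter_convexity (z e : C) :
  unit_disc z -> z <> RtoC 0 -> Cmod e <= 1 ->
  0 <= Re (RtoC 1 + e * C_derive (extremal' P g z) e / extremal' P g z e)%C.
Proof.
move=> Hz Hz0.
have Hmz : 0 < Cmod z by apply/Cmod_gt_0.
have Hinv : 1 < / Cmod z.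
  by rewrite -Rinv_1; apply: Rinv_lt_contravar => //; rewrite /unit_disc in Hz; lra.
have Hh := extremal_parameter_holomorphic z Hz Hz0.
have Hh' := extremal'_parameter_holomorphic z Hz Hz0.
have Hne : forall e, Cmod (z * e) < 1 -> extremal' P g z e <> RtoC 0.
  by move=> y Hy; exact: extremal'_neq_0.
have Hle : forall y, Cmod y <= 1 -> Cmod (z * y) < 1.
  by move=> y Hy; rewrite Cmod_mult; exact: Cmod_lt_prod.
have H1 : forall y, Cmod y = 1 -> 0 <= Re (RtoC 1 + y * C_derive (extremal' P g z) y / extremal' P g z y)%C.
  move=> y Hy; have Hzy := Hle y (Req_le _ _ Hy).
  have Hyd := proj2 (disc_inv_iff z y Hz0) Hzy.
  have E1 := extremal_parameter_derive z y Hz Hz0 Hzy.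
  have E2 : C_derive (C_derive (fun e => extremal P g e z)) y = C_derive (extremal' P g z) y.
    apply: cdiff_C_derive; apply: (cdiff_ext_loc _ _ _ _ _ (holomorphic_cdiff _ _ _ Hh' Hyd)).
    apply: locally_imp (disc_locally _ _ _ Hyd) => v /(disc_inv_iff z v Hz0) Hv.
    by symmetry; exact: extremal_parameter_derive.
  rewrite -E2 -E1; apply: (convexity_second_order _ _ _ Hh) => //.
  - exact: unimodular_neq_0.
  - by rewrite E1; exact: Hne.
  - move=> t; rewrite E1; apply: (support_inequality Om P Om_convex HP Hinj Honto g Hg) => //.
    by apply: extremal_schur_class => //; rewrite unimodular_rotation Hy; lra.
move=> He.
pose f y := (RtoC (-1) * (RtoC 1 + y * C_derive (extremal' P g z) y / extremal' P g z y))%C.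
have Hf : holomorphic_on (disc (RtoC 0) (/ Cmod z)) f.
  move=> y Hy; eexists; apply/cdiff_is_derive; apply: cdiff_scal.
  apply: cdiff_plus; first exact: cdiff_const.
  apply: cdiff_div; [| exact: holomorphic_cdiff Hh' Hy | by apply: Hne; apply/disc_inv_iff].
  apply: cdiff_mult; first exact: cdiff_id.
  exact: holomorphic_cdiff (holomorphic_derive _ _ _ Hh') Hy.
have := Re_max_principle_center f (/ Cmod z) 1 0 Hf ltac:(lra) _ e He.
rewrite /f re_scal_l => H.
suff : -1 * Re (RtoC 1 + e * C_derive (extremal' P g z) e / extremal' P g z e)%C <= 0 by lra.
by apply: H => y /H1; rewrite re_scal_l; lra.
Qed.

End FixedCoefficient.

Lemma moebius_zero (u : C) : moebius (RtoC 0) u = u.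
Proof.
rewrite /moebius; have -> : Cconj (RtoC 0) = RtoC 0 by apply: C_ext => /=; ring.
by field; rewrite Cmult_0_l Cplus_0_r; exact: C1_nz.
Qed.

Lemma moebius'_zero (u : C) : moebius' (RtoC 0) u = RtoC 1.
Proof.
rewrite /moebius'; have -> : Cconj (RtoC 0) = RtoC 0 by apply: C_ext => /=; ring.
by field; rewrite Cmult_0_l Cplus_0_r; exact: C1_nz.
Qed.

(* The case [g = 0] of [parameter_convexity], where [extremal 0 e z = P (z^2 e)]. *)
Lemma convex_map_nonneg (b : C) :
  unit_disc b -> 0 <= Re (RtoC 1 + b * C_derive (C_derive P) b / C_derive P b)%C.
Proof.
move=> Hb; case: (classic (b = RtoC 0)) => [-> | Hb0].
  by rewrite Cmult_0_l /Cdiv Cmult_0_l Cplus_0_r /=; lra.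
have Hmb : 0 < Cmod b by apply/Cmod_gt_0.
have Hmb1 : Cmod b < 1 := Hb.
have Hnb : RtoC (Cmod b) <> RtoC 0 by move/RtoC_inj; lra.
(* The point and the unimodular parameter are chosen with [z^2 * e = b]. *)
pose z := RtoC (sqrt (Cmod b)).
pose e := (b / RtoC (Cmod b))%C.
have Hzz : (z * z = RtoC (Cmod b))%C by rewrite /z -RtoC_mult sqrt_def //; lra.
have Hsq : 0 < sqrt (Cmod b) by exact: sqrt_lt_R0.
have Hzd : unit_disc z.
  rewrite /unit_disc /z Cmod_RtoC_nonneg; last lra.
  by rewrite -sqrt_1; apply: sqrt_lt_1; lra.
have Hz0 : z <> RtoC 0 by move/RtoC_inj; lra.
have He : Cmod e = 1 by rewrite /e Cmod_div // Cmod_RtoC_nonneg; [field | ]; lra.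
have Hg0 : Cmod (RtoC 0) < 1 by rewrite Cmod_0; lra.
have Eb : (z * (z * e) = b)%C.
  have -> : (z * (z * e) = (z * z) * e)%C by ring.
  by rewrite Hzz /e; field.
have Hform : forall y, extremal' P (RtoC 0) z y = (z * z * C_derive P (z * z * y))%C.
  by move=> y; rewrite /extremal' moebius_zero moebius'_zero Cmult_1_r Cmult_assoc.
have Hzze : (z * z * e = b)%C by rewrite -Cmult_assoc.
have := parameter_convexity (RtoC 0) Hg0 z e Hzd Hz0 (Req_le _ _ He).
have -> : C_derive (extremal' P (RtoC 0) z) e = (z * z * (z * z * C_derive (C_derive P) b))%C.
  apply: cdiff_C_derive; apply: (cdiff_ext (fun y => z * z * C_derive P (z * z * y))%C).
    by move=> y; rewrite Hform.
  apply: cdiff_scal; apply: cdiff_scale; rewrite Hzze; exact: holomorphic_cdiff HP' Hb.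
rewrite Hform Hzze; congr (0 <= Re (_ + _)%C).
have HPb := P'_neq_0 b Hb.
rewrite -[X in (_ = X * _ / _)%C]Eb; field; split => //; exact: Cmult_neq_0.
Qed.

(** A zero real part at one point would make the expression constant by the strong maximum
    principle, but its value at 0 is 1. *)
Lemma convex_map_pos (b : C) :
  unit_disc b -> 0 < Re (RtoC 1 + b * C_derive (C_derive P) b / C_derive P b)%C.
Proof.
move=> Hb; case: (convex_map_nonneg b Hb) => // E.
pose f y := (RtoC (-1) * (RtoC 1 + y * C_derive (C_derive P) y / C_derive P y))%C.
have HP'' : holomorphic_on unit_disc (C_derive (C_derive P)).
  by apply/holomorphic_unit_disc; apply: holomorphic_derive; apply/holomorphic_unit_disc.
have Hf : holomorphic_on unit_disc f.
  move=> y Hy; eexists; apply/cdiff_is_derive; apply: cdiff_scal.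
  apply: cdiff_plus; first exact: cdiff_const.
  apply: cdiff_div; [| exact: holomorphic_cdiff HP' Hy | exact: P'_neq_0].
  apply: cdiff_mult; first exact: cdiff_id.
  exact: holomorphic_cdiff HP'' Hy.
have Hneg : forall y, unit_disc y -> Re (f y) <= 0.
  by move=> y /convex_map_nonneg; rewrite /f re_scal_l; lra.
have Hfb : Re (f b) = 0 by rewrite /f re_scal_l -E; ring.
have := strong_max_principle f b Hf Hneg Hb Hfb b Hb => Ef.
rewrite Ef /f re_scal_l Cmult_0_l /Cdiv Cmult_0_l Cplus_0_r /= in Hfb; lra.
Qed.

Section Kernel.

Variables (g e : C).
Hypothesis Hg : Cmod g < 1.
Hypothesis He : Cmod e <= 1.

(* [extremal' z e = z^2 kernel z]. *)
Definition kernel (z : C) : C := (moebius' g (z * e) * C_derive P (z * moebius g (z * e)))%C.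

Lemma moebius'_holomorphic (u : C) : Cmod u < 1 -> exists l, cdiff (moebius' g) u l.
Proof.
move=> Hu; have Hn := moebius_denominator g u (Cmod_lt_prod _ _ Hg (Rlt_le _ _ Hu)).
have H := cdiff_plus _ _ _ _ _ (cdiff_const (RtoC 1) u) (cdiff_scal _ _ _ (cdiff_id u) (Cconj g)).
eexists; apply: cdiff_div; first exact: cdiff_const.
  exact: (cdiff_mult _ _ _ _ _ H H).
exact: Cmult_neq_0.
Qed.

Let Hze (z : C) : unit_disc z -> Cmod (z * e) < 1.
Proof. by move=> Hz; rewrite Cmod_mult; exact: Cmod_lt_prod. Qed.

Lemma kernel_neq_0 (z : C) : unit_disc z -> kernel z <> RtoC 0.
Proof.
move=> Hz; have Hlt := Hze z Hz; apply: Cmult_neq_0.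
  by apply: moebius'_neq_0 => //; lra.
by apply: P'_neq_0; exact: extremal_in_disc.
Qed.

(** The second derivative [m] of the automorphism stays abstract: it occurs in the same way on both
    sides of the identity behind [kernel_convexity]. *)
Lemma cdiff_kernel (z m : C) :
  unit_disc z -> cdiff (moebius' g) (z * e)%C m ->
  cdiff kernel z (e * m * C_derive P (z * moebius g (z * e)) + moebius' g (z * e) *
    ((moebius g (z * e) + z * (e * moebius' g (z * e))) *
      C_derive (C_derive P) (z * moebius g (z * e))))%C.
Proof.
move=> Hz Hm; have H := Hze z Hz.
have Hgz : Cmod g * Cmod (z * e) < 1 by apply: Cmod_lt_prod => //; lra.
have H0 := cdiff_mult _ _ _ _ _ (cdiff_id z) (cdiff_const e z).
have H1 : cdiff (fun z => moebius' g (z * e)%C) z (e * m)%C.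
  by apply: cdiff_eq (cdiff_comp _ (moebius' g) _ _ _ H0 Hm) _; ring.
have H2 : cdiff (fun z => moebius g (z * e)%C) z (e * moebius' g (z * e))%C.
  by apply: cdiff_eq (cdiff_comp _ (moebius g) _ _ _ H0 (cdiff_moebius g _ Hgz)) _; ring.
have H3 := cdiff_mult _ _ _ _ _ (cdiff_id z) H2.
have H4 := cdiff_comp _ (C_derive P) _ _ _ H3 (holomorphic_cdiff _ _ _ HP' (extremal_in_disc g Hg e z Hz H)).
by apply: cdiff_eq (cdiff_mult _ _ _ _ _ H1 H4) _; ring.
Qed.

Lemma kernel_holomorphic : holomorphic_on unit_disc kernel.
Proof.
move=> z Hz; have [m Hm] := moebius'_holomorphic _ (Hze z Hz).
by eexists; apply/cdiff_is_derive; exact: cdiff_kernel Hz Hm.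
Qed.

(* [2 + z K' / K] splits as the sum of the convexity quantities of [P] and of
   [e |-> extremal e z]. *)
Lemma kernel_convexity (z : C) :
  unit_disc z -> 0 < Re (RtoC 2 + z * C_derive kernel z / kernel z)%C.
Proof.
move=> Hz; case: (classic (z = RtoC 0)) => [-> | Hz0].
  by rewrite Cmult_0_l /Cdiv Cmult_0_l Cplus_0_r /=; lra.
have H := Hze z Hz; have [m Hm] := moebius'_holomorphic _ H.
have Hom := extremal_in_disc g Hg e z Hz H.
have HPn := P'_neq_0 _ Hom.
have Hmn := moebius'_neq_0 g (z * e) Hg (Rlt_le _ _ H).
have H1 := convex_map_pos _ Hom.
have H2 := parameter_convexity g Hg z e Hz Hz0 He.
have D : C_derive (extremal' P g z) e = (z * z * (z * m * C_derive P (z * moebius g (z * e)) +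
   moebius' g (z * e) * (z * (z * moebius' g (z * e)) * C_derive (C_derive P) (z * moebius g (z * e)))))%C.
  apply: cdiff_C_derive.
  have Hgz : Cmod g * Cmod (z * e) < 1 by apply: Cmod_lt_prod => //; lra.
  have K1 := cdiff_scale e z _ (moebius' g) Hm.
  have K2 := cdiff_scal _ _ _ (cdiff_scale e z _ (moebius g) (cdiff_moebius g _ Hgz)) z.
  have K3 := cdiff_comp _ (C_derive P) _ _ _ K2 (holomorphic_cdiff _ _ _ HP' Hom).
  have K4 := cdiff_scal _ _ _ (cdiff_mult _ _ _ _ _ K1 K3) (z * z)%C.
  by move: K4; apply: cdiff_ext => y; rewrite /extremal'; ring.
have E : (RtoC 2 + z * C_derive kernel z / kernel z =
  (1 + z * moebius g (z * e) * C_derive (C_derive P) (z * moebius g (z * e)) / C_derive P (z * moebius g (z * e)))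
  + (1 + e * C_derive (extremal' P g z) e / extremal' P g z e))%C.
  rewrite (cdiff_C_derive _ _ _ (cdiff_kernel z m Hz Hm)) D /kernel /extremal'.
  by field; repeat split.
by rewrite E re_plus; lra.
Qed.

Lemma kernel_starlike (z : C) : unit_disc z -> 0 < Re (radial_mean 1 kernel z / kernel z)%C.
Proof. exact: (starlike_of_convex kernel kernel_holomorphic kernel_neq_0 kernel_convexity). Qed.

Lemma radial_mean_kernel_neq_0 (z : C) : unit_disc z -> radial_mean 1 kernel z <> RtoC 0.
Proof. by move=> Hz E; have := kernel_starlike z Hz; rewrite E /Cdiv Cmult_0_l /=; lra. Qed.

End Kernel.

End ConvexMap.

(** * The variability region *)

(** For [q = 1 + z f'' / f'] this is [log f']. *)
Definition log_integral (q : C -> C) (z : C) : C :=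
  Cint0 (fun zeta => / zeta * (q zeta - RtoC 1))%C z.

(** The quotient [(q z - q 0) / z] with its singularity at 0 removed; for the [q] above it is
    [f'' / f']. *)
Definition slope (q : C -> C) : C -> C := radial_mean 0 (C_derive q).

Lemma unit_disc_scale (z : C) (t : R) : unit_disc z -> 0 <= t <= 1 -> unit_disc (RtoC t * z)%C.
Proof.
move=> Hz Ht; rewrite /unit_disc in Hz *; rewrite Cmod_mult Cmod_RtoC_nonneg; last lra.
by have := Cmod_ge_0 z; nra.
Qed.

Section LogIntegral.

Variable q : C -> C.
Hypothesis Hq : holomorphic_on unit_disc q.

Let Hqd : holomorphic_on (disc (RtoC 0) 1) q := proj1 (holomorphic_unit_disc q) Hq.

Lemma slope_holomorphic : holomorphic_on (disc (RtoC 0) 1) (slope q).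
Proof. exact: (radial_mean_holomorphic 1 _ (holomorphic_derive _ _ _ Hqd) 0). Qed.

Lemma slope_0 : slope q (RtoC 0) = C_derive q (RtoC 0).
Proof.
by have := radial_mean_0 _ _ (holomorphic_derive _ _ _ Hqd) 0 Rlt_0_1; rewrite /= Cmult_1_l.
Qed.

Hypothesis Hq0 : q (RtoC 0) = RtoC 1.

Lemma slope_eq_quotient (z : C) : unit_disc z -> (q z - RtoC 1 = z * slope q z)%C.
Proof.
move=> /unit_disc_disc Hz; rewrite (holomorphic_quotient _ _ _ Hqd Hz) Hq0 /slope; ring.
Qed.

Lemma log_integral_eq (z : C) :
  unit_disc z -> log_integral q z = (z * radial_mean 0 (slope q) z)%C.
Proof.
move=> Hz; case: (classic (z = RtoC 0)) => [-> | Hz0].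
  by rewrite /log_integral /Cint0 !Cmult_0_l.
rewrite /log_integral /Cint0 /radial_mean; congr (z * _)%C.
apply: CInt_ext; first lra.
move=> t Ht.
have Ht0 : RtoC t <> RtoC 0 by move/RtoC_inj; lra.
have Htz : unit_disc (RtoC t * z)%C.
  by apply: unit_disc_scale => //; lra.
rewrite slope_eq_quotient //= Cmult_1_l; field; split => //.
Qed.

Lemma log_integral_0 : log_integral q (RtoC 0) = RtoC 0.
Proof. by rewrite /log_integral /Cint0 Cmult_0_l. Qed.

Lemma cdiff_log_integral (z : C) : unit_disc z -> cdiff (log_integral q) z (slope q z).
Proof.
move=> Hz; apply: (cdiff_ext_loc (fun y => y * radial_mean 0 (slope q) y)%C).
  by apply: locally_imp (unit_disc_locally _ Hz) => y Hy; rewrite log_integral_eq.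
exact: (cdiff_primitive 1 _ slope_holomorphic z (proj1 (unit_disc_disc z) Hz)).
Qed.

End LogIntegral.

Lemma eq_of_derivatives (f1 f2 d : C -> C) :
  (forall z, unit_disc z -> cdiff f1 z (d z)) -> (forall z, unit_disc z -> cdiff f2 z (d z)) ->
  f1 (RtoC 0) = f2 (RtoC 0) -> forall z, unit_disc z -> f1 z = f2 z.
Proof.
move=> H1 H2 H0 z /unit_disc_disc Hz.
have Hd : forall y, disc (RtoC 0) 1 y -> cdiff (fun y => f1 y - f2 y)%C y (RtoC 0).
  move=> y Hy; have Hy' := proj2 (unit_disc_disc y) Hy.
  by apply: cdiff_eq (cdiff_minus _ _ _ _ _ (H1 y Hy') (H2 y Hy')) _; ring.
have := constant_of_zero_derivative _ 1 z (holomorphic_intro _ _ _ Hd) Hd Hz; rewrite H0.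
have -> : (f2 (RtoC 0) - f2 (RtoC 0) = 0)%C by ring.
by move=> E; apply: (proj2 (Ceq_minus _ _)).
Qed.

(** Equal values and derivatives at 0 make [q1 - q2] divisible by [z^2]; dividing by [zeta] and
    integrating leaves the primitive of [zeta * D1 zeta]. *)
Lemma second_order_quotient (q1 q2 : C -> C) :
  holomorphic_on unit_disc q1 -> holomorphic_on unit_disc q2 ->
  q1 (RtoC 0) = RtoC 1 -> q2 (RtoC 0) = RtoC 1 ->
  C_derive q1 (RtoC 0) = C_derive q2 (RtoC 0) ->
  exists D1, holomorphic_on unit_disc D1 /\
    (forall z, unit_disc z -> (q1 z - q2 z = z * z * D1 z)%C) /\
    (forall z, unit_disc z -> (log_integral q1 z - log_integral q2 z = z * z * radial_mean 1 D1 z)%C).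
Proof.
move=> H1 H2 E1 E2 Ed.
have S1 := slope_holomorphic _ H1; have S2 := slope_holomorphic _ H2.
pose d z := (slope q1 z - slope q2 z)%C.
have Hd : holomorphic_on (disc (RtoC 0) 1) d.
  by apply: holomorphic_intro => z Hz; apply: cdiff_minus;
    [exact: holomorphic_cdiff S1 Hz | exact: holomorphic_cdiff S2 Hz].
have d0 : d (RtoC 0) = RtoC 0 by rewrite /d !slope_0 // Ed; ring.
pose D1 := radial_mean 0 (C_derive d).
have HD1 : holomorphic_on (disc (RtoC 0) 1) D1.
  exact: (radial_mean_holomorphic 1 _ (holomorphic_derive _ _ _ Hd) 0).
have Hdz : forall z, unit_disc z -> d z = (z * D1 z)%C.
  by move=> z /unit_disc_disc Hz; rewrite (holomorphic_quotient _ _ _ Hd Hz) d0 /D1; ring.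
exists D1; split; first by apply/holomorphic_unit_disc.
split.
  move=> z Hz.
  have -> : (q1 z - q2 z = (q1 z - RtoC 1) - (q2 z - RtoC 1))%C by ring.
  rewrite !slope_eq_quotient //.
  have -> : (z * slope q1 z - z * slope q2 z = z * d z)%C by rewrite /d; ring.
  by rewrite Hdz //; ring.
apply: (eq_of_derivatives _ _ d).
- move=> z Hz; apply: cdiff_minus; exact: cdiff_log_integral.
- move=> z Hz; have Hzd := proj1 (unit_disc_disc z) Hz.
  have K1 := cdiff_mult _ _ _ _ _ (cdiff_id z) (cdiff_id z).
  apply: cdiff_eq (cdiff_mult _ _ _ _ _ K1 (cdiff_radial_mean 1 _ HD1 1 z Hzd)) _.
  rewrite Hdz // -(radial_mean_ode 1 _ HD1 1 z Hzd).
  have -> : RtoC (INR 2) = RtoC 2 by rewrite /=; congr RtoC; ring.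
  have -> : RtoC 2 = (1 + 1)%C by rewrite -RtoC_plus; congr RtoC; ring.
  ring.
- by rewrite !log_integral_0; ring.
Qed.

Section Region.

Variables (Om : C -> Prop) (P : C -> C).
Hypothesis Om_convex : convex_set Om.
Hypothesis HP : holomorphic_on unit_disc P.
Hypothesis Hinj : injective_on unit_disc P.
Hypothesis Honto : forall w, image P unit_disc w <-> Om w.
Hypothesis HP0 : P (RtoC 0) = RtoC 1.

Variable g : C.
Hypothesis Hg : Cmod g < 1.

Let HPd : holomorphic_on (disc (RtoC 0) 1) P := proj1 (holomorphic_unit_disc P) HP.
Let HPd' : holomorphic_on (disc (RtoC 0) 1) (C_derive P) := holomorphic_derive _ _ _ HPd.

(** The derivative of [Q P g z] at [e], by [cdiff_Q]; as a function of [z] it is the starlike [H] of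
    the overview, with [H' = z * kernel]. *)
Definition parameter_derivative (z e : C) : C := (z * z * radial_mean 1 (kernel P g e) z)%C.

Lemma parameter_derivative_neq_0 (z e : C) :
  unit_disc z -> z <> RtoC 0 -> Cmod e <= 1 -> parameter_derivative z e <> RtoC 0.
Proof.
move=> Hz Hz0 He; apply: Cmult_neq_0; first exact: Cmult_neq_0.
exact: (radial_mean_kernel_neq_0 Om P Om_convex HP Hinj Honto g e Hg He z Hz).
Qed.

Lemma comparison (q : C -> C) (e : C) :
  schur_class Om P g q -> Cmod e = 1 ->
  (forall z, unit_disc z -> z <> RtoC 0 ->
    Re ((log_integral q z - log_integral (extremal P g e) z) / (e * parameter_derivative z e))%C <= 0) /\
  (forall z0, unit_disc z0 -> z0 <> RtoC 0 ->
    Re ((log_integral q z0 - log_integral (extremal P g e) z0) / (e * parameter_derivative z0 e))%C = 0 ->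
    exists c : C, Re c = 0 /\ forall z, unit_disc z ->
      (log_integral q z - log_integral (extremal P g e) z = e * parameter_derivative z e * c)%C).
Proof.
move=> Hq He; have He1 := Req_le _ _ He; have He0 := unimodular_neq_0 e He.
have Hx := extremal_schur_class Om P HP Honto g Hg e He1.
have [Hqh [_ [Eq Dq]]] := Hq; have [Hxh [_ [Ex Dx]]] := Hx.
have [D1 [HD1 [E1 E2]]] := second_order_quotient q (extremal P g e) Hqh Hxh
  (eq_trans Eq HP0) (eq_trans Ex HP0) (eq_trans Dq (eq_sym Dx)).
have HK := kernel_holomorphic P HP g e Hg He1.
have HK0 := kernel_neq_0 P HP Hinj g e Hg He1.
have Hs := kernel_starlike Om P Om_convex HP Hinj Honto g e Hg He1.
have Hform : forall z, extremal' P g z e = (z * z * kernel P g e z)%C.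
  by move=> z; rewrite /extremal' /kernel; ring.
have Hne : forall z, unit_disc z -> z <> RtoC 0 -> Re (/ e * (D1 z / kernel P g e z))%C <= 0.
  move=> z Hz Hz0; have Hkz := HK0 z Hz.
  have := support_inequality Om P Om_convex HP Hinj Honto g Hg q e z Hq He Hz Hz0.
  by rewrite E1 // Hform; congr (Re _ <= 0); field; repeat split.
(* The support inequality requires [z <> 0]; the value at 0 follows by continuity along the positive
   axis. *)
have Hneg : forall z, unit_disc z -> Re (/ e * (D1 z / kernel P g e z))%C <= 0.
  move=> z Hz; case: (classic (z = RtoC 0)) => [E | Hz0]; last exact: Hne.
  apply: (Re_accumulation_nonpos (fun z => / e * (D1 z / kernel P g e z))%C).
    apply: continuous_Cmult; first exact: continuous_const.
    by apply: continuous_Cdiv; [exact: HK0 | exact: holomorphic_continuous HD1 Hz |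
      exact: holomorphic_continuous HK Hz].
  move=> d Hd; pose t := Rmin (1 / 2) (d / 2).
  have Ht0 : 0 < t by apply: Rmin_pos; lra.
  have Ht1 : t <= 1 / 2 by exact: Rmin_l.
  have Ht2 : t <= d / 2 by exact: Rmin_r.
  exists (RtoC t); rewrite E.
  have -> : (RtoC t - 0 = RtoC t)%C by ring.
  rewrite Cmod_RtoC_nonneg; last lra.
  split; first lra.
  apply: Hne; first by rewrite /unit_disc Cmod_RtoC_nonneg; lra.
  by move/RtoC_inj; lra.
have [Hr0 [Hph Hpn]] := quotient_Re_nonpos _ HK HK0 D1 (/ e)%C Hs HD1 Hneg.
have Hquot : forall z, unit_disc z -> z <> RtoC 0 ->
    ((log_integral q z - log_integral (extremal P g e) z) / (e * parameter_derivative z e)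
     = / e * (radial_mean 1 D1 z / radial_mean 1 (kernel P g e) z))%C.
  move=> z Hz Hz0; have Hn := Hr0 z Hz; rewrite E2 // /parameter_derivative; field.
  by repeat split.
split; first by move=> z Hz Hz0; rewrite Hquot //; exact: Hpn.
move=> z0 Hz0d Hz0; rewrite Hquot // => Hzero.
exists (/ e * (radial_mean 1 D1 (RtoC 0) / radial_mean 1 (kernel P g e) (RtoC 0)))%C.
have Hc := strong_max_principle _ z0 Hph Hpn Hz0d Hzero.
split; first by rewrite -(Hc z0 Hz0d).
move=> z Hz; rewrite -(Hc z Hz) E2 // /parameter_derivative; have Hn := Hr0 z Hz.
by field; repeat split.
Qed.

Lemma Q_log_integral (z e : C) : Q P g z e = log_integral (extremal P g e) z.
Proof.
rewrite /Q /log_integral; congr Cint0; apply: functional_extensionality => zeta.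
congr (_ * (P (_ * _) - _))%C; rewrite /moebius; congr (_ / _)%C; ring.
Qed.

(** * Differentiation of [Q] with respect to [eps] *)

Section DerivativeInEps.

Variables (z0 : C).
Hypothesis Hz0d : unit_disc z0.
Hypothesis Hz0 : z0 <> RtoC 0.

Let z_ (t : R) : C := (RtoC t * z0)%C.
Let P1 : C -> C := slope P.
(** The integrand of [Q] with [zeta] cancelled: [(P (zeta T) - 1) / zeta = T * P1 (zeta T)], which
    is regular at [t = 0]. *)
Let N (w : C) (t : R) : C := (moebius g (z_ t * w) * P1 (z_ t * moebius g (z_ t * w)))%C.
Let N' (w : C) (t : R) : C :=
  (z_ t * moebius' g (z_ t * w) * C_derive P (z_ t * moebius g (z_ t * w)))%C.

Let z_disc (t : R) : 0 <= t <= 1 -> unit_disc (z_ t).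
Proof. by move=> Ht; exact: unit_disc_scale. Qed.

Let zw_lt (w : C) (t : R) : Cmod (z0 * w) < 1 -> 0 <= t <= 1 -> Cmod (z_ t * w) < 1.
Proof.
move=> Hw Ht; have -> : (z_ t * w = RtoC t * (z0 * w))%C by rewrite /z_; ring.
rewrite Cmod_mult Cmod_RtoC_nonneg; last lra.
by have := Cmod_ge_0 (z0 * w); nra.
Qed.

Let P1_holomorphic : holomorphic_on (disc (RtoC 0) 1) P1 := slope_holomorphic P HP.

Let N_cdiff (w : C) (t : R) :
  Cmod (z0 * w) < 1 -> 0 <= t <= 1 -> cdiff (fun v => N v t) w (N' w t).
Proof.
move=> Hw Ht; have H := zw_lt w t Hw Ht; have Hz := z_disc t Ht.
have Hm : Cmod g * Cmod (z_ t * w) < 1 by apply: Cmod_lt_prod => //; lra.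
have Hom := proj1 (unit_disc_disc _) (extremal_in_disc g Hg w _ Hz H).
have K1 := cdiff_scale w (z_ t) _ _ (cdiff_moebius g _ Hm).
have K2 := cdiff_comp _ P1 _ _ _ (cdiff_scal _ _ _ K1 (z_ t)) (holomorphic_cdiff _ _ _ P1_holomorphic Hom).
apply: cdiff_eq (cdiff_mult _ _ _ _ _ K1 K2) _.
(* The two terms of the product rule combine because [P1 u + u * P1' u = P' u]. *)
rewrite /N' -(radial_mean_ode 1 _ HPd' 0 _ Hom) -/P1.
rewrite (cdiff_C_derive _ _ _ (cdiff_radial_mean 1 _ HPd' 0 _ Hom)) /P1 /slope.
have -> : RtoC (INR 1) = RtoC 1 by [].
ring.
Qed.

Let continuous_zw (w : C) (t : R) :
  ccont_CR
    (fun p => z_ (snd p) * fst p)%C (w, t).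
Proof.
apply: continuous_Cmult; last exact: continuous_fst.
apply: continuous_Cmult; last exact: continuous_const.
by apply: continuous_RtoC; exact: continuous_snd.
Qed.

Let continuous_om (w : C) (t : R) :
  Cmod (z0 * w) < 1 -> 0 <= t <= 1 ->
  ccont_CR
    (fun p => moebius g (z_ (snd p) * fst p))%C (w, t) /\
  ccont_CR
    (fun p => z_ (snd p) * moebius g (z_ (snd p) * fst p))%C (w, t).
Proof.
move=> Hw Ht; have H := zw_lt w t Hw Ht.
have Hm : Cmod g * Cmod (z_ t * w) < 1 by apply: Cmod_lt_prod => //; lra.
have H1 : ccont_CR
    (fun p => moebius g (z_ (snd p) * fst p))%C (w, t).
  apply: (continuous_comp (V := C_UniformSpace) (fun p => z_ (snd p) * fst p)%C (moebius g)).
    exact: continuous_zw.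
  exact: cdiff_continuous (cdiff_moebius g _ Hm).
split => //; apply: continuous_Cmult => //.
apply: continuous_Cmult; last exact: continuous_const.
by apply: continuous_RtoC; exact: continuous_snd.
Qed.

Let N'_continuous (w : C) (t : R) :
  Cmod (z0 * w) < 1 -> 0 <= t <= 1 ->
  ccont_CR
    (fun p => N' (fst p) (snd p)) (w, t).
Proof.
move=> Hw Ht; have H := zw_lt w t Hw Ht; have [_ Com] := continuous_om w t Hw Ht.
have Hom := proj1 (unit_disc_disc _) (extremal_in_disc g Hg w _ (z_disc t Ht) H).
have [l Hl] := moebius'_holomorphic g Hg _ H.
apply: continuous_Cmult.
  apply: continuous_Cmult.
    apply: continuous_Cmult; last exact: continuous_const.
    by apply: continuous_RtoC; exact: continuous_snd.
  apply: (continuous_comp (V := C_UniformSpace) (fun p => z_ (snd p) * fst p)%C (moebius' g)).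
    exact: continuous_zw.
  exact: cdiff_continuous Hl.
apply: (continuous_comp (V := C_UniformSpace)
  (fun p => z_ (snd p) * moebius g (z_ (snd p) * fst p))%C (C_derive P)) => //.
exact: holomorphic_continuous HPd' Hom.
Qed.

Let N_integrable (w : C) : Cmod (z0 * w) < 1 -> ex_CInt (N w) 0 1.
Proof.
move=> Hw; apply: ex_CInt_continuous; first lra.
move=> t Ht; have H := zw_lt w t Hw Ht; have [C1 C2] := continuous_om w t Hw Ht.
have Hom := proj1 (unit_disc_disc _) (extremal_in_disc g Hg w _ (z_disc t Ht) H).
apply: (continuous_slice N).
apply: continuous_Cmult => //.
apply: (continuous_comp (V := C_UniformSpace)
  (fun p => z_ (snd p) * moebius g (z_ (snd p) * fst p))%C P1) => //.
exact: holomorphic_continuous P1_holomorphic Hom.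
Qed.

Lemma Q_integral (w : C) : Cmod (z0 * w) < 1 -> Q P g z0 w = (z0 * CInt (N w) 0 1)%C.
Proof.
move=> Hw; rewrite Q_log_integral /log_integral /Cint0; congr (z0 * _)%C.
apply: CInt_ext; first lra.
move=> t Ht; have Ht1 : 0 <= t <= 1 by lra.
have H := zw_lt w t Hw Ht1.
have Hom := extremal_in_disc g Hg w _ (z_disc t Ht1) H.
have Ht0 : RtoC t <> RtoC 0 by move/RtoC_inj; lra.
rewrite -/(z_ t) /extremal (slope_eq_quotient P HP HP0 _ Hom) /N /P1.
by field; exact: Cmult_neq_0.
Qed.

Lemma cdiff_Q (e : C) : Cmod (z0 * e) < 1 -> cdiff (Q P g z0) e (parameter_derivative z0 e).
Proof.
move=> He.
have Hmz : 0 < Cmod z0 by apply/Cmod_gt_0.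
pose d := (1 - Cmod (z0 * e)) / Cmod z0.
have Hd : 0 < d by apply: Rdiv_lt_0_compat; lra.
have Hin : forall w, Cmod (w - e) < d -> Cmod (z0 * w) < 1.
  move=> w Hw.
  have -> : (z0 * w = z0 * e + z0 * (w - e))%C by ring.
  apply: Rle_lt_trans (Cmod_triangle _ _) _; rewrite (Cmod_mult z0 (w - e)).
  have : Cmod z0 * Cmod (w - e) < Cmod z0 * d by apply: Rmult_lt_compat_l.
  have -> : Cmod z0 * d = 1 - Cmod (z0 * e) by rewrite /d; field; lra.
  lra.
apply: (cdiff_ext_loc (fun w => z0 * CInt (N w) 0 1)%C).
  apply/locally_Cmod; exists d; split => // w /Hin Hw; by rewrite Q_integral.
have HN' : ex_CInt (N' e) 0 1.
  apply: ex_CInt_continuous; first lra.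
  by move=> t Ht; apply: (continuous_slice N'); exact: N'_continuous.
have -> : parameter_derivative z0 e = (z0 * CInt (N' e) 0 1)%C.
  have E : radial_mean 1 (kernel P g e) z0 = (/ z0 * CInt (N' e) 0 1)%C.
    rewrite -CInt_scal //; apply: CInt_ext; first lra.
    by move=> t _; rewrite /N' /kernel /z_ /= Rmult_1_r; field.
  by rewrite /parameter_derivative E; field.
apply: cdiff_scal; apply: (cdiff_CInt_param N N' 0 1 e d) => //; first lra.
- by move=> w t /Hin Hw Ht; exact: N_cdiff.
- by move=> w t /Hin Hw Ht; exact: N'_continuous.
- by move=> w /Hin; exact: N_integrable.
Qed.

End DerivativeInEps.

End Region.

(** The minimum [d] of [|u z| + max (1, |z|)] over a closed disc of radius [s > 1] exceeds 1, and a
    zero of [u] in that disc must have [|z| >= d]. This provides the room around the closed unit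
    disc that the maximum principle requires. *)
Lemma nonvanishing_extension (u : C -> C) (rho : R) :
  1 < rho ->
  (forall z, disc (RtoC 0) rho z -> ccont_C u z) ->
  (forall z, Cmod z <= 1 -> u z <> RtoC 0) ->
  exists r, 1 < r <= rho /\ forall z, disc (RtoC 0) r z -> u z <> RtoC 0.
Proof.
move=> Hrho Hu Hn.
pose s := (1 + rho) / 2.
have Hc : forall z, Cmod (z - 0) <= s ->
    continuous (T := C_UniformSpace) (fun z => - (Cmod (u z) + Rmax 1 (Cmod z))) z.
  move=> z; rewrite Cminus_0_r => Hz; apply: (continuous_opp (V := R_NormedModule) (U := C_UniformSpace)).
  apply: (continuous_plus (V := R_NormedModule) (U := C_UniformSpace)
    (fun z => Cmod (u z)) (fun z : C => Rmax 1 (Cmod z))).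
    by apply: continuous_Cmod; apply: Hu; rewrite /disc Cminus_0_r; rewrite /s in Hz; lra.
  apply/continuous_ball_iff => e; apply/locally_Cmod; exists e; split; first exact: cond_pos.
  move=> y Hy; apply: Rle_lt_trans Hy.
  rewrite /minus /plus /opp /= /abs /=.
  have := Cmod_reverse_triangle y z; have := Cmod_reverse_triangle z y.
  rewrite (Cmod_minus_sym z y) /Rmax.
  by repeat destruct Rle_dec; move=> ? ?; apply: Rabs_le; lra.
have [z1 [Hz1 Hmax]] := closed_disc_max (RtoC 0) s _ ltac:(rewrite /s; lra) Hc.
pose d := Cmod (u z1) + Rmax 1 (Cmod z1).
have Hd : 1 < d.
  rewrite /d; case: (Rle_dec (Cmod z1) 1) => H1.
    have : 0 < Cmod (u z1) by apply/Cmod_gt_0; exact: Hn.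
    by have := Rmax_l 1 (Cmod z1); lra.
  by have := Cmod_ge_0 (u z1); have := Rmax_r 1 (Cmod z1); lra.
exists (Rmin s d); split.
  by split; [apply: Rmin_glb_lt; rewrite /s; lra | apply: Rle_trans (Rmin_l _ _) _; rewrite /s; lra].
move=> z; rewrite /disc Cminus_0_r => Hz E.
have Hzs : Cmod z < s by apply: Rlt_le_trans Hz (Rmin_l _ _).
have Hzd : Cmod z < d by apply: Rlt_le_trans Hz (Rmin_r _ _).
have := Hmax z ltac:(rewrite Cminus_0_r; lra); rewrite -/d E Cmod_0.
have : Rmax 1 (Cmod z) < d by apply: Rmax_lub_lt.
rewrite /d; lra.
Qed.

Lemma Re_inv_nonpos (x : C) : x <> RtoC 0 -> Re x <= 0 -> Re (/ x)%C <= 0.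
Proof.
move=> Hx H; have Hp : 0 < Cmod x ^ 2 by apply: pow_lt; apply/Cmod_gt_0.
have -> : Re (/ x)%C = Re x / (Re x ^ 2 + Im x ^ 2) by [].
by rewrite -Cmod2_alt; apply/Rle_div_l; lra.
Qed.

Lemma cdiff_Cint0 (F : C -> C) (z : C) :
  holomorphic_on unit_disc F -> unit_disc z -> cdiff (Cint0 F) z (F z).
Proof.
move=> HF Hz; have HFd := proj1 (holomorphic_unit_disc F) HF.
apply: (cdiff_ext (fun y => y * radial_mean 0 F y)%C).
  move=> y; rewrite /Cint0 /radial_mean; congr (y * _)%C.
  by apply: CInt_ext; [lra | move=> t _ /=; ring].
exact: (cdiff_primitive 1 F HFd z (proj1 (unit_disc_disc z) Hz)).
Qed.

Lemma Cint0_0 (F : C -> C) : Cint0 F (RtoC 0) = RtoC 0.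
Proof. by rewrite /Cint0 Cmult_0_l. Qed.

Lemma Cint0_ext (F G : C -> C) (z : C) :
  (forall y, unit_disc y -> F y = G y) -> unit_disc z -> Cint0 F z = Cint0 G z.
Proof.
move=> H Hz; rewrite /Cint0; congr (z * _)%C; apply: CInt_ext; first lra.
by move=> t Ht; apply: H; apply: unit_disc_scale => //; lra.
Qed.

Lemma derive_eq_on_disc (f d : C -> C) (z l : C) :
  (forall y, unit_disc y -> cdiff f y (d y)) -> unit_disc z -> cdiff d z l ->
  cdiff (C_derive f) z l.
Proof.
move=> Hf Hz; apply: cdiff_ext_loc; apply: locally_imp (unit_disc_locally _ Hz) => y /Hf Hy.
by rewrite (cdiff_C_derive _ _ _ Hy).
Qed.

(** * Logarithms of derivatives *)

(** The product [h * exp (- L)] has zero derivative, so [L] is a branch. As [log_branch] is a choice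
    among branches, it must also be shown that every branch has derivative [h' / h = d] and so
    equals [L]. *)
Lemma log_branch_eq (h h' L d : C -> C) :
  (forall z, unit_disc z -> cdiff h z (h' z)) -> (forall z, unit_disc z -> cdiff L z (d z)) ->
  h (RtoC 0) = RtoC 1 -> L (RtoC 0) = RtoC 0 ->
  (forall z, unit_disc z -> h' z = (h z * d z)%C) ->
  (forall z, unit_disc z -> Cexp (L z) = h z) /\
  forall z, unit_disc z -> log_branch h z = L z.
Proof.
move=> Hh HL h0 L0 Hd.
have HE : forall z, unit_disc z -> Cexp (L z) = h z.
  move=> z Hz.
  have H1 : (h z * Cexp (RtoC (-1) * L z) = 1)%C.
    apply: (eq_of_derivatives (fun z => h z * Cexp (RtoC (-1) * L z))%C (fun _ => RtoC 1)
      (fun _ => RtoC 0)) => //.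
    - move=> y Hy; have K1 := cdiff_comp _ Cexp _ _ _ (cdiff_scal _ _ _ (HL y Hy) (RtoC (-1))) (cdiff_Cexp _).
      by apply: cdiff_eq (cdiff_mult _ _ _ _ _ (Hh y Hy) K1) _; rewrite Hd //; ring.
    - by move=> y _; exact: cdiff_const.
    - by rewrite h0 L0 Cmult_0_r Cexp_0; ring.
  have H2 : (Cexp (RtoC (-1) * L z) * Cexp (L z) = 1)%C.
    by rewrite -Cexp_plus; have -> : (RtoC (-1) * L z + L z = 0)%C; [ring | exact: Cexp_0].
  have -> : Cexp (L z) = ((h z * Cexp (RtoC (-1) * L z)) * Cexp (L z))%C by rewrite H1; ring.
  by rewrite -Cmult_assoc H2; ring.
split => //.
have [B1 [B2 B3]] : is_log_branch h (log_branch h).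
  by apply: epsilon_spec; exists L; split; [exact: holomorphic_intro HL | split].
apply: (eq_of_derivatives _ _ d) => //; last by rewrite B2 L0.
move=> z Hz; have K := holomorphic_cdiff _ _ _ B1 Hz.
apply: cdiff_eq K _; set l := C_derive _ z.
have K1 : cdiff h z (l * Cexp (log_branch h z))%C.
  apply: (cdiff_ext_loc (fun y => Cexp (log_branch h y))).
    by apply: locally_imp (unit_disc_locally _ Hz) => y; exact: B3.
  exact: cdiff_comp (holomorphic_cdiff _ _ _ B1 Hz) (cdiff_Cexp _).
have E := cdiff_unique _ _ _ _ K1 (Hh z Hz).
rewrite Hd // B3 // in E.
have Hn : h z <> RtoC 0 by rewrite -B3 //; exact: Cexp_neq_0.
have -> : l = ((l * h z) / h z)%C by field.
by rewrite E; field.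
Qed.

Lemma Omega_convex (k : R) : 0 <= k -> convex_set (Omega k).
Proof.
move=> Hk w1 w2 t; rewrite /Omega => H1 H2 Ht.
rewrite re_plus !re_scal_l.
have -> : (RtoC (1 - t) * w1 + RtoC t * w2 - RtoC 1
  = RtoC (1 - t) * (w1 - RtoC 1) + RtoC t * (w2 - RtoC 1))%C by rewrite RtoC_minus; ring.
have := Cmod_triangle (RtoC (1 - t) * (w1 - RtoC 1)) (RtoC t * (w2 - RtoC 1)).
rewrite !Cmod_mult !Cmod_RtoC_nonneg; try lra.
set m := Cmod _; set m1 := Cmod (w1 - _) in H1 *; set m2 := Cmod (w2 - _) in H2 *.
move=> Hm.
have : k * m <= (1 - t) * (k * m1) + t * (k * m2) by nra.
(* The strict inequality must come from a point of positive weight: [w1] when [t = 0], otherwise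
   [w2]. *)
case: (Req_dec t 0) => [-> | Ht0]; first by nra.
have : t * (k * m2) < t * Re w2 by apply: Rmult_lt_compat_l; lra.
have : (1 - t) * (k * m1) <= (1 - t) * Re w1 by apply: Rmult_le_compat_l; lra.
lra.
Qed.

Definition variability_region (Om : C -> Prop) (P : C -> C) (g z0 w : C) : Prop :=
  exists q, schur_class Om P g q /\ w = log_integral q z0.

(** * Correspondence between k-uniformly convex functions and the Schur class *)

Section Main.

Variables (k : R) (P : C -> C).
Hypothesis Hk : 0 <= k.
Hypothesis HP : holomorphic_on unit_disc P.
Hypothesis Hinj : injective_on unit_disc P.
Hypothesis Honto : forall w, image P unit_disc w <-> Omega k w.
Hypothesis HP0 : P (RtoC 0) = RtoC 1.
Hypothesis HPim : Im (C_derive P (RtoC 0)) = 0.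
Hypothesis HPre : 0 < Re (C_derive P (RtoC 0)).

Let Om_convex : convex_set (Omega k) := Omega_convex k Hk.
Let cls := schur_class (Omega k) P.

Lemma derive_P_0 : C_derive P (RtoC 0) = RtoC (alpha1 P).
Proof. by apply: C_ext. Qed.

Lemma alpha1_neq_0 : RtoC (alpha1 P) <> RtoC 0.
Proof. by move/RtoC_inj; rewrite /alpha1; lra. Qed.

(** The quotient [q = 1 + z f'' / f'] has [q' 0 = f'' 0 = 2 * lambda], which must equal
    [g * P' 0]. *)
Definition gamma_of (lambda : C) : C := (RtoC 2 * lambda / RtoC (alpha1 P))%C.

Section FromFunction.

Variables (f : C -> C) (lambda : C).
Hypothesis Hf : kUCV k f.
Hypothesis Ha2 : a2 f = lambda.

Let q := convexity_quotient f.

Let Hf' : holomorphic_on unit_disc (C_derive f).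
Proof.
by apply/holomorphic_unit_disc; apply: holomorphic_derive; apply/holomorphic_unit_disc; exact: (proj1 Hf).
Qed.

Let q_0 : q (RtoC 0) = RtoC 1.
Proof. by rewrite /q /convexity_quotient Cmult_0_l /Cdiv Cmult_0_l Cplus_0_r. Qed.

Let f'_neq_0 (z : C) : unit_disc z -> C_derive f z <> RtoC 0 := proj1 (proj2 (proj2 (proj2 Hf))) z.

Let q_derive_0 : C_derive q (RtoC 0) = C_derive (C_derive f) (RtoC 0).
Proof.
have [_ [_ [f'0 _]]] := Hf.
have Hf'' : holomorphic_on unit_disc (C_derive (C_derive f)).
  by apply/holomorphic_unit_disc; apply: holomorphic_derive; apply/holomorphic_unit_disc.
have U0 := unit_disc_0.
apply: cdiff_C_derive.
have K1 := cdiff_mult _ _ _ _ _ (cdiff_id (RtoC 0)) (holomorphic_cdiff _ _ _ Hf'' U0).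
have K2 := cdiff_div _ _ _ _ _ K1 (holomorphic_cdiff _ _ _ Hf' U0) (f'_neq_0 _ U0).
apply: cdiff_eq (cdiff_plus _ _ _ _ _ (cdiff_const (RtoC 1) _) K2) _.
by rewrite f'0; field; exact: C1_nz.
Qed.

Lemma kUCV_schur_class : cls (gamma_of lambda) q.
Proof.
have [_ [_ [_ [_ [Hq Oq]]]]] := Hf.
split => //; split => //; split; first by rewrite HP0; exact: q_0.
rewrite q_derive_0 derive_P_0 /gamma_of -Ha2 /a2; field.
exact: alpha1_neq_0.
Qed.

Lemma kUCV_slope (z : C) :
  unit_disc z -> C_derive (C_derive f) z = (C_derive f z * slope q z)%C.
Proof.
move=> Hz; have [_ [_ [f'0 [_ [Hq Oq]]]]] := Hf.
case: (classic (z = RtoC 0)) => [-> | Hz0].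
  by rewrite f'0 slope_0 // q_derive_0; ring.
have := slope_eq_quotient q Hq q_0 z Hz.
have Hn := f'_neq_0 z Hz.
have -> : (q z - RtoC 1 = z * (C_derive (C_derive f) z / C_derive f z))%C.
  by rewrite /q /convexity_quotient; field.
move=> E.
have E2 : (C_derive (C_derive f) z / C_derive f z)%C = slope q z.
  have -> : slope q z = ((z * slope q z) / z)%C by field.
  by rewrite -E; field; split.
by rewrite -E2; field.
Qed.

Lemma kUCV_log_deriv :
  (forall z, unit_disc z -> Cexp (log_integral q z) = C_derive f z) /\
  forall z, unit_disc z -> log_deriv f z = log_integral q z.
Proof.
have [_ [_ [f'0 [_ [Hq _]]]]] := Hf.
apply: (log_branch_eq _ (C_derive (C_derive f)) _ (slope q)) => //.
- by move=> z Hz; exact: holomorphic_cdiff Hf' Hz.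
- by move=> z Hz; exact: cdiff_log_integral.
- exact: log_integral_0.
- exact: kUCV_slope.
Qed.

End FromFunction.

(** The solution of [1 + z f'' / f' = q] with [f 0 = 0] and [f' 0 = 1], inverting
    [convexity_quotient]. *)
Definition primitive_of (q : C -> C) : C -> C := Cint0 (fun zeta => Cexp (log_integral q zeta)).

Section ToFunction.

Variables (q : C -> C).
Hypothesis Hq : holomorphic_on unit_disc q.
Hypothesis Hq0 : q (RtoC 0) = RtoC 1.

Let E (z : C) : C := Cexp (log_integral q z).

Let E_cdiff (z : C) : unit_disc z -> cdiff E z (E z * slope q z)%C.
Proof.
move=> Hz; apply: cdiff_eq (cdiff_comp _ Cexp _ _ _ (cdiff_log_integral q Hq Hq0 z Hz) (cdiff_Cexp _)) _.
rewrite /E; ring.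
Qed.

Lemma primitive_of_cdiff (z : C) : unit_disc z -> cdiff (primitive_of q) z (Cexp (log_integral q z)).
Proof. by move=> Hz; apply: (cdiff_Cint0 E) => //; exact: holomorphic_intro E_cdiff. Qed.

(** Stated for any [f] with the right derivative on the disc, so that it also serves a function
    known only to agree with [primitive_of q] there. *)
Lemma log_deriv_of_derive (f : C -> C) :
  (forall z, unit_disc z -> cdiff f z (E z)) ->
  forall z, unit_disc z -> log_deriv f z = log_integral q z.
Proof.
move=> Hf.
have Ef : forall z, unit_disc z -> C_derive f z = E z by move=> z /Hf /cdiff_C_derive.
have [] // := log_branch_eq (C_derive f) (fun z => E z * slope q z)%C (log_integral q) (slope q).
- by move=> z Hz; exact: derive_eq_on_disc Hf Hz (E_cdiff z Hz).
- by move=> z Hz; exact: cdiff_log_integral.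
- by rewrite Ef; [rewrite /E log_integral_0 Cexp_0 | exact: unit_disc_0].
- exact: log_integral_0.
- by move=> z Hz; rewrite Ef.
Qed.

Lemma primitive_of_kUCV (lambda : C) :
  cls (gamma_of lambda) q ->
  kUCV k (primitive_of q) /\ a2 (primitive_of q) = lambda.
Proof.
move=> [_ [Oq [_ Dq]]].
have Hd := primitive_of_cdiff.
have Ef : forall z, unit_disc z -> C_derive (primitive_of q) z = E z.
  by move=> z /Hd /cdiff_C_derive.
have Ef' : forall z, unit_disc z -> C_derive (C_derive (primitive_of q)) z = (E z * slope q z)%C.
  by move=> z Hz; apply: cdiff_C_derive; exact: derive_eq_on_disc Hd Hz (E_cdiff z Hz).
have En : forall z, E z <> RtoC 0 by move=> z; exact: Cexp_neq_0.
have E0 : E (RtoC 0) = RtoC 1 by rewrite /E log_integral_0 Cexp_0.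
have Eq : forall z, unit_disc z -> convexity_quotient (primitive_of q) z = q z.
  move=> z Hz; rewrite /convexity_quotient Ef // Ef' //.
  have -> : q z = (RtoC 1 + (q z - RtoC 1))%C by ring.
  by rewrite slope_eq_quotient //; field; exact: En.
have U0 := unit_disc_0.
split; last first.
  rewrite /a2 Ef' // E0 slope_0 // Dq derive_P_0 /gamma_of; field.
  exact: alpha1_neq_0.
split; first exact: holomorphic_intro Hd.
split; first exact: Cint0_0.
split; first by rewrite Ef.
split; first by move=> z Hz; rewrite Ef.
split; last by move=> z Hz; rewrite Eq //; exact: Oq.
move=> z Hz; exists (C_derive q z); apply/cdiff_is_derive.
apply: (cdiff_ext_loc q); last exact: holomorphic_cdiff Hq Hz.
by apply: locally_imp (unit_disc_locally _ Hz) => y Hy; rewrite Eq.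
Qed.

End ToFunction.

Lemma V_kUCV_iff (z0 lambda w : C) :
  unit_disc z0 ->
  V_kUCV k z0 lambda w <-> variability_region (Omega k) P (gamma_of lambda) z0 w.
Proof.
move=> Hz0; split.
- move=> [f [Hf [Ha ->]]]; exists (convexity_quotient f); split; first exact: kUCV_schur_class.
  exact: (proj2 (kUCV_log_deriv f Hf)).
- move=> [q [Hq ->]]; have [Hqh [_ [Eq _]]] := Hq; rewrite HP0 in Eq.
  have [H1 H2] := primitive_of_kUCV q Hqh Eq lambda Hq.
  exists (primitive_of q); split => //; split => //; symmetry.
  by apply: log_deriv_of_derive => //; exact: primitive_of_cdiff.
Qed.

Lemma slope_unique (q : C -> C) (z l : C) :
  holomorphic_on unit_disc q -> q (RtoC 0) = RtoC 1 -> unit_disc z ->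
  (q z - RtoC 1 = z * l)%C -> (z = RtoC 0 -> l = C_derive q (RtoC 0)) -> slope q z = l.
Proof.
move=> Hq Hq0 Hz E H0; case: (classic (z = RtoC 0)) => [Ez | Hz0].
  by rewrite Ez slope_0 // H0.
rewrite (slope_eq_quotient q Hq Hq0 z Hz) in E.
have -> : slope q z = ((z * slope q z) / z)%C by field.
by rewrite E; field.
Qed.

(** Both sides vanish at 0 and have equal derivatives, which avoids discussing the integrability of
    the singular integrands. *)
Lemma log_integral_convex (q1 q2 : C -> C) (t : R) (z : C) :
  holomorphic_on unit_disc q1 -> holomorphic_on unit_disc q2 ->
  q1 (RtoC 0) = RtoC 1 -> q2 (RtoC 0) = RtoC 1 -> unit_disc z ->
  log_integral (fun z => RtoC (1 - t) * q1 z + RtoC t * q2 z)%C z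
  = (RtoC (1 - t) * log_integral q1 z + RtoC t * log_integral q2 z)%C.
Proof.
move=> H1 H2 E1 E2; set q := (fun z => _).
have Hd : forall z, unit_disc z -> cdiff q z (RtoC (1 - t) * C_derive q1 z + RtoC t * C_derive q2 z)%C.
  by move=> y Hy; apply: cdiff_plus; apply: cdiff_scal;
    [exact: holomorphic_cdiff H1 Hy | exact: holomorphic_cdiff H2 Hy].
have Hq : holomorphic_on unit_disc q by exact: holomorphic_intro Hd.
have Eq : q (RtoC 0) = RtoC 1 by rewrite /q E1 E2 RtoC_minus; ring.
move: z; apply: (eq_of_derivatives _ _ (fun z => RtoC (1 - t) * slope q1 z + RtoC t * slope q2 z)%C).
- move=> z Hz; apply: cdiff_eq (cdiff_log_integral q Hq Eq z Hz) _.
  apply: slope_unique => //.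
    have -> : (q z - RtoC 1 = RtoC (1 - t) * (q1 z - RtoC 1) + RtoC t * (q2 z - RtoC 1))%C.
      by rewrite /q RtoC_minus; ring.
    by rewrite !slope_eq_quotient //; ring.
  by move=> ->; rewrite !slope_0 // (cdiff_C_derive _ _ _ (Hd _ unit_disc_0)).
- move=> z Hz; apply: cdiff_plus; apply: cdiff_scal; exact: cdiff_log_integral.
- by rewrite !log_integral_0; ring.
Qed.

(** * The region for [|g| < 1]: parametrization, injectivity and convexity *)

Section Interior.

Variables (g z0 : C).
Hypothesis Hg : Cmod g < 1.
Hypothesis Hz0d : unit_disc z0.
Hypothesis Hz0 : z0 <> RtoC 0.

Let Qz : C -> C := Q P g z0.
Let Qd : C -> C := parameter_derivative P g z0.
Let rho : R := / Cmod z0.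

Let region : C -> Prop := variability_region (Omega k) P g z0.

Let rho_gt_1 : 1 < rho.
Proof.
have H : 0 < Cmod z0 by apply/Cmod_gt_0.
have H1 : Cmod z0 < 1 := Hz0d.
by rewrite /rho -Rinv_1; apply: Rinv_lt_contravar => //; lra.
Qed.

Let Q_cdiff (e : C) : disc (RtoC 0) rho e -> cdiff Qz e (Qd e).
Proof. by move=> /(disc_inv_iff z0 e Hz0) He; exact: cdiff_Q. Qed.

Let Q_holomorphic : holomorphic_on (disc (RtoC 0) rho) Qz.
Proof. exact: holomorphic_intro Q_cdiff. Qed.

Let Q_derive (e : C) : disc (RtoC 0) rho e -> C_derive Qz e = Qd e.
Proof. by move=> /Q_cdiff /cdiff_C_derive. Qed.

Let closed_disc_rho (e : C) : Cmod e <= 1 -> disc (RtoC 0) rho e.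
Proof.
by rewrite /disc Cminus_0_r => ?; have := rho_gt_1; lra.
Qed.

Let Qd_neq_0 (e : C) : Cmod e <= 1 -> Qd e <> RtoC 0.
Proof. exact: (parameter_derivative_neq_0 (Omega k) P Om_convex HP Hinj Honto g Hg). Qed.

Let Q_region (e : C) : Cmod e <= 1 -> region (Qz e).
Proof.
move=> He; exists (extremal P g e); split; last exact: Q_log_integral.
exact: extremal_schur_class.
Qed.

Let support (w e : C) : region w -> Cmod e = 1 -> Re ((w - Qz e) / (e * Qd e))%C <= 0.
Proof.
move=> [q [Hq ->]] He; rewrite /Qz Q_log_integral.
exact: (proj1 (comparison (Omega k) P Om_convex HP Hinj Honto HP0 g Hg q e Hq He)).
Qed.

Let region_convex : convex_set region.
Proof.
move=> w1 w2 t [q1 [H1 ->]] [q2 [H2 ->]] Ht.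
exists (fun z => RtoC (1 - t) * q1 z + RtoC t * q2 z)%C; split.
  exact: schur_class_convex.
have [K1 [_ [E1 _]]] := H1; have [K2 [_ [E2 _]]] := H2; rewrite HP0 in E1 E2.
by rewrite log_integral_convex.
Qed.

(* If [w] were not a value of [Q], the function [e Q' / (w - Q)], which vanishes
   at 0, would have nonpositive real part in the disc. *)
Lemma region_in_image (w : C) : region w -> image Qz closed_unit_disc w.
Proof.
move=> Hw; apply: NNPP => Hn.
have Hne : forall e, Cmod e <= 1 -> (w - Qz e <> 0)%C.
  by move=> e He; apply: Cminus_neq_0 => E; apply: Hn; exists e.
have [r [Hr Hrn]] := nonvanishing_extension (fun e => w - Qz e)%C rho rho_gt_1
  ltac:(move=> e He; apply: continuous_Cminus; [exact: continuous_const |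
        exact: holomorphic_continuous Q_holomorphic He]) Hne.
have Hsub : forall e, disc (RtoC 0) r e -> disc (RtoC 0) rho e.
  by move=> e; rewrite /disc; lra.
pose m e := (e * C_derive Qz e / (w - Qz e))%C.
have Hm : holomorphic_on (disc (RtoC 0) r) m.
  move=> e He; have He' := Hsub e He; eexists; apply/cdiff_is_derive.
  apply: cdiff_div; last exact: Hrn.
    apply: cdiff_mult; first exact: cdiff_id.
    exact: holomorphic_cdiff (holomorphic_derive _ _ _ Q_holomorphic) He'.
  exact: cdiff_minus (cdiff_const _ _) (holomorphic_cdiff _ _ _ Q_holomorphic He').
have Hcirc : forall e, Cmod e = 1 -> Re (m e) <= 0.
  move=> e He; have He1 := Req_le _ _ He.
  have He0 := unimodular_neq_0 e He; have Hd := Qd_neq_0 e He1; have Hwn := Hne e He1.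
  have -> : m e = (/ ((w - Qz e) / (e * Qd e)))%C.
    rewrite /m Q_derive; last exact: closed_disc_rho.
    by field; repeat split.
  apply: Re_inv_nonpos; last exact: support.
  move=> E; apply: Hwn.
  have -> : (w - Qz e = (w - Qz e) / (e * Qd e) * (e * Qd e))%C by field; split.
  by rewrite E; ring.
have Hneg : forall e, unit_disc e -> Re (m e) <= 0.
  by move=> e He; apply: (Re_max_principle_center m r 1 0 Hm) => //; [lra | apply: Rlt_le].
have Hmu : holomorphic_on unit_disc m.
  apply/holomorphic_unit_disc; apply: holomorphic_subset Hm => e; rewrite /disc; lra.
have m0 : m (RtoC 0) = RtoC 0 by rewrite /m Cmult_0_l /Cdiv Cmult_0_l.
(* The strong maximum principle makes [m] identically 0, yet at the sample point [1 / 2] none of its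
   factors vanishes. *)
have Hh : unit_disc (RtoC (1 / 2)) by rewrite /unit_disc Cmod_RtoC_nonneg; lra.
have := strong_max_principle m (RtoC 0) Hmu Hneg unit_disc_0 ltac:(by rewrite m0) _ Hh.
rewrite m0 /m Q_derive; last by apply: closed_disc_rho; exact: Rlt_le.
have Hd := Qd_neq_0 _ (Rlt_le _ _ Hh); have Hwn := Hne _ (Rlt_le _ _ Hh).
apply: Cmult_neq_0.
  by apply: Cmult_neq_0 => //; move/RtoC_inj; lra.
move=> E; apply: C1_nz.
have -> : RtoC 1 = ((w - Qz (RtoC (1 / 2))) * / (w - Qz (RtoC (1 / 2))))%C by field.
by rewrite E; ring.
Qed.

Lemma region_image (w : C) : region w <-> image Qz closed_unit_disc w.
Proof. by split; [exact: region_in_image | move=> [e [He ->]]; exact: Q_region]. Qed.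

(** The constant quotient supplied by [comparison] has numerator 0 at [z0], so it is 0
    everywhere. *)
Lemma boundary_unique (q : C -> C) (e : C) :
  cls g q -> Cmod e = 1 -> log_integral q z0 = Qz e ->
  forall z, unit_disc z -> log_integral q z = log_integral (extremal P g e) z.
Proof.
move=> Hq He E z Hz; rewrite /Qz Q_log_integral in E.
have E0 : (log_integral q z0 - log_integral (extremal P g e) z0 = 0)%C by rewrite E; ring.
have [|c [_ Hc]] := proj2 (comparison (Omega k) P Om_convex HP Hinj Honto HP0 g Hg q e Hq He) z0 Hz0d Hz0.
  by rewrite E0 /Cdiv Cmult_0_l.
have Hn : (e * parameter_derivative P g z0 e <> 0)%C.
  by apply: Cmult_neq_0; [exact: unimodular_neq_0 | apply: Qd_neq_0; lra].
have Ec : c = RtoC 0 by apply: (Cmult_eq_0_l _ _ _ Hn); rewrite -Hc.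
by apply: (proj2 (Ceq_minus _ _)); rewrite Hc // Ec; ring.
Qed.

(** Differentiating at [z0] recovers the values of the two extremal functions there; [P], the
    automorphism and multiplication by [z0] are then inverted in turn. *)
Let extremal_log_injective (e1 e2 : C) :
  Cmod e1 <= 1 -> Cmod e2 <= 1 ->
  (forall z, unit_disc z -> log_integral (extremal P g e1) z = log_integral (extremal P g e2) z) ->
  e1 = e2.
Proof.
move=> He1 He2 H.
have [K1 [_ [E1 _]]] := extremal_schur_class (Omega k) P HP Honto g Hg e1 He1.
have [K2 [_ [E2 _]]] := extremal_schur_class (Omega k) P HP Honto g Hg e2 He2.
rewrite HP0 in E1 E2.
have D1 := cdiff_log_integral _ K1 E1 z0 Hz0d; have D2 := cdiff_log_integral _ K2 E2 z0 Hz0d.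
have Es : slope (extremal P g e1) z0 = slope (extremal P g e2) z0.
  apply: (cdiff_unique _ _ _ _ D1); apply: cdiff_ext_loc D2.
  by apply: locally_imp (unit_disc_locally _ Hz0d) => y Hy; rewrite H.
have S1 := slope_eq_quotient _ K1 E1 z0 Hz0d; have S2 := slope_eq_quotient _ K2 E2 z0 Hz0d.
have EP : extremal P g e1 z0 = extremal P g e2 z0.
  have -> : extremal P g e1 z0 = ((extremal P g e1 z0 - RtoC 1) + RtoC 1)%C by ring.
  by rewrite S1 Es -S2; ring.
have L1 : Cmod (z0 * e1) < 1 by rewrite Cmod_mult; exact: Cmod_lt_prod.
have L2 : Cmod (z0 * e2) < 1 by rewrite Cmod_mult; exact: Cmod_lt_prod.
have EM := Hinj _ _ (extremal_in_disc g Hg e1 z0 Hz0d L1) (extremal_in_disc g Hg e2 z0 Hz0d L2) EP.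
have EM' : moebius g (z0 * e1) = moebius g (z0 * e2).
  have -> : moebius g (z0 * e1) = ((z0 * moebius g (z0 * e1)) / z0)%C by field.
  by rewrite EM; field.
have EZ : (z0 * e1 = z0 * e2)%C.
  by rewrite -(moebius_inverse g (z0 * e1)) // ?EM' ?moebius_inverse //; lra.
have -> : e1 = ((z0 * e1) / z0)%C by field.
by rewrite EZ; field.
Qed.

(* The function [(Q (c x) - Q x) / (x Q' x)] has value [c - 1] at 0 and
   nonpositive real part, so it vanishes in the disc only for [c = 1]. *)
Lemma Q_injective_interior (c e : C) :
  Cmod c <= 1 -> unit_disc e -> e <> RtoC 0 -> Qz (c * e)%C = Qz e -> c = RtoC 1.
Proof.
move=> Hc He He0 EQ.
have Hin : forall x, disc (RtoC 0) rho x -> disc (RtoC 0) rho (c * x)%C.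
  move=> x; rewrite /disc !Cminus_0_r.
  by rewrite Cmod_mult => Hx; have := Cmod_ge_0 x; nra.
pose S x := (Qz (c * x)%C - Qz x)%C.
have HS : forall x, disc (RtoC 0) rho x -> cdiff S x (c * Qd (c * x) - Qd x)%C.
  move=> x Hx; apply: cdiff_minus; last exact: Q_cdiff.
  by apply: cdiff_scale; apply: Q_cdiff; exact: Hin.
have HSh := holomorphic_intro _ _ _ HS.
have HSh' := holomorphic_derive _ _ _ HSh.
have Hrho0 : 0 < rho by have := rho_gt_1; lra.
have D0 := disc_center (RtoC 0) _ Hrho0.
pose S1 := slope S.
have HS1 : holomorphic_on (disc (RtoC 0) rho) S1 by exact: (radial_mean_holomorphic rho _ HSh' 0).
have S0 : S (RtoC 0) = RtoC 0 by rewrite /S Cmult_0_r; ring.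
have ES : forall x, disc (RtoC 0) rho x -> S x = (x * S1 x)%C.
  by move=> x Hx; rewrite (holomorphic_quotient _ _ _ HSh Hx) S0 /S1 /slope; ring.
have S10 : S1 (RtoC 0) = ((c - 1) * Qd (RtoC 0))%C.
  have := radial_mean_0 _ _ HSh' 0 Hrho0; rewrite /= Cmult_1_l /S1 /slope => ->.
  by rewrite (cdiff_C_derive _ _ _ (HS _ D0)) Cmult_0_r; ring.
have HQ' := holomorphic_derive _ _ _ Q_holomorphic.
have [r [Hr Hrn]] := nonvanishing_extension (C_derive Qz) rho rho_gt_1
  ltac:(move=> x Hx; exact: holomorphic_continuous HQ' Hx)
  ltac:(move=> x Hx; rewrite Q_derive; [exact: Qd_neq_0 | exact: closed_disc_rho]).
have Hsub : forall x, disc (RtoC 0) r x -> disc (RtoC 0) rho x.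
  by move=> x; rewrite /disc; lra.
pose B x := (S1 x / C_derive Qz x)%C.
have HB : holomorphic_on (disc (RtoC 0) r) B.
  move=> x Hx; have Hx' := Hsub x Hx; eexists; apply/cdiff_is_derive.
  apply: cdiff_div; [| | exact: Hrn].
    exact: holomorphic_cdiff HS1 Hx'.
  exact: holomorphic_cdiff HQ' Hx'.
(* As [|c| <= 1], the value of [Q] at [c * x] belongs to the region, so the support inequality at
   the boundary parameter [x] applies to it. *)
have Hcirc : forall x, Cmod x = 1 -> Re (B x) <= 0.
  move=> x Hx; have Hx1 := Req_le _ _ Hx; have Hxr := closed_disc_rho x Hx1.
  have Hx0 := unimodular_neq_0 x Hx; have Hd := Qd_neq_0 x Hx1.
  have Hcx : Cmod (c * x) <= 1 by rewrite Cmod_mult Hx; lra.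
  have := support _ x (Q_region _ Hcx) Hx.
  rewrite -/(S x) ES // /B Q_derive //; congr (Re _ <= 0).
  by field; split.
have Hneg : forall x, unit_disc x -> Re (B x) <= 0.
  by move=> x Hx; apply: (Re_max_principle_center B r 1 0 HB) => //; [lra | apply: Rlt_le].
have HBu : holomorphic_on unit_disc B.
  apply/holomorphic_unit_disc; apply: holomorphic_subset HB => x; rewrite /disc; lra.
have Her := closed_disc_rho e (Rlt_le _ _ He).
have Be : B e = RtoC 0.
  have E : S1 e = RtoC 0.
    apply: (Cmult_eq_0_l e) => //; rewrite -ES // /S EQ; ring.
  by rewrite /B E /Cdiv Cmult_0_l.
have HB0 := strong_max_principle B e HBu Hneg He ltac:(by rewrite Be) e He.
have Q0 := Qd_neq_0 (RtoC 0) ltac:(rewrite Cmod_0; lra).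
have B0 : B (RtoC 0) = (c - 1)%C by rewrite /B S10 Q_derive //; field.
rewrite Be B0 in HB0.
by apply: (proj2 (Ceq_minus _ _)).
Qed.

(** If one parameter is unimodular, uniqueness at boundary points identifies the extremal functions.
    If both are interior, [c] is the quotient of the one of smaller modulus by the other. *)
Lemma Q_injective : injective_on closed_unit_disc Qz.
Proof.
have Hbd : forall e1 e2, Cmod e1 <= 1 -> Cmod e2 = 1 -> Qz e1 = Qz e2 -> e1 = e2.
  move=> e1 e2 He1 He2 E; apply: extremal_log_injective => //; first lra.
  apply: boundary_unique => //; first exact: extremal_schur_class.
  by rewrite -E /Qz Q_log_integral.
have Hint : forall e1 e2, Cmod e1 <= Cmod e2 -> Cmod e2 < 1 -> Qz e1 = Qz e2 -> e1 = e2.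
  move=> e1 e2 H12 He2 E; case: (classic (e2 = RtoC 0)) => [E2 | Hn].
    rewrite E2 Cmod_0 in H12; rewrite E2; apply: Cmod_eq_0.
    by apply: Rle_antisym => //; exact: Cmod_ge_0.
  have Ec : (e1 / e2 * e2 = e1)%C by field.
  have Hc : (e1 / e2)%C = RtoC 1.
    apply: (Q_injective_interior _ e2) => //; last by rewrite Ec.
    by apply: Cmod_div_le => //; lra.
  by rewrite -Ec Hc; ring.
move=> e1 e2; rewrite /closed_unit_disc => He1 He2 E.
case: (Req_dec (Cmod e2) 1) => H2; first exact: Hbd.
case: (Req_dec (Cmod e1) 1) => H1; first by symmetry; apply: Hbd.
case: (Rle_dec (Cmod e1) (Cmod e2)) => H; first by apply: Hint => //; lra.
by symmetry; apply: Hint; [lra | lra | symmetry].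
Qed.

Let Q_holomorphic_unit : holomorphic_on unit_disc Qz.
Proof. by apply: holomorphic_subset Q_holomorphic => e He; apply: closed_disc_rho; exact: Rlt_le. Qed.

Let Q_injective_unit : injective_on unit_disc Qz.
Proof. by move=> e1 e2 H1 H2; apply: Q_injective; exact: Rlt_le. Qed.

(** The image of the open disc is open, so [w] can be moved by [d / 2] along the outer normal
    [e * Qd e] and still satisfies the weak inequality; the displacement contributes the positive
    number [s]. *)
Let strict_support (w e : C) :
  image Qz unit_disc w -> Cmod e = 1 -> Re ((w - Qz e) / (e * Qd e))%C < 0.
Proof.
move=> Hw He; have He1 := Req_le _ _ He.
have Hn : (e * Qd e <> 0)%C by apply: Cmult_neq_0; [exact: unimodular_neq_0 | exact: Qd_neq_0].
have [d [Hd Hball]] := proj1 (locally_Cmod _ _) (injective_image_open Qz Q_holomorphic_unit Q_injective_unit w Hw).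
have Hp : 0 < Cmod (e * Qd e) by apply/Cmod_gt_0.
pose s := d / (2 * Cmod (e * Qd e)).
have Hs : 0 < s by apply: Rdiv_lt_0_compat; lra.
have [e' [He' Ew]] : image Qz unit_disc (w + RtoC s * (e * Qd e))%C.
  apply: Hball; have -> : (w + RtoC s * (e * Qd e) - w = RtoC s * (e * Qd e))%C by ring.
  rewrite Cmod_mult Cmod_RtoC_nonneg; last lra.
  by rewrite /s; have -> : d / (2 * Cmod (e * Qd e)) * Cmod (e * Qd e) = d / 2; [field | ]; lra.
have := support _ e (Q_region e' (Rlt_le _ _ He')) He.
rewrite -Ew.
have -> : ((w + RtoC s * (e * Qd e) - Qz e) / (e * Qd e) = (w - Qz e) / (e * Qd e) + RtoC s)%C.
  by field; split; [exact: Qd_neq_0 | exact: unimodular_neq_0].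
by rewrite re_plus /=; lra.
Qed.

(** A convex combination of two image points lies in the convex region, hence is a value of [Q] on
    the closed disc. A unimodular parameter is excluded, since the combination of the two strict
    support inequalities would be 0. *)
Lemma Q_convex : convex_univalent_analytic_on_closed_disc Qz.
Proof.
split.
  exists (disc (RtoC 0) rho); split; first by move=> z; exact: disc_locally.
  by split; [exact: closed_disc_rho | exact: Q_holomorphic].
split; first exact: Q_injective.
split; first exact: injective_image_open.
split; first by exists (Qz (RtoC 0)), (RtoC 0); split => //; exact: unit_disc_0.
move=> w1 w2 t H1 H2 Ht.
have R1 : region w1 by have [e1 [He1 ->]] := H1; apply: Q_region; exact: Rlt_le.
have R2 : region w2 by have [e2 [He2 ->]] := H2; apply: Q_region; exact: Rlt_le.
have [e [He Ee]] := region_in_image _ (region_convex w1 w2 t R1 R2 Ht).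
case: (Rle_lt_or_eq_dec _ _ He) => He1; first by exists e.
exfalso.
have S1 := strict_support w1 e H1 He1; have S2 := strict_support w2 e H2 He1.
have Hn1 := unimodular_neq_0 e He1; have Hn2 := Qd_neq_0 e He.
have E0 : (RtoC (1 - t) * ((w1 - Qz e) / (e * Qd e)) + RtoC t * ((w2 - Qz e) / (e * Qd e)) = 0)%C.
  have -> : (RtoC (1 - t) * ((w1 - Qz e) / (e * Qd e)) + RtoC t * ((w2 - Qz e) / (e * Qd e))
    = ((RtoC (1 - t) * w1 + RtoC t * w2) - Qz e) / (e * Qd e))%C.
    by rewrite RtoC_minus; field; split.
  by rewrite Ee /Cdiv; ring.
have : Re (RtoC (1 - t) * ((w1 - Qz e) / (e * Qd e)) + RtoC t * ((w2 - Qz e) / (e * Qd e)))%C = 0.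
  by rewrite E0.
rewrite re_plus !re_scal_l; nra.
Qed.

End Interior.

End Main.

Theorem corollary2p1 (k : R) (P : C -> C) (z0 lambda : C) :
  0 <= k ->
  is_conformal_map_onto_Omega k P ->
  unit_disc z0 -> z0 <> RtoC 0 ->
  Cmod lambda <= alpha1 P / 2 ->
  let gamma1 : C := (RtoC 2 * lambda / RtoC (alpha1 P))%C in
  (Cmod gamma1 = 1 ->
     forall w : C,
       V_kUCV k z0 lambda w <->
       w = Cint0 (fun zeta : C => (/ zeta * (P (gamma1 * zeta) - RtoC 1))%C) z0)
  /\
  (Cmod gamma1 < 1 ->
     (forall w : C,
        V_kUCV k z0 lambda w <-> image (Q P gamma1 z0) closed_unit_disc w)
     /\ convex_univalent_analytic_on_closed_disc (Q P gamma1 z0)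
     /\ (forall (eps : C) (f : C -> C),
           Cmod eps = 1 -> kUCV k f -> a2 f = lambda ->
           (log_deriv f z0 = Q P gamma1 z0 eps <->
            forall z : C, unit_disc z ->
              f z = Cint0 (fun zeta : C => Cexp (Q P gamma1 zeta eps)) z))).
Proof.
move=> Hk [HP [Hinj [Honto [HP0 [HPim HPre]]]]] Hz0d Hz0 _ gamma1.
have Viff := V_kUCV_iff k P HP0 HPim HPre.
split=> Hg.
  move=> w; split.
  - move=> /(Viff z0 lambda w Hz0d) [q [Hq ->]]; apply: Cint0_ext => // y Hy.
    by rewrite (schur_class_unimodular (Omega k) P HP Hinj Honto gamma1 q Hg Hq y Hy).
  - move=> ->; apply/(Viff _ _ _ Hz0d); exists (fun z => P (gamma1 * z)%C); split => //.
    by apply: rotation_schur_class => //; exact: Req_le.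
have Hreg := region_image k P Hk HP Hinj Honto HP0 gamma1 z0 Hg Hz0d Hz0.
split; last split.
- move=> w; split.
  + by move=> /(Viff z0 lambda w Hz0d) /(Hreg w).
  + by move=> /(Hreg w) H; apply/(Viff _ _ _ Hz0d).
- exact: (Q_convex k P Hk HP Hinj Honto HP0 gamma1 z0 Hg Hz0d Hz0).
move=> eps f He Hf Ha.
have Hcls := kUCV_schur_class k P HP0 HPim HPre f lambda Hf Ha.
have [Hexp Hlog] := kUCV_log_deriv k f Hf.
have [Kx [_ [Ex _]]] := extremal_schur_class (Omega k) P HP Honto gamma1 Hg eps (Req_le _ _ He).
rewrite HP0 in Ex.
have Hext : forall z, Cint0 (fun zeta => Cexp (Q P gamma1 zeta eps)) z
    = primitive_of (extremal P gamma1 eps) z.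
  move=> z; rewrite /primitive_of; congr (Cint0 _ z); apply: functional_extensionality => y.
  by rewrite Q_log_integral.
split.
- rewrite Hlog // => E z Hz; rewrite Hext.
  (* Agreement at the single point [z0] identifies [log f'] with the extremal integral on the whole
     disc; [f] and its claimed formula then share their derivative and their value at 0. *)
  have HL := boundary_unique k P Hk HP Hinj Honto HP0 gamma1 z0 Hg Hz0d Hz0 _ eps Hcls He E.
  move: z Hz; apply: (eq_of_derivatives _ _ (fun z => Cexp (log_integral (extremal P gamma1 eps) z))).
  + move=> z Hz; rewrite -HL // Hexp //; exact: holomorphic_cdiff (proj1 Hf) Hz.
  + exact: primitive_of_cdiff.
  + by rewrite (proj1 (proj2 Hf)) /primitive_of Cint0_0.
- move=> Hfz; rewrite Q_log_integral; apply: log_deriv_of_derive => // z Hz.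
  apply: (cdiff_ext_loc (primitive_of (extremal P gamma1 eps))).
    by apply: locally_imp (unit_disc_locally _ Hz) => y Hy; rewrite (Hfz y Hy); exact: eq_sym (Hext y).
  exact: primitive_of_cdiff.
Qed.
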